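(* Suppose assumptions (A1)–(A8) listed in the context hold, let $K_{\max}$ be a pre-specified upper bound with $K<K_{\max}$, and let $\hat K$ be a minimizer over $1\le L\le K_{\max}$ of $$BIC_L=-\max_{\tau_1',\dots,\tau_L'}R(\tau_1',\dots,\tau_L')+L\,C_N ,$$ where the maximum is over admissible partitions with $L$ change points. If, as $N\to\infty$, $$\frac{C_N}{N}\to0\qquad\text{and}\qquad \frac{C_N}{N^{\frac{q+3+2q\alpha}{2q}}}\to\infty,$$ then $P(\hat K=K)\to1$.
   Context: Model. $K\ge 1$ is a fixed (unknown) integer and $0=\kappa_0^0<\kappa_1^0<\dots<\kappa_K^0<\kappa_{K+1}^0=1$ are constants. For sample size $N$ put $\tau_k^0=[\kappa_k^0N]$ (integer part), so $\tau_0^0=0$, $\tau_{K+1}^0=N$. The observations are $$X_t=\sum_{j=-\infty}^{\infty}a_j(k)\,\xi_{t-j},\qquad \tau_{k-1}^0<t\le\tau_k^0,\quad k=1,\dots,K+1,$$ where $(\xi_t)_{t\in\mathbb Z}$ are i.i.d. with mean $0$ and variance $\sigma^2$ and $\sum_j|a_j(k)|<\infty$ for each $k$. The spectral density of the $k$-th segment is $f_k(\lambda)=\sigma^2\bigl|\sum_j a_j(k)e^{-ij\lambda}\bigr|^2$, $\lambda\in[-\pi,\pi]$. Spectral estimator. For $0\le a<b\le N$ let $I_{a+1,b}(\lambda)=\frac1{b-a}\bigl|\sum_{j=a+1}^{b}X_je^{-ij\lambda}\bigr|^2$. With spectral window $W$ and bandwidth parameter $m=m_N$, the smoothed estimator from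 $X_{a+1},\dots,X_b$ is $m\int_{-\pi}^{\pi}W(m(\lambda-u))I_{a+1,b}(u)\,du$. For a partition $0=\tau_0<\tau_1<\dots<\tau_L<\tau_{L+1}=N$, $\hat f_k$ denotes the estimator from $X_{\tau_{k-1}+1},\dots,X_{\tau_k}$; $\hat f_0$ denotes the estimator from the whole sample $X_1,\dots,X_N$. The function $w(v)=\int W(u)e^{iuv}\,du$ is the inverse Fourier transform of $W$. Objective function. For a nonnegative function $g$ on $[-\pi,\pi]$, $st(g)=g/\int_{-\pi}^{\pi}g(u)\,du$. Let $f$ be a baseline spectral density function which is different from all the $f_k$; the two choices considered are $f=\hat f_0$ and (when it is known that the data is not white noise) $st(f)=\frac1{2\pi}$. For $L$ change points define, with $\tau_0=0$, $\tau_{L+1}=N$, $$R(\tau_1,\dots,\tau_{L})=\sum_{k=1}^{L+1}(\tau_k-\tau_{k-1})\int_{-\pi}^{\pi}\hat f_k(u)\log\frac{st(\hat f_k)(u)}{st(f)(u)}\,du .$$ Estimated spectra are computed on a grid of frequencies $\Lambda=\{\lambda_1,\dots,\lambda_{N_\lambda}\}\subset[-\pi,\pi]$ with $N_\lambda\le N$, where $N_\lambda$ may tend to infinity with $N$ (e.g. $N_\lambda=N$); the integrals in $R$ and in $st$ denote the corresponding sums over $\Lambda$, and the grid is such that the resulting Kullback–Leibler divergence of normalized spectral densities is nonnegative and vanishes if and only if the two normalized spectral densities are equal on $[-\pi,\pi]$. A partition with $L$ change points is admissible if $\tau_k-\tau_{k-1}\ge \mathrm{ml}$ for $k=1,\dots,L+1$,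 where $\mathrm{ml}$ is the minimal segment length (values of $L$ for which no admissible partition exists are not candidates for $\hat K$). Assumptions. (A1) $E\xi_t^{8q}<\infty$ for some integer $q\ge3$, and $\{a_j(k)\}_j$ is absolutely summable for every $k$. (A2) $W$ is nonnegative, even, bounded, integrable, $\int_{-\pi}^{\pi}W(v)\,dv=1$, and $\int_{-\pi}^{\pi}W(v)^{1-\frac1{2q}}\,dv<\infty$. (A3) With $N_{\min}=\min_{1\le k\le K+1}(\tau_k^0-\tau_{k-1}^0)$: $N_{\min}/N\to c_{\min}>0$ as $N\to\infty$, and $N_{\min}>m$. (A4) Each $f_k$ is everywhere positive and $|f_k(u_1)-f_k(u_2)|\le B_{f_k}|u_1-u_2|$ for all $u_1,u_2\in[-\pi,\pi]$, with $B_{f_k}$ a constant. (A5) $m$ is of order $N^{\alpha}$ (bounded above and below by positive constant multiples of $N^\alpha$), where $\frac14\le\alpha<\alpha+\frac3{2q}<\frac12$. (A6) $w(0)=1$ and $w$ has continuous derivatives up to order $2q$. (A7) $\{f_k\}_{k=1}^{K+1}$ are linearly independent functions on $[-\pi,\pi]$. (A8) $\mathrm{ml}=c_{\mathrm{ml}}N$ with $c_{\mathrm{ml}}>0$, and $\mathrm{ml}<N_{\min}$.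
   Formalization: For grids changing with N, the Kullback–Leibler divergence of distinct normalized segment spectra must have positive lower limit, not merely be nonzero for each N (else the claim fails); grid integrals are sums times 2π/N_λ. *)

(* Defs.v *)
From HB Require Import structures.
From mathcomp Require Import all_boot all_order all_algebra.
From mathcomp Require Import all_classical all_reals all_analysis.

Set Implicit Arguments.
Unset Strict Implicit.
Unset Printing Implicit Defensive.

Import Order.TTheory GRing.Theory Num.Theory.
Import numFieldNormedType.Exports.

Local Open Scope classical_set_scope.
Local Open Scope ring_scope.

Section Probability.
Context {d : measure_display} {T : measurableType d} {R : realType}.

Definition mutually_independent (P : probability T R) (I : choiceType)
    (Y : I -> T -> R) : Prop :=
  forall (s : seq I) (B : I -> set R), uniq s ->
    (forall i, measurable (B i)) ->
    P (\bigcap_(i in [set` s]) (Y i @^-1` B i)) =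
      (\prod_(i <- s) P (Y i @^-1` B i))%E.

Definition identically_distributed (P : probability T R) (I : Type)
    (Y : I -> T -> R) : Prop :=
  forall (i j : I) (B : set R), measurable B ->
    P (Y i @^-1` B) = P (Y j @^-1` B).

End Probability.

Section SpectralModel.
Context {R : realType}.

(* sum of F j over the integers -n <= j <= n; two-sided series are read as
   limits of these sums (all those considered converge absolutely) *)
Definition zsum (F : int -> R) (n : nat) : R :=
  \sum_(i < n.*2.+1) F (i%:Z - n%:Z).

(* sigma^2 |sum_j a_j e^(-ij lambda)|^2, with |z|^2 = (Re z)^2 + (Im z)^2 *)
Definition spectral_density (sigma : R) (a : int -> R) (lambda : R) : R :=
  sigma ^+ 2 *
    (limn (zsum (fun j => a j * cos (j%:~R * lambda))) ^+ 2 +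
     limn (zsum (fun j => a j * sin (j%:~R * lambda))) ^+ 2).

(* tau_k^0 = [kappa_k^0 N] *)
Definition true_cp (kappa : nat -> R) (N k : nat) : nat :=
  Num.truncn (kappa k * N%:R).

(* the default value N of the iterated minimum is harmless: no segment is
   longer than N *)
Definition Nmin (K : nat) (kappa : nat -> R) (N : nat) : nat :=
  \big[minn/N]_(k < K.+1) (true_cp kappa N k.+1 - true_cp kappa N k)%N.

Definition lin_indep_on (D : set R) (n : nat) (f : 'I_n -> R -> R) : Prop :=
  forall c : 'I_n -> R,
    (forall u, D u -> \sum_(k < n) c k * f k u = 0) -> forall k, c k = 0.

Definition has_cont_derivs (n : nat) (g : R -> R) : Prop :=
  (forall i, (i < n)%N -> forall v, derivable (derive1n i g) v 1) /\
  (forall i, (i <= n)%N -> continuous (derive1n i g)).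

(* real and imaginary parts of w(v) = int W(u) e^(iuv) du *)
Definition invFourier_re (W : R -> R) (v : R) : R :=
  \int[lebesgue_measure]_u (W u * cos (u * v)).
Definition invFourier_im (W : R -> R) (v : R) : R :=
  \int[lebesgue_measure]_u (W u * sin (u * v)).

End SpectralModel.

Section Objective.
Context {R : realType}.

(* In this section x is an observed path, of which only x 1, ..., x N matter. *)

(* I_{a+1,b}, computed from x_{a+1}, ..., x_b *)
Definition periodogram (x : nat -> R) (a b : nat) (lambda : R) : R :=
  ((\sum_(a.+1 <= j < b.+1) x j * cos (j%:R * lambda)) ^+ 2 +
   (\sum_(a.+1 <= j < b.+1) x j * sin (j%:R * lambda)) ^+ 2) / (b - a)%:R.

Definition spec_est (W : R -> R) (m : R) (x : nat -> R) (a b : nat)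
    (lambda : R) : R :=
  m * \int[lebesgue_measure]_(u in `[- pi, pi])
        (W (m * (lambda - u)) * periodogram x a b u).

(* The sum over the grid that stands for the integral over [-pi, pi].  The
   factor makes it the average over the grid times the length 2 pi, so that a
   constant function has normalization 1 / (2 pi). *)
Definition grid_int (Lam : seq R) (g : R -> R) : R :=
  (2 * pi) / (size Lam)%:R * \sum_(u <- Lam) g u.

Definition st (Lam : seq R) (g : R -> R) (u : R) : R := g u / grid_int Lam g.

Definition KLdiv (Lam : seq R) (g h : R -> R) : R :=
  grid_int Lam (fun u => st Lam g u * ln (st Lam g u / st Lam h u)).

(* The n-th grid may change with n, so the divergence associated with the grids
   is taken asymptotically: it vanishes when its lower limit is 0.  For a grid
   that does not depend on n this is the divergence itself.  Vanishing for each
   fixed n would not be enough: grids may concentrate where g and h agree, and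
   then the divergence tends to 0 although it is positive for every n. *)
Definition grid_separates (Lam : nat -> seq R) (g h : R -> R) : Prop :=
  (forall n, 0 <= KLdiv (Lam n) g h) /\
  (limn_einf (fun n => (KLdiv (Lam n) g h)%:E) = 0%E <->
   \forall n \near \oo,
     forall u, u \in `[- pi, pi] -> st (Lam n) g u = st (Lam n) h u).

(* the baseline is either the estimate from the whole sample or a constant
   spectrum, st(f) = 1 / (2 pi) *)
Inductive baseline := whole_sample | white_noise.

Definition st_baseline (B : baseline) (Lam : seq R) (W : R -> R) (m : R)
    (N : nat) (x : nat -> R) (u : R) : R :=
  match B with
  | whole_sample => st Lam (spec_est W m x 0 N) u
  | white_noise => 1 / (2 * pi)
  end.

(* tau 0 = 0 < tau 1 < ... < tau L < tau (L + 1) = N; the values of tau beyond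
   L + 1 are irrelevant *)
Definition admissible (N : nat) (ml : R) (L : nat) (tau : nat -> nat) : Prop :=
  [/\ tau 0%N = 0%N, tau L.+1 = N &
      forall k, (k <= L)%N ->
        (tau k < tau k.+1)%N /\ ml <= (tau k.+1 - tau k)%:R].

Definition objective (B : baseline) (Lam : seq R) (W : R -> R) (m : R)
    (N : nat) (x : nat -> R) (L : nat) (tau : nat -> nat) : R :=
  \sum_(k < L.+1) (tau k.+1 - tau k)%:R *
    (let fk := spec_est W m x (tau k) (tau k.+1) in
     grid_int Lam (fun u =>
       fk u * ln (st Lam fk u / st_baseline B Lam W m N x u))).

(* the supremum is a maximum: the objective takes finitely many values on
   admissible partitions *)
Definition BIC (B : baseline) (Lam : seq R) (W : R -> R) (m : R)
    (N : nat) (x : nat -> R) (ml C : R) (L : nat) : R :=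
  - sup [set objective B Lam W m N x L tau | tau in admissible N ml L]
  + L%:R * C.

Definition candidate (N : nat) (ml : R) (Kmax L : nat) : Prop :=
  (1 <= L <= Kmax)%N /\ exists tau, admissible N ml L tau.

Definition BIC_minimizer (B : baseline) (Lam : seq R) (W : R -> R) (m : R)
    (N : nat) (x : nat -> R) (ml C : R) (Kmax L : nat) : Prop :=
  candidate N ml Kmax L /\
  forall L', candidate N ml Kmax L' ->
    BIC B Lam W m N x ml C L <= BIC B Lam W m N x ml C L'.

End Objective.

(* Main.v *)
(** Write cnt_l(x,y) for the number of times of ]x,y] that lie in the l-th true
    segment.  The quantity (y - x) est_{x,y}(u) is a quadratic form in the
    observations.  Truncate the linear processes: the centred form is then a
    quadratic form in finitely many innovations, and its 2q-th moment is at most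
    a constant times (N m)^q.  Its mean is kap(u) sum_l cnt_l(x,y) f_l(u), where
    kap(u), between 1/2 and 1, is the mass that the rescaled window centred at u
    has in [-pi, pi], up to O(sqrt N + N / m) and an arbitrarily small multiple
    of the number of times of ]x,y] outside a segment of one's choice (times of
    two different segments only interact near a change point).  By Markov's
    inequality and a union bound over all x, y, u the error is O(rho), with
    rho = N^((q+3+2q alpha)/(2q)), uniformly, with probability tending to 1.

    On that event the rest is deterministic.  Let theta_l be the contribution per
    unit of time of the l-th true segment.  A segment ]x,y] of a partition
    contributes at most sum_l cnt_l(x,y) theta_l + O(rho), minus a constant times
    the number of its times outside its dominant true segment, because the
    divergences of the spectra from a mixture of them are bounded below.  The true
    partition attains the sum of the theta_l up to O(rho).  A partition with fewer
    than K change points puts a whole true segment, a positive fraction of N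
    times, outside the dominant ones; one with more gains O(rho).  As C_N is
    negligible with respect to N and dominates rho, the minimizer is K. *)

Require Import Defs.
From HB Require Import structures.
From mathcomp Require Import all_boot all_order all_algebra.
From mathcomp Require Import all_classical all_reals all_analysis measurable_realfun.
From mathcomp Require Import ring lra zify.

Set Implicit Arguments.
Unset Strict Implicit.
Unset Printing Implicit Defensive.

Import Order.TTheory GRing.Theory Num.Theory.
Import numFieldNormedType.Exports.

Local Open Scope classical_set_scope.
Local Open Scope ring_scope.

(** * Products of independent random variables *)

Import HBNNSimple.

(** The exponent of rho is an exact budget. There are at most of order N^3 triples (x, y, u);
    Markov's inequality of order 2q bounds the probability of each exception by (N m)^q / rho^(2q),
    up to a constant, and with m of order N^alpha the total is of order N^(- q alpha).

    Only absolute summability of the coefficients is known, so covariances across a change point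
    have no rate: they cost eps times the number of foreign times. A true segment has none, and
    elsewhere the divergence loses a fixed amount per foreign time, which absorbs eps. The estimator
    is thus controlled only up to a part proportional to the very loss it competes with.

    The window is cut at -pi and pi, so the estimator targets kap f_l instead of f_l. As kap is the
    same for all segments, it reweights frequencies by a factor between 1/2 and 1, and the lower
    bounds on the divergences survive.

    The series that define the observations converge almost surely, which is enough to carry bounds
    on probabilities over from the truncations: no moment of an observation is ever taken. *)

Section Independence.
Context {d : measure_display} {T : measurableType d} {R : realType}.
Variable P : probability T R.

(** The hypothesis says that the law of [f] under the measure with density [Y] is [y] times its law
    under [P]. Linearity extends this to simple functions and monotone convergence to [g]. The other
    variables occur only through the weight [Y], so that no generated sigma-algebra is needed. *)
Lemma ge0_integral_factor (f : T -> R) (Y : T -> R) (y : R) :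
  measurable_fun [set: T] f -> measurable_fun [set: T] Y -> (forall w, 0 <= Y w) ->
  0 <= y ->
  (forall B : set R, measurable B ->
     \int[P]_(w in f @^-1` B) (Y w)%:E = P (f @^-1` B) * y%:E)%E ->
  forall g : R -> \bar R, measurable_fun [set: R] g -> (forall r, 0 <= g r)%E ->
    (\int[P]_w (g (f w) * (Y w)%:E) = (\int[P]_w g (f w)) * y%:E)%E.
Proof.
move=> mf mY Y0 y0 H g mg g0.
have mT : measurable [set: R] by [].
have mY' : measurable_fun [set: T] (fun w => (Y w)%:E) by exact/measurable_EFinP.
pose g_ := nnsfun_approx mT mg.
have cg r : ((g_ n r)%:E @[n --> \oo] --> g r)%E.
  by apply: cvg_nnsfun_approx => // x _; exact: g0.
have mgf n : measurable_fun [set: T] (fun w => (g_ n (f w))%:E).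
  by apply/measurable_EFinP/measurableT_comp => //; exact: measurable_funP.
have nd r m n : (m <= n)%N -> ((g_ m r)%:E <= (g_ n r)%:E)%E.
  by move=> mn; rewrite lee_fin; exact/lefP/nd_nnsfun_approx.
have mfB (B : set R) : measurable B -> measurable (f @^-1` B).
  by move=> mB; rewrite -(setTI (_ @^-1` _)); exact: mf.
have step n : (\int[P]_w ((g_ n (f w))%:E * (Y w)%:E) =
               (\int[P]_w (g_ n (f w))%:E) * y%:E)%E.
  have E w : ((g_ n (f w))%:E = \sum_(k \in range (g_ n))
      (k%:E * (\1_(f @^-1` (g_ n @^-1` [set k])) w)%:E))%E.
    by rewrite [in LHS]fimfunE -fsumEFin.
  have mp k : measurable (f @^-1` (g_ n @^-1` [set k])) by exact: mfB.
  have k0 k w : (0 <= k%:E * (\1_(f @^-1` (g_ n @^-1` [set k])) w)%:E :> \bar R)%E.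
    exact: nnfun_muleindic_ge0.
  under eq_integral.
    move=> w _; rewrite E ge0_mule_fsuml//. over.
  under [in RHS]eq_integral do rewrite E.
  rewrite !ge0_integral_fsum//; last 3 first.
  - move=> k; apply/emeasurable_funM => //.
    by apply/measurable_EFinP/measurable_indic.
  - move=> k; apply/emeasurable_funM => //; apply/emeasurable_funM => //.
    by apply/measurable_EFinP/measurable_indic.
  - by move=> k w _; apply: mule_ge0; [exact: k0|rewrite lee_fin].
  rewrite ge0_mule_fsuml; last first.
    by move=> k; apply: integral_ge0.
  apply: eq_fsbigr => k; rewrite inE /= => -[x _ kx].
  have k00 : 0 <= k by rewrite -kx.
  under eq_integral do rewrite -muleA.
  rewrite ge0_integralZl//; last 2 first.
  - apply/emeasurable_funM => //.
    by apply/measurable_EFinP/measurable_indic.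
  - by move=> w _; rewrite mule_ge0// lee_fin.
  rewrite ge0_integralZl//; last by apply/measurable_EFinP/measurable_indic.
  rewrite -muleA; congr (_ * _)%E.
  rewrite integral_indic// setIT -H//.
  under eq_integral do rewrite muleC.
  by rewrite [RHS]integral_mkcond; apply: eq_integral => w _; rewrite epatch_indic.
transitivity (limn (fun n => \int[P]_w ((g_ n (f w))%:E * (Y w)%:E))%E).
  rewrite -monotone_convergence//.
  - apply: eq_integral => w _; apply/esym/cvg_lim => //.
    exact: cvgeZr.
  - by move=> n; apply/emeasurable_funM.
  - by move=> n w _; rewrite mule_ge0// lee_fin.
  - by move=> w _ m n mn; apply: lee_wpmul2r; [rewrite lee_fin|exact: nd].
under eq_fun do rewrite step.
rewrite [in RHS](_ : (\int[P]_w g (f w) = limn (fun n => \int[P]_w (g_ n (f w))%:E))%E); last first.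
  rewrite -monotone_convergence//.
  - by apply: eq_integral => w _; apply/esym/cvg_lim => //.
  - by move=> n w _; rewrite lee_fin.
  - by move=> w _ m n mn; exact: nd.
apply/cvg_lim => //; apply: cvgeZr => //.
apply: ereal_nondecreasing_is_cvgn => m n mn.
apply: ge0_le_integral => // w _; [by rewrite lee_fin|exact: nd].
Qed.


Variables (I : choiceType) (Y : I -> T -> R).
Hypothesis mY : forall i, measurable_fun [set: T] (Y i).
Hypothesis indepY : mutually_independent P Y.

Lemma bigcap_seq_cons (i : I) (s : seq I) (F : I -> set T) :
  \bigcap_(j in [set` i :: s]) F j = F i `&` \bigcap_(j in [set` s]) F j.
Proof.
rewrite -bigcap_setU1; congr (\bigcap_(j in _) F j).
apply/seteqP; split => j /=; rewrite inE.
  by case/orP => [/eqP|]; [left|right].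
by case=> [->|->]; rewrite ?eqxx ?orbT.
Qed.

Lemma measurable_bigcap_preimage (s : seq I) (B : I -> set R) :
  (forall i, measurable (B i)) ->
  measurable (\bigcap_(i in [set` s]) (Y i @^-1` B i)).
Proof.
move=> mB; elim: s => [|i s IHs]; first by rewrite set_nil bigcap_set0.
rewrite bigcap_seq_cons; apply: measurableI => //.
by rewrite -(setTI (_ @^-1` _)); exact: mY.
Qed.

(** Independence is given for events only. The variables of [s1] are turned from events into
    functions one at a time: the induction hypothesis, with [i] put among the events, is what
    [ge0_integral_factor] asks of the weight made of the remaining product. *)
Lemma integral_prod_indep_mixed (g : I -> R -> R) (s1 s2 : seq I)
    (B : I -> set R) :
  (forall i, measurable_fun [set: R] (g i)) -> (forall i r, 0 <= g i r) ->
  (forall i, i \in s1 -> \int[P]_w (g i (Y i w))%:E < +oo)%E ->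
  uniq (s1 ++ s2) -> (forall i, measurable (B i)) ->
  (\int[P]_(w in \bigcap_(i in [set` s2]) (Y i @^-1` B i))
     (\prod_(i <- s1) g i (Y i w))%:E =
   (\prod_(i <- s1) \int[P]_w (g i (Y i w))%:E) *
   \prod_(i <- s2) P (Y i @^-1` B i))%E.
Proof.
move=> mg g0; elim: s1 s2 B => [|i s1 IH] s2 B fin us mB.
  under eq_integral do rewrite big_nil.
  rewrite big_nil mul1e integral_cst ?mul1e; last exact: measurable_bigcap_preimage.
  exact: indepY.
pose A := \bigcap_(i in [set` s2]) (Y i @^-1` B i).
have mA : measurable A by exact: measurable_bigcap_preimage.
have mp : measurable_fun [set: T] (fun w => \prod_(i <- s1) g i (Y i w)).
  elim: s1 {IH fin us} => [|j s1 IHs].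
    by under eq_fun do rewrite big_nil; exact: measurable_cst.
  under eq_fun do rewrite big_cons.
  by apply: measurable_funM => //; exact: measurableT_comp.
have p0 w : 0 <= \prod_(i <- s1) g i (Y i w) by apply: prodr_ge0.
have fin1 j : j \in s1 -> (\int[P]_w (g j (Y j w))%:E < +oo)%E.
  by move=> js; apply: fin; rewrite inE js orbT.
pose y := ((\prod_(i <- s1) \int[P]_w (g i (Y i w))%:E) *
   \prod_(i <- s2) P (Y i @^-1` B i))%E.
have int0 j : (0 <= \int[P]_w (g j (Y j w))%:E)%E.
  by apply: integral_ge0 => w _; rewrite lee_fin.
have yge0 : (0 <= y)%E by apply: mule_ge0; apply: prode_ge0.
have yfin : y \is a fin_num.
  rewrite fin_numM//.
    rewrite big_seq_cond; apply: prode_fin_num => j /andP[js _].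
    by rewrite ge0_fin_numE// fin1.
  by apply: prode_fin_num => j _; apply: fin_num_measure; rewrite -(setTI (_ @^-1` _)); exact: mY.
move: us; rewrite cat_cons cons_uniq => /andP[inot us].
have key := @ge0_integral_factor (Y i)
  (fun w => \prod_(i <- s1) g i (Y i w) * \1_A w) (fine y) (mY i) _ _ _ _
  (fun r => (g i r)%:E) _ _.
rewrite big_cons -muleA -/y -[y]fineK// -key.
- rewrite integral_mkcond; apply: eq_integral => w _.
  by rewrite epatch_indic /= big_cons -!EFinM mulrA.
- by apply: measurable_funM => //; exact: measurable_indic.
- by move=> w; rewrite mulr_ge0.
- exact: fine_ge0.
- move=> B' mB'; rewrite fineK//.
  (* [B] with the test set [B'] at the index [i], so that [i] can join [s2]. *)
  pose B2 := fun j => if j == i then B' else B j.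
  have mB2 j : measurable (B2 j) by rewrite /B2; case: ifP.
  have us2 : uniq (s1 ++ i :: s2).
    by rewrite (perm_uniq (permEl (perm_catCA s1 [:: i] s2))) /= inot.
  have eqB j : j \in s2 -> B2 j = B j.
    move=> js; rewrite /B2; case: eqP => // ji; move: inot.
    by rewrite -ji mem_cat js orbT.
  have B2i : B2 i = B' by rewrite /B2 eqxx.
  have := IH (i :: s2) B2 fin1 us2 mB2.
  rewrite big_cons bigcap_seq_cons B2i.
  have -> : \bigcap_(j in [set` s2]) (Y j @^-1` B2 j) = A.
    by apply: eq_bigcapr => j /= js; rewrite eqB.
  have -> : (\prod_(j <- s2) P (Y j @^-1` B2 j) =
            \prod_(j <- s2) P (Y j @^-1` B j))%E.
    by apply: eq_big_seq => j js /=; rewrite eqB.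
  rewrite muleCA -/y => <-.
  rewrite integral_mkcondr; apply: eq_integral => w _.
  by rewrite epatch_indic EFinM.
- exact/measurable_EFinP.
- by move=> r; rewrite lee_fin.
Qed.

Lemma integrable_prod_indep_ge0 (g : I -> R -> R) (s : seq I) :
  (forall i, measurable_fun [set: R] (g i)) -> (forall i r, 0 <= g i r) ->
  (forall i, i \in s -> P.-integrable [set: T] (fun w => (g i (Y i w))%:E)) ->
  uniq s ->
  P.-integrable [set: T] (fun w => (\prod_(i <- s) g i (Y i w))%:E) /\
  \int[P]_w (\prod_(i <- s) g i (Y i w)) = \prod_(i <- s) \int[P]_w g i (Y i w).
Proof.
move=> mg g0 ig us.
have fin i : i \in s -> (\int[P]_w (g i (Y i w))%:E < +oo)%E.
  move=> /ig/integrableP[_]; apply: le_lt_trans.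
  by apply: ge0_le_integral => //= [w _|||w _]; rewrite ?lee_fin ?ler_norm//;
    apply/measurable_EFinP; rewrite -?normr_comp; do ?apply: measurableT_comp => //;
    exact: measurableT_comp.
have us0 : uniq (s ++ [::]) by rewrite cats0.
have := integral_prod_indep_mixed mg g0 fin us0 (fun=> measurableT).
rewrite big_nil mule1 set_nil bigcap_set0 => E.
have p0 w : 0 <= \prod_(i <- s) g i (Y i w) by apply: prodr_ge0.
have finp : (\prod_(i <- s) \int[P]_w (g i (Y i w))%:E)%E \is a fin_num.
  rewrite big_seq_cond; apply: prode_fin_num => j /andP[js _].
  by rewrite ge0_fin_numE ?fin//; apply: integral_ge0 => w _; rewrite lee_fin.
have mp : measurable_fun [set: T] (fun w => \prod_(i <- s) g i (Y i w)).
  elim: s {ig us fin us0 E p0 finp} => [|j s1 IHs].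
    by under eq_fun do rewrite big_nil; exact: measurable_cst.
  under eq_fun do rewrite big_cons.
  by apply: measurable_funM => //; exact: measurableT_comp.
split.
  apply/integrableP; split; first exact/measurable_EFinP.
  under eq_integral do rewrite gee0_abs ?lee_fin//.
  by rewrite E -ge0_fin_numE// prode_ge0// => i _; apply: integral_ge0 => w _; rewrite lee_fin.
rewrite /Rintegral E; move: finp {E us us0 ig p0 mp}.
elim: s fin => [|j s IHs] fin fp; first by rewrite !big_nil.
have fj : (\int[P]_w (g j (Y j w))%:E)%E \is a fin_num.
  by rewrite ge0_fin_numE ?fin ?mem_head//; apply: integral_ge0 => w _; rewrite lee_fin.
have fs : (\prod_(i <- s) \int[P]_w (g i (Y i w))%:E)%E \is a fin_num.
  rewrite big_seq_cond; apply: prode_fin_num => i /andP[js _].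
  rewrite ge0_fin_numE ?fin//; first by rewrite inE js orbT.
  by apply: integral_ge0 => w _; rewrite lee_fin.
rewrite !big_cons fineM// IHs// => i js; apply: fin.
by rewrite inE js orbT.
Qed.


End Independence.

Section Moments.
Context {d : measure_display} {T : measurableType d} {R : realType}.
Variable P : probability T R.
Variables (I : choiceType) (Y : I -> T -> R).
Hypothesis mY : forall i, measurable_fun [set: T] (Y i).
Hypothesis indepY : mutually_independent P Y.

(** [s1] lists the variables whose function may change sign. Splitting such a function into its
    positive and negative parts moves the variable to [s2], until the nonnegative case applies. *)
Lemma integral_prod_indep (s1 s2 : seq I) (g : I -> R -> R) :
  (forall i, measurable_fun [set: R] (g i)) ->
  (forall i, i \notin s1 -> forall r, 0 <= g i r) ->
  (forall i, i \in s1 ++ s2 -> P.-integrable [set: T] (fun w => (g i (Y i w))%:E)) ->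
  uniq (s1 ++ s2) ->
  P.-integrable [set: T] (fun w => (\prod_(i <- s1 ++ s2) g i (Y i w))%:E) /\
  \int[P]_w (\prod_(i <- s1 ++ s2) g i (Y i w)) =
  \prod_(i <- s1 ++ s2) \int[P]_w g i (Y i w).
Proof.
elim: s1 s2 g => [|i s1 IH] s2 g mg g0 ig us.
  by apply: integrable_prod_indep_ge0 => // i r; exact: g0.
pose gp (b : bool) j r := if j == i then Num.max (if b then g i r else - g i r) 0 else g j r.
have perm : perm_eq (s1 ++ i :: s2) (i :: s1 ++ s2).
  by rewrite (permEl (perm_catCA s1 [:: i] s2)).
have [inot us'] : i \notin s1 ++ s2 /\ uniq (s1 ++ s2) by move: us => /andP[].
have igi : P.-integrable [set: T] (fun w => (g i (Y i w))%:E).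
  by apply: ig; rewrite mem_head.
have mgp b j : measurable_fun [set: R] (gp b j).
  rewrite /gp; case: eqP => // _; apply: measurable_maxr => //.
  by case: b => //; exact: measurableT_comp.
have igp b j : j \in s1 ++ i :: s2 -> P.-integrable [set: T] (fun w => (gp b j (Y j w))%:E).
  rewrite (perm_mem perm) inE /gp; case: eqP => [->{j} _|_ /= js]; last first.
    by apply: ig; rewrite inE js orbT.
  apply: le_integrable igi => //.
    apply/measurable_EFinP; apply: measurable_maxr => //.
    by case: b; [|apply: measurableT_comp => //]; exact: measurableT_comp.
  move=> w _ /=; rewrite lee_fin; case: b.
    by rewrite ger0_norm ?le_max ?lexx ?orbT// ge_max ler_norm normr_ge0.
  by rewrite ger0_norm ?le_max ?lexx ?orbT// ge_max normr_ge0 -normrN ler_norm.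
have usp : uniq (s1 ++ i :: s2) by rewrite (perm_uniq perm).
have gp0 b j : j \notin s1 -> forall r, 0 <= gp b j r.
  move=> js r; rewrite /gp; case: eqP => [_|/eqP ji]; first by rewrite le_max lexx orbT.
  by apply: g0; rewrite inE negb_or ji.
have H b := IH (i :: s2) (gp b) (mgp b) (gp0 b) (igp b) usp.
have Eg r : g i r = gp true i r - gp false i r.
  rewrite /gp eqxx; case: (lerP 0 (g i r)) => gi.
    by rewrite [X in _ - X]max_r ?subr0// oppr_le0.
  by rewrite max_l ?sub0r ?opprK// oppr_ge0 ltW.
have Eg' b j r : j \in s1 ++ s2 -> gp b j r = g j r.
  by rewrite /gp; case: eqP => // ->; rewrite (negbTE inot).
have EP b w : \prod_(j <- s1 ++ i :: s2) gp b j (Y j w) =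
    gp b i (Y i w) * \prod_(j <- s1 ++ s2) g j (Y j w).
  rewrite (perm_big _ perm) big_cons; congr (_ * _).
  by apply: eq_big_seq => j js; rewrite Eg'.
have EI b : \prod_(j <- s1 ++ i :: s2) \int[P]_w gp b j (Y j w) =
    \int[P]_w gp b i (Y i w) * \prod_(j <- s1 ++ s2) \int[P]_w g j (Y j w).
  rewrite (perm_big _ perm) big_cons; congr (_ * _).
  by apply: eq_big_seq => j js; apply: eq_Rintegral => w _; rewrite Eg'.
have EW w : \prod_(j <- (i :: s1) ++ s2) g j (Y j w) =
    \prod_(j <- s1 ++ i :: s2) gp true j (Y j w) -
    \prod_(j <- s1 ++ i :: s2) gp false j (Y j w).
  by rewrite cat_cons big_cons !EP -mulrBl -Eg.
have ii : i \in s1 ++ i :: s2 by rewrite mem_cat mem_head orbT.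
split.
  under eq_fun do rewrite EW EFinB.
  by apply: integrableB => //; have [] := H true; have [] := H false.
under eq_Rintegral do rewrite EW.
have [it Ht] := H true; have [jt Hf] := H false.
rewrite RintegralB// Ht Hf !EI cat_cons big_cons -mulrBl; congr (_ * _).
rewrite -RintegralB ?(igp _ _ ii)//.
by apply: eq_Rintegral => w _; rewrite -Eg.
Qed.

Variable D : nat.
Hypothesis momD : forall i, P.-integrable [set: T] (fun w => (`|Y i w| ^+ D)%:E).

Lemma integrable_pow i e : (e <= D)%N ->
  P.-integrable [set: T] (fun w => (Y i w ^+ e)%:E).
Proof.
move=> eD.
apply: (@le_integrable _ _ _ P _ _ _ (fun w => (1 + `|Y i w| ^+ D)%:E)) => //.
- by apply/measurable_EFinP; apply: measurable_funX.
- move=> w _ /=; rewrite lee_fin normrX [leRHS]ger0_norm; last by rewrite addr_ge0.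
  have [y1|/ltW y1] := lerP `|Y i w| 1.
    by rewrite (le_trans (exprn_ile1 _ _ _))// lerDl exprn_ge0.
  by rewrite (le_trans (ler_weXn2l y1 eD))// lerDr.
- under eq_fun do rewrite EFinD; apply: integrableD => //.
  by apply: finite_measure_integrable_cst.
Qed.

Definition monomial (s : seq I) w := \prod_(i <- s) Y i w.

Lemma monomialE s w : monomial s w = \prod_(i <- undup s) Y i w ^+ count_mem i s.
Proof.
by rewrite /monomial -big_undup_iterop_count. 
Qed.

Lemma integral_monomial s (e : I -> nat) : uniq s -> (forall i, i \in s -> e i <= D)%N ->
  P.-integrable [set: T] (fun w => (\prod_(i <- s) Y i w ^+ e i)%:E) /\
  \int[P]_w (\prod_(i <- s) Y i w ^+ e i) = \prod_(i <- s) \int[P]_w (Y i w ^+ e i).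
Proof.
move=> us eD.
(* The function is 0 outside [s], hence nonnegative there, as [integral_prod_indep] asks of the
   indices that it does not treat as signed. *)
pose g i (r : R) := if i \in s then r ^+ e i else 0.
have := @integral_prod_indep s [::] g.
rewrite cats0 => H.
have Eg w : \prod_(i <- s) Y i w ^+ e i = \prod_(i <- s) g i (Y i w).
  by apply: eq_big_seq => i js; rewrite /g js.
have EI : \prod_(i <- s) \int[P]_w (Y i w ^+ e i) = \prod_(i <- s) \int[P]_w g i (Y i w).
  by apply: eq_big_seq => i js; rewrite /g js.
under eq_fun do rewrite Eg; rewrite EI; under eq_Rintegral do rewrite Eg.
apply: H => // [i|i nis r|i js].
- by rewrite /g; case: (i \in s); [exact: measurable_funX|exact: measurable_cst].
- by rewrite /g (negbTE nis).
- by rewrite /g js; apply: integrable_pow; exact: eD.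
Qed.

Lemma integrable_monomial s : (size s <= D)%N ->
  P.-integrable [set: T] (fun w => (monomial s w)%:E).
Proof.
move=> sD; under eq_fun do rewrite monomialE.
apply: (proj1 (integral_monomial (undup_uniq s) _)) => i _.
by rewrite (leq_trans _ sD)// count_size.
Qed.

Lemma integral_monomial_factor s i k : i \notin s -> (size s + k <= D)%N ->
  \int[P]_w (monomial s w * Y i w ^+ k) = \int[P]_w monomial s w * \int[P]_w (Y i w ^+ k).
Proof.
move=> nis skD.
have iu : i \notin undup s by rewrite mem_undup.
pose e j := if j == i then k else count_mem j s.
have E w : monomial s w * Y i w ^+ k = \prod_(j <- i :: undup s) Y j w ^+ e j.
  rewrite big_cons mulrC {1}/e eqxx monomialE; congr (_ * _).
  apply: eq_big_seq => j js; rewrite /e; case: eqP => // ji.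
  by rewrite ji (negbTE iu) in js.
have eD j : j \in i :: undup s -> (e j <= D)%N.
  move=> _; rewrite /e; case: eqP => _; first by rewrite (leq_trans _ skD)// leq_addl.
  by rewrite (leq_trans (count_size _ _))// (leq_trans _ skD)// leq_addr.
have [|_ ] := integral_monomial _ eD; first by rewrite /= iu undup_uniq.
under eq_Rintegral do rewrite -E.
move=> ->; rewrite big_cons {1}/e eqxx mulrC; congr (_ * _).
under [RHS]eq_Rintegral do rewrite monomialE.
have [|_ ->] := @integral_monomial (undup s) (fun j => count_mem j s) (undup_uniq s).
  by move=> j _; rewrite (leq_trans (count_size _ _))// (leq_trans _ skD)// leq_addr.
apply: eq_big_seq => j js; rewrite /e; case: eqP => // ji.
by rewrite ji (negbTE iu) in js.
Qed.

End Moments.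

(** * Moments of polynomials in independent random variables *)

Section Polynomials.
Context {d : measure_display} {T : measurableType d} {R : realType}.
Variable P : probability T R.
Variables (I : choiceType) (Y : I -> T -> R).
Hypothesis mY : forall i, measurable_fun [set: T] (Y i).
Hypothesis indepY : mutually_independent P Y.
Variable D : nat.
Hypothesis momD : forall i, P.-integrable [set: T] (fun w => (`|Y i w| ^+ D)%:E).

(* Polynomials of degree at most n in the variables Y i with i in S. *)
Inductive polyRV (S : pred I) : nat -> (T -> R) -> Prop :=
| polyRV_monomial s : all S s -> polyRV S (size s) (monomial Y s)
| polyRVD n Z1 Z2 : polyRV S n Z1 -> polyRV S n Z2 ->
    polyRV S n (fun w => Z1 w + Z2 w)
| polyRVZ n c Z : polyRV S n Z -> polyRV S n (fun w => c * Z w)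
| polyRV_le n m Z : (n <= m)%N -> polyRV S n Z -> polyRV S m Z.

Lemma polyRV_cst S c : polyRV S 0 (fun=> c).
Proof.
have /(polyRVZ c) := @polyRV_monomial S [::] isT.
by congr polyRV; apply/funext => w; rewrite /monomial big_nil mulr1.
Qed.

Lemma polyRV_var (S : pred I) i : S i -> polyRV S 1 (Y i).
Proof.
move=> Si; have := @polyRV_monomial S [:: i].
rewrite /= Si => /(_ isT).
by congr polyRV; apply/funext => w; rewrite /monomial big_seq1.
Qed.

Lemma polyRVM S m n Z1 Z2 : polyRV S m Z1 -> polyRV S n Z2 ->
  polyRV S (m + n) (fun w => Z1 w * Z2 w).
Proof.
move=> p1 p2; elim: p1 => {m Z1}.
- move=> s Ss; elim: p2 => {n Z2}.
  + move=> s2 Ss2; rewrite -size_cat.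
    have := @polyRV_monomial S (s ++ s2); rewrite all_cat Ss Ss2 => /(_ isT).
    by congr polyRV; apply/funext => w; rewrite /monomial big_cat.
  + move=> n Z1 Z2 _ p1 _ p2; have := polyRVD p1 p2.
    by congr polyRV; apply/funext => w; rewrite mulrDr.
  + move=> n c Z _ p; have := polyRVZ c p.
    by congr polyRV; apply/funext => w; rewrite mulrCA.
  + by move=> n m Z nm _; apply: polyRV_le; rewrite leq_add2l.
- move=> m Z1' Z2' _ q1 _ q2; have := polyRVD q1 q2.
  by congr polyRV; apply/funext => w; rewrite mulrDl.
- move=> m c Z _ q; have := polyRVZ c q.
  by congr polyRV; apply/funext => w; rewrite mulrA.
- by move=> m m' Z mm _; apply: polyRV_le; rewrite leq_add2r.
Qed.

Lemma polyRVX S m Z e : polyRV S m Z -> polyRV S (m * e) (fun w => Z w ^+ e).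
Proof.
move=> p; elim: e => [|e IH].
  by rewrite muln0; under eq_fun do rewrite expr0; exact: polyRV_cst.
by rewrite mulnS; under eq_fun do rewrite exprS; exact: polyRVM.
Qed.

Lemma polyRV_sum S n (J : Type) (s : seq J) (Pr : pred J) (F : J -> T -> R) :
  (forall j, Pr j -> polyRV S n (F j)) ->
  polyRV S n (fun w => \sum_(j <- s | Pr j) F j w).
Proof.
move=> pF; elim: s => [|j s IH].
  under eq_fun do rewrite big_nil.
  by apply: (@polyRV_le S 0) => //; exact: polyRV_cst.
under eq_fun do rewrite big_cons.
by case: (boolP (Pr j)) => Pj //; apply: polyRVD => //; exact: pF.
Qed.

Lemma polyRV_sub (S S' : pred I) n Z : {subset S <= S'} -> polyRV S n Z -> polyRV S' n Z.
Proof.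
move=> SS'; elim=> {n Z} [s Ss|n Z1 Z2 _ p1 _ p2|n c Z _ p|n m Z nm _ p].
- by apply: polyRV_monomial; apply: sub_all Ss => x; exact: SS'.
- exact: polyRVD.
- exact: polyRVZ.
- exact: polyRV_le p.
Qed.

Lemma integrable_polyRV S n Z : polyRV S n Z -> (n <= D)%N ->
  P.-integrable [set: T] (fun w => (Z w)%:E).
Proof.
elim=> {n Z} [s Ss sD|n Z1 Z2 _ i1 _ i2 nD|n c Z _ i nD|n m Z nm _ i mD].
- exact: (integrable_monomial mY indepY momD).
- by under eq_fun do rewrite EFinD; apply: integrableD; [|exact: i1|exact: i2].
- by under eq_fun do rewrite EFinM; apply: integrableZl => //; exact: i.
- by apply: i; rewrite (leq_trans nm).
Qed.

(** Takes the place of conditioning on the variables of [S]: a power of a variable outside [S] can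
    be integrated first. The total degree must stay below the order [D] of the available moments. *)
Lemma integral_polyRV_factor (S : pred I) n Z i k : polyRV S n Z -> ~~ S i ->
  (n + k <= D)%N ->
  \int[P]_w (Z w * Y i w ^+ k) = \int[P]_w Z w * \int[P]_w (Y i w ^+ k).
Proof.
move=> pZ nSi.
have int Z' m : polyRV S m Z' -> (m + k <= D)%N ->
    P.-integrable [set: T] (fun w => (Z' w * Y i w ^+ k)%:E).
  move=> pZ' mD; apply: (@integrable_polyRV predT (m + k)) => //.
  apply: polyRVM; first exact: polyRV_sub pZ'.
  rewrite -[k in polyRV _ k]mul1n; apply: polyRVX; exact: polyRV_var.
have int0 Z' m : polyRV S m Z' -> (m + k <= D)%N ->
    P.-integrable [set: T] (fun w => (Z' w)%:E).
  by move=> pZ' mD; apply: integrable_polyRV pZ' _; rewrite (leq_trans _ mD) ?leq_addr.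
elim: pZ => {n Z} [s Ss sD|n Z1 Z2 p1 i1 p2 i2 nD|n c Z p IH nD|n m Z nm p IH mD].
- apply: (integral_monomial_factor mY indepY momD) => //.
  by apply: contra nSi => /(allP Ss).
- under eq_Rintegral do rewrite mulrDl.
  rewrite !RintegralD//; try exact: (int _ _ _ nD); try exact: (int0 _ _ _ nD).
  by rewrite i1// i2// mulrDl.
- under eq_Rintegral do rewrite -mulrA.
  rewrite !RintegralZl//; try exact: (int _ _ _ nD); try exact: (int0 _ _ _ nD).
  by rewrite IH// mulrA.
- by apply: IH; rewrite (leq_trans _ mD)// leq_add2r.
Qed.

End Polynomials.

(** * Moments of sums of martingale differences *)

Section MomentInduction.
Context {d : measure_display} {T : measurableType d} {R : realType}.
Variable P : probability T R.

Lemma integrableDR (f g : T -> R) :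
  P.-integrable [set: T] (EFin \o f) -> P.-integrable [set: T] (EFin \o g) ->
  P.-integrable [set: T] (EFin \o (fun w => f w + g w)).
Proof.
move=> fi gi; rewrite (_ : _ \o _ = (EFin \o f) \+ (EFin \o g))%E; last by [].
exact: integrableD.
Qed.

Lemma integrableZR c (f : T -> R) : P.-integrable [set: T] (EFin \o f) ->
  P.-integrable [set: T] (EFin \o (fun w => c * f w)).
Proof. move=> fi; rewrite (_ : _ \o _ = (fun w => c%:E * (EFin \o f) w)%E); last by [].
exact: integrableZl. Qed.

(** In the binomial expansion the terms of order at least 2 in [s * z] carry at least [s ^+ 2],
    because s <= 1, and the rest of each is at most the larger of |x| and |z| to the power 2r. Their
    binomial coefficients sum to at most 2^(2r) = 4^r. *)
Lemma expr_add_taylor (r : nat) (s x z : R) : (0 < r)%N -> 0 <= s <= 1 ->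
  (x + s * z) ^+ (2 * r) <=
  x ^+ (2 * r) + (2 * r)%:R * (x ^+ (2 * r).-1 * (s * z)) +
  4 ^+ r * s ^+ 2 * (x ^+ (2 * r) + z ^+ (2 * r)).
Proof.
case: r => // r _ /andP[s0 s1].
have en t : t ^+ (2 * r.+1) = `|t| ^+ (2 * r.+1) :> R.
  by rewrite !exprM real_normK ?num_real.
have -> : 4 ^+ r.+1 = 2 ^+ (2 * r.+1) :> R by rewrite exprM expr2 -natrM.
have nE : (2 * r.+1 = (2 * r).+2)%N by lia.
rewrite nE in en *; move: (2 * r)%N en => n' en {nE}.
have -> : 2 ^+ n'.+2 = \sum_(i < n'.+3) ('C(n'.+2, i)%:R : R).
  have := @exprDn R 1 1 n'.+2; under eq_bigr do rewrite !expr1n mulr1.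
  by [].
rewrite exprDn; set n := n'.+2.
rewrite big_ord_recl big_ord_recl /= bin0 bin1 !subn0 !expr0 mulr1n mulr1.
rewrite expr1 -[X in _ + (X + _)]mulr_natl subn1 -!addrA lerD2l lerD2l.
rewrite !mulr_suml [leRHS]big_ord_recl [X in _ <= _ + X]big_ord_recl /= -[leLHS]add0r.
have e0 : 0 <= x ^+ n + z ^+ n by rewrite (en x) (en z) addr_ge0.
rewrite lerD ?mulr_ge0 ?exprn_ge0// -[leLHS]add0r.
rewrite lerD ?mulr_ge0 ?exprn_ge0//.
apply: ler_sum => i _.
rewrite /bump /= !add1n -mulr_natl -!mulrA ler_wpM2l//.
set k := i.+2.
have kn : (k <= n)%N by by have := ltn_ord i.
have M0 : 0 <= Num.max `|x| `|z| by rewrite le_max normr_ge0.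
apply: (@le_trans _ _ (`|x| ^+ (n - k) * (s ^+ 2 * `|z| ^+ k))).
  apply: le_trans (ler_norm _) _; rewrite normrM !normrX normrM (ger0_norm s0).
  rewrite ler_wpM2l ?exprn_ge0// exprMn ler_wpM2r ?exprn_ge0//.
  by apply: ler_wiXn2l.
rewrite [leRHS]mulrA -expr2 [leLHS]mulrCA ler_wpM2l ?exprn_ge0//.
apply: (@le_trans _ _ (Num.max `|x| `|z| ^+ n)).
  by rewrite -{2}(subnK kn) exprD ler_pM ?exprn_ge0// lerXn2r ?nnegrE ?le_max ?normr_ge0 ?lexx ?orbT.
rewrite (en x) (en z); case: (lerP `|x| `|z|) => _; first by rewrite lerDr exprn_ge0.
by rewrite lerDl exprn_ge0.
Qed.

(* The first-order term of the Taylor expansion of (Q + Dl)^(2r) vanishes in mean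
   (martingale differences); after scaling Dl by sqrt th, the second-order terms
   multiply the moment by at most 1 + 4^r th. *)
Lemma moment_induction (r : nat) (Q Dl : nat -> T -> R) (th : nat -> R) (V : R) (n : nat) :
  (0 < r)%N -> 0 <= V ->
  (forall w, Q 0%N w = 0) -> (forall i w, (i < n)%N -> Q i.+1 w = Q i w + Dl i w) ->
  (forall i, (i < n)%N -> 0 < th i <= 1) ->
  (forall i, (i <= n)%N -> P.-integrable [set: T] (fun w => (Q i w ^+ (2 * r))%:E)) ->
  (forall i, (i < n)%N -> P.-integrable [set: T] (fun w => (Dl i w ^+ (2 * r))%:E)) ->
  (forall i, (i < n)%N ->
    P.-integrable [set: T] (fun w => (Q i w ^+ (2 * r).-1 * Dl i w)%:E)) ->
  (forall i, (i < n)%N -> \int[P]_w (Q i w ^+ (2 * r).-1 * Dl i w) = 0) ->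
  (forall i, (i < n)%N -> \int[P]_w (Dl i w ^+ (2 * r)) <= (th i * V) ^+ r) ->
  \int[P]_w (Q n w ^+ (2 * r)) <= expR (4 ^+ r * \sum_(i < n) th i) * V ^+ r.
Proof.
move=> r0 V0 Q0 QS th01 iQ iD iQD QD0 DV.
(* The recursion for the moments is affine; adding [V ^+ r] turns it into a multiplication by 1 +
   4^r th i. *)
suff H i : (i <= n)%N -> \int[P]_w (Q i w ^+ (2 * r)) + V ^+ r <=
    expR (4 ^+ r * \sum_(j < i) th j) * V ^+ r.
  by apply: le_trans (H n (leqnn n)); rewrite lerDl exprn_ge0.
elim: i => [_|i IH ilt].
  rewrite big_ord0 mulr0 expR0 mul1r; under eq_Rintegral do rewrite Q0 expr0n muln_eq0 /= (gtn_eqF r0).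
  by rewrite Rintegral_cst// mul0r add0r.
have {}IH := IH (ltnW ilt).
have /andP[t0 t1] := th01 i ilt.
pose s := Num.sqrt (th i).
have s0 : 0 < s by rewrite sqrtr_gt0.
have s2 : s ^+ 2 = th i by rewrite sqr_sqrtr// ltW.
have s01 : 0 <= s <= 1 by rewrite ltW//= -sqrtr1 ler_sqrt.
pose c := 4 ^+ r * th i.
have c0 : 0 <= c by rewrite mulr_ge0 ?exprn_ge0// ltW.
have step : \int[P]_w (Q i.+1 w ^+ (2 * r)) <=
    (1 + c) * \int[P]_w (Q i w ^+ (2 * r)) + c * V ^+ r.
  have iQ1 := iQ i (ltnW ilt); have iD1 := iD i ilt; have iQD1 := iQD i ilt.
  apply: (@le_trans _ _ (\int[P]_w ((1 + c) * Q i w ^+ (2 * r) +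
     ((2 * r)%:R * (Q i w ^+ (2 * r).-1 * Dl i w) + (c / th i ^+ r) * Dl i w ^+ (2 * r))))).
    apply: le_Rintegral => //.
    - exact: iQ.
    - by apply: integrableDR; [|apply: integrableDR]; exact: integrableZR.
    move=> w _; rewrite QS//.
    have := expr_add_taylor (Q i w) (Dl i w / s) r0 s01.
    rewrite (mulrC s) divfK ?gt_eqF// s2 expr_div_n (exprM s) s2.
    move=> /le_trans; apply; rewrite -/c.
    rewrite mulrDl mul1r mulrDr -!addrA lerD2l addrCA lerD2l.
    by rewrite lerD2l mulrA mulrAC.
  rewrite RintegralD//; [|exact: integrableZR|by apply: integrableDR; exact: integrableZR].
  rewrite RintegralD//; [|exact: integrableZR..].
  rewrite !RintegralZl// QD0// mulr0 add0r lerD2l.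
  apply: le_trans (ler_wpM2l _ (DV i ilt)) _; first by rewrite divr_ge0// exprn_ge0// ltW.
  by rewrite exprMn mulrA divfK// expf_neq0// gt_eqF.
rewrite big_ord_recr /= mulrDr expRD.
apply: le_trans (_ : (1 + c) * (\int[P]_w (Q i w ^+ (2 * r)) + V ^+ r) <= _).
  rewrite mulrDr (le_trans (lerD step (lexx _)))// -addrA lerD2l mulrDl mul1r addrC.
  by [].
rewrite mulrAC mulrC ler_pM// ?addr_ge0// ?exprn_ge0//.
  by apply: Rintegral_ge0 => w _; rewrite exprM exprn_ge0// sqr_ge0.
by rewrite expR_ge1Dx.
Qed.

End MomentInduction.

(** * Linear and quadratic forms in independent centred variables *)

Section Forms.
Context {d : measure_display} {T : measurableType d} {R : realType}.
Variable P : probability T R.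
Variables (I : choiceType) (Y : I -> T -> R).
Hypothesis mY : forall i, measurable_fun [set: T] (Y i).
Hypothesis indepY : mutually_independent P Y.
Variable r : nat.
Hypothesis r0 : (0 < r)%N.
Hypothesis momY : forall i, P.-integrable [set: T] (fun w => (`|Y i w| ^+ (4 * r))%:E).
Hypothesis meanY : forall i, \int[P]_w Y i w = 0.
Variable sg2 : R.
Hypothesis varY : forall i, \int[P]_w (Y i w ^+ 2) = sg2.
Variable mu : R.
Hypothesis mu1 : 1 <= mu.
Hypothesis mu2 : forall i, \int[P]_w (Y i w ^+ (2 * r)) <= mu.
Hypothesis mu4 : forall i, \int[P]_w (Y i w ^+ (4 * r)) <= mu.
Hypothesis sg2mu : sg2 ^+ (2 * r) <= mu.
Variable idx : nat -> I.
Hypothesis idx_inj : injective idx.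

Let before n : pred I := [pred x | x \in map idx (iota 0 n)].

Let beforeP j n : (j < n)%N -> before n (idx j).
Proof. by move=> jn; apply/mapP; exists j => //; rewrite mem_iota. Qed.

Let beforeNn n : ~~ before n (idx n).
Proof.
by apply/mapP => -[j]; rewrite mem_iota => /andP[_ jn] /idx_inj nj; rewrite nj ltnn in jn.
Qed.

Definition linform (c : nat -> R) n w := \sum_(i < n) c i * Y (idx i) w.

Lemma polyRV_linform (c : nat -> R) n : polyRV Y (before n) 1 (linform c n).
Proof.
by apply: polyRV_sum => i _; apply: polyRVZ; apply: polyRV_var; exact: beforeP.
Qed.

Let intp S n Z : polyRV Y S n Z -> (n <= 4 * r)%N ->
  P.-integrable [set: T] (EFin \o Z).
Proof. exact: (integrable_polyRV mY indepY momY). Qed.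

Let factor (S : pred I) n Z i k : polyRV Y S n Z -> ~~ S i -> (n + k <= 4 * r)%N ->
  \int[P]_w (Z w * Y i w ^+ k) = \int[P]_w Z w * \int[P]_w (Y i w ^+ k).
Proof. exact: (integral_polyRV_factor mY indepY momY). Qed.

Let integral0 i Z S n : polyRV Y S n Z -> ~~ S i -> (n + 1 <= 4 * r)%N ->
  \int[P]_w (Z w * Y i w) = 0.
Proof.
move=> pZ nSi nr; have := factor pZ nSi nr.
under eq_Rintegral do rewrite expr1; move=> ->.
by under [X in _ * X]eq_Rintegral do rewrite expr1; rewrite meanY mulr0.
Qed.

(** An instance of [moment_induction] in which each summand is an increment. It is needed because
    the increments of a quadratic form contain such a form as a factor. *)
Lemma linform_moment (c : nat -> R) n (v : R) : 0 < v -> \sum_(i < n) c i ^+ 2 <= v ->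
  \int[P]_w (linform c n w ^+ (2 * r)) <= expR (4 ^+ r) * (2 * v * mu) ^+ r.
Proof.
move=> v0 cv.
(* The summand v / (n + 1) keeps the share positive when [c i] is 0; over all i it adds at most v,
   whence the denominator 2 v. *)
pose th i := (c i ^+ 2 + v / n.+1%:R) / (2 * v).
have vn : 0 < v / n.+1%:R by rewrite divr_gt0.
have thv i : th i * (2 * v * mu) = (c i ^+ 2 + v / n.+1%:R) * mu.
  by rewrite /th mulrA divfK// mulf_neq0// gt_eqF.
have pQ i := polyRV_linform c i.
have pD i (S : pred I) : S (idx i) -> polyRV Y S 1 (fun w => c i * Y (idx i) w).
  by move=> Si; apply: polyRVZ; exact: polyRV_var.
have sumth : \sum_(i < n) th i <= 1.
  rewrite -mulr_suml big_split /= sumr_const card_ord ler_pdivrMr ?mulr_gt0// mul1r.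
  rewrite [leRHS](_ : _ = v + v); last by ring.
  rewrite lerD// -[_ *+ n]mulr_natr -mulrA ler_piMr ?(ltW v0)//.
  by rewrite mulrC ler_pdivrMr// mul1r ler_nat.
have th0 i : 0 < th i by rewrite divr_gt0 ?mulr_gt0// ltr_wpDl// sqr_ge0.
apply: (@le_trans _ _ (expR (4 ^+ r * \sum_(i < n) th i) * (2 * v * mu) ^+ r)); last first.
  rewrite ler_wpM2r ?exprn_ge0 ?mulr_ge0 ?(ltW v0)//; first exact: le_trans mu1.
  by rewrite ler_expR ler_piMr// exprn_ge0.
apply: (@moment_induction _ _ _ P r (linform c) (fun i w => c i * Y (idx i) w)) => //.
- by rewrite !mulr_ge0 ?(ltW v0)//; exact: le_trans mu1.
- by move=> w; rewrite /linform big_ord0.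
- by move=> i w _; rewrite /linform big_ord_recr.
- move=> i ilt; rewrite th0 /=; apply: le_trans sumth.
  by rewrite (bigD1 (Ordinal ilt)) //= lerDl sumr_ge0// => j _; exact: ltW.
- by move=> i _; apply: (intp (polyRVX (2 * r) (pQ i))); lia.
- by move=> i _; apply: (intp (polyRVX (2 * r) (@pD i predT isT))); lia.
- move=> i _; apply: (intp (polyRVM (polyRVX _ (polyRV_sub _ (pQ i))) (@pD i predT isT))) => //.
  by lia.
- move=> i _; rewrite -[RHS](mulr0 (c i)).
  rewrite -(integral0 (polyRVX (2 * r).-1 (pQ i)) (beforeNn i)); last by lia.
  rewrite -RintegralZl//.
    by apply: eq_Rintegral => w _; rewrite mulrCA.
  apply: (intp (polyRVM (polyRVX _ (polyRV_sub (S' := predT) _ (pQ i))) (polyRV_var Y (i := idx i) _))) => //.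
  by lia.
- move=> i _; under eq_Rintegral do rewrite exprMn.
  rewrite RintegralZl//; last first.
    by apply: (intp (polyRVX (2 * r) (polyRV_var Y (S := predT) (i := idx i) isT))); lia.
  rewrite thv exprMn exprM ler_pM//.
  + by rewrite exprn_ge0// sqr_ge0.
  + by apply: Rintegral_ge0 => w _; rewrite exprM exprn_ge0// sqr_ge0.
  + by rewrite lerXn2r ?nnegrE ?sqr_ge0 ?addr_ge0 ?sqr_ge0 ?(ltW vn)// lerDl ltW.
  + by apply: le_trans (mu2 _) _; apply: ler_eXnr.
Qed.

(** The i-th increment of a quadratic form has the coefficients [B j i + B i j]; symmetrizing at
    most doubles the sum of squares. *)
Lemma sum_sqr_sym (B : nat -> nat -> R) n :
  \sum_(i < n) (\sum_(j < i) (B j i + B i j) ^+ 2 + B i i ^+ 2) <=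
  2 * \sum_(i < n) \sum_(j < n) B i j ^+ 2.
Proof.
elim: n => [|n IH]; first by rewrite !big_ord0 mulr0.
have E : \sum_(i < n) \sum_(j < n.+1) B i j ^+ 2 =
    \sum_(i < n) \sum_(j < n) B i j ^+ 2 + \sum_(i < n) B i n ^+ 2.
  by rewrite -big_split /=; apply: eq_bigr => i _; rewrite big_ord_recr.
rewrite big_ord_recr [in leRHS]big_ord_recr /= E [X in _ <= _ * (_ + X)]big_ord_recr /=.
have H : \sum_(j < n) (B j n + B n j) ^+ 2 <=
    2 * (\sum_(i < n) B i n ^+ 2 + \sum_(i < n) B n i ^+ 2).
  rewrite -big_split /= mulr_sumr; apply: ler_sum => j _.
  have := sqr_ge0 (B j n - B n j); nra.
have := sqr_ge0 (B n n); move: IH H; lra.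
Qed.

Lemma Rintegral_probability_cst (c : R) : \int[P]_w c = c.
Proof.
rewrite Rintegral_cst// -[RHS]mulr1.
exact: (congr1 (fun x => c * fine x) (probability_setT P)).
Qed.

Lemma expr_add_le (a b : R) : (a + b) ^+ (2 * r) <= 4 ^+ r * (a ^+ (2 * r) + b ^+ (2 * r)).
Proof.
rewrite !exprM; set M := Num.max (a ^+ 2) (b ^+ 2).
have aM : a ^+ 2 <= M by rewrite le_max lexx.
have bM : b ^+ 2 <= M by rewrite le_max lexx orbT.
apply: (@le_trans _ _ ((4 * M) ^+ r)).
  have M0 : 0 <= M by apply: le_trans aM; exact: sqr_ge0.
  rewrite lerXn2r ?nnegrE ?sqr_ge0 ?mulr_ge0//.
  have := sqr_ge0 (a - b); move: aM bM; clearbody M; nra.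
rewrite exprMn ler_wpM2l ?exprn_ge0// /M.
by case: (lerP (a ^+ 2) (b ^+ 2)) => _; rewrite ?lerDr ?lerDl exprn_ge0// sqr_ge0.
Qed.

Definition quadform (B : nat -> nat -> R) n w :=
  \sum_(i < n) \sum_(j < n) B i j * (Y (idx i) w * Y (idx j) w - (i == j :> nat)%:R * sg2).

(** The factor 3 is the total of the shares: 2 from [sum_sqr_sym] and 1 from the padding that keeps
    them positive. The factor 4 comes from separating the two parts of an increment by
    [expr_add_le]. In the bracket are the linear form times a new variable and the centred square of
    that variable; it is at least 1, so it is at most its r-th power and may stand inside the
    power. *)
Definition quad_const := 3 * (4 * (expR (4 ^+ r) * (2 * mu) ^+ r * mu + 4 ^+ r * (2 * mu))).

Lemma quadformS B n w : quadform B n.+1 w = quadform B n w +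
  (linform (fun i => B i n + B n i) n w * Y (idx n) w + B n n * (Y (idx n) w ^+ 2 - sg2)).
Proof.
rewrite /quadform big_ord_recr /=.
under eq_bigr do rewrite big_ord_recr /=.
rewrite big_split /= -addrA; congr (_ + _).
rewrite big_ord_recr /= eqxx mul1r expr2 addrA; congr (_ + _).
rewrite /linform mulr_suml -big_split /=; apply: eq_bigr => i _.
have -> : (i == n :> nat) = false by rewrite ltn_eqF.
have -> : (n == i :> nat) = false by rewrite gtn_eqF.
by rewrite !mul0r !subr0; ring.
Qed.

Lemma polyRV_quadform (B : nat -> nat -> R) n : polyRV Y (before n) 2 (quadform B n).
Proof.
apply: polyRV_sum => i _; apply: polyRV_sum => j _; apply: polyRVZ.
apply: polyRVD; first by apply: (polyRVM (m := 1) (n := 1)); apply: polyRV_var; exact: beforeP.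
by apply: (polyRV_le (n := 0)) => //; exact: polyRV_cst.
Qed.

(* The increments in n of quadform are differences for the filtration of the first
   n variables; the share th of each one is proportional to its row of B. *)
Lemma quadform_moment (B : nat -> nat -> R) n (v : R) :
  0 < v -> \sum_(i < n) \sum_(j < n) B i j ^+ 2 <= v ->
  \int[P]_w (quadform B n w ^+ (2 * r)) <= expR (4 ^+ r) * (quad_const * v) ^+ r.
Proof.
have dA : (2 * (2 * r) <= 4 * r)%N by clear; lia.
have dB : (1 * (2 * r) <= 4 * r)%N by clear; lia.
have dC : (1 * (2 * r) + 1 * (2 * r) <= 4 * r)%N by clear; lia.
have dD : (1 * (4 * r) <= 4 * r)%N by clear; lia.
have dE : (1 * (2 * r) + 2 * r <= 4 * r)%N by clear; lia.
have degZ : (2 * (2 * r).-1 + 2 <= 4 * r)%N by have := r0; clear; lia.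
have deg1 : (2 * (2 * r).-1 + 1 + 1 <= 4 * r)%N by have := r0; clear; lia.
move=> v0 Bv.
have mu0 : 0 <= mu by exact: le_trans mu1.
pose ww i := \sum_(j < i) (B j i + B i j) ^+ 2 + v / n.+1%:R.
pose th i := (ww i + B i i ^+ 2) / (3 * v).
pose K1 := expR (4 ^+ r) * (2 * mu) ^+ r * mu + 4 ^+ r * (2 * mu).
have K11 : 1 <= K1.
  rewrite /K1; apply: (@le_trans _ _ (0 + 1 * 1)); first by rewrite add0r mulr1.
  rewrite lerD ?mulr_ge0 ?expR_ge0 ?exprn_ge0 ?mulr_ge0//.
  have mu21 : 1 <= 2 * mu by have := mu1; lra.
  apply: ler_pM => //.
  by apply: exprn_ege1; rewrite ler1n.
have vn : 0 < v / n.+1%:R by rewrite divr_gt0.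
have ww0 i : 0 < ww i.
  by rewrite /ww ltr_wpDl// sumr_ge0// => j _; exact: sqr_ge0.
have thv i : th i * (quad_const * v) = (4 * K1) * (ww i + B i i ^+ 2).
  rewrite /th /quad_const -/K1; field.
  by rewrite gt_eqF.
have th0 i : 0 < th i by rewrite divr_gt0 ?mulr_gt0// ltr_wpDr// sqr_ge0.
have sumth : \sum_(i < n) th i <= 1.
  rewrite -mulr_suml ler_pdivrMr ?mulr_gt0// mul1r.
  have := sum_sqr_sym B n; rewrite /ww.
  under [X in _ -> X <= _]eq_bigr do rewrite addrAC.
  rewrite [X in _ -> X <= _]big_split /= sumr_const card_ord.
  have : v / n.+1%:R *+ n <= v.
    rewrite -[_ *+ n]mulr_natr -mulrA ler_piMr ?(ltW v0)//.
    by rewrite mulrC ler_pdivrMr// mul1r ler_nat.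
  move=> h1 h2; apply: le_trans (lerD h2 h1) _.
  rewrite [leRHS](_ : _ = 2 * v + v); last by ring.
  by rewrite lerD// ler_wpM2l.
pose L i := linform (fun j => B j i + B i j) i.
pose Dl i w := L i w * Y (idx i) w + B i i * (Y (idx i) w ^+ 2 - sg2).
have pQ i := polyRV_quadform B i.
have pL i : polyRV Y (before i) 1 (L i) by exact: polyRV_linform.
have pD i : polyRV Y predT 2 (Dl i).
  apply: polyRVD.
    by apply: (polyRVM (m := 1) (n := 1)); [exact: polyRV_sub (pL i)|exact: polyRV_var].
  apply: polyRVZ; apply: polyRVD; first by apply: (polyRVX (m := 1) 2); exact: polyRV_var.
  by apply: (polyRV_le (n := 0)) => //; exact: polyRV_cst.
apply: (@le_trans _ _ (expR (4 ^+ r * \sum_(i < n) th i) * (quad_const * v) ^+ r)); last first.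
  rewrite ler_wpM2r ?exprn_ge0 ?mulr_ge0 ?(ltW v0)//; first by rewrite -/K1; lra.
  by rewrite ler_expR ler_piMr// exprn_ge0.
apply: (@moment_induction _ _ _ P r (quadform B) Dl) => //.
- by rewrite !mulr_ge0 ?(ltW v0)// -/K1; lra.
- by move=> w; rewrite /quadform big_ord0.
- by move=> i w _; exact: quadformS.
- move=> i ilt; rewrite th0 /=; apply: le_trans sumth.
  by rewrite (bigD1 (Ordinal ilt)) //= lerDl sumr_ge0// => j _; exact: ltW.
- by move=> i _; exact: (intp (polyRVX (2 * r) (pQ i))).
- by move=> i _; exact: (intp (polyRVX (2 * r) (pD i))).
- move=> i _; apply: (intp (polyRVM (polyRVX _ (polyRV_sub _ (pQ i))) (pD i))) => //.
- move=> i _.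
  have pZ := polyRVX (2 * r).-1 (pQ i).
  have iZ k : (k <= 2)%N ->
      P.-integrable [set: T] (EFin \o (fun w => quadform B i w ^+ (2 * r).-1 * Y (idx i) w ^+ k)).
    move=> k2; apply: (intp (S := predT)
      (polyRVM (polyRV_sub _ pZ) (polyRVX k (polyRV_var Y (i := idx i) isT)))) => //.
    by rewrite mul1n (leq_trans _ degZ)// leq_add2l.
  (* The first summand is linear in the new variable and has mean 0; the other two cancel by [varY].
     The exponent 0 brings the constant term to the form that [factor] covers. *)
  have E w : quadform B i w ^+ (2 * r).-1 * Dl i w =
      quadform B i w ^+ (2 * r).-1 * L i w * Y (idx i) w +
      (B i i * (quadform B i w ^+ (2 * r).-1 * Y (idx i) w ^+ 2) +
       (- (B i i * sg2)) * (quadform B i w ^+ (2 * r).-1 * Y (idx i) w ^+ 0)).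
    by rewrite /Dl expr0; ring.
  under eq_Rintegral do rewrite E.
  rewrite RintegralD//; last 2 first.
  + apply: (intp (S := predT) (polyRVM (polyRV_sub _ (polyRVM pZ (pL i)))
      (polyRV_var Y (i := idx i) isT))) => //.
  + by apply: integrableDR; apply: integrableZR; exact: iZ.
  rewrite (integral0 (polyRVM pZ (pL i)) (beforeNn i))// add0r.
  rewrite RintegralD//; [|by apply: integrableZR; exact: iZ..].
  rewrite !RintegralZl//; [|exact: iZ..].
  rewrite !(factor pZ (beforeNn i)) ?varY//; last first.
    by rewrite addn0 (leq_trans _ degZ)// leq_addr.
  have -> : \int[P]_w (Y (idx i) w ^+ 0) = 1.
    under eq_Rintegral do rewrite expr0.
    exact: Rintegral_probability_cst.
  by ring.
- move=> i _.
  have iX S n' Z e : polyRV Y S n' Z -> (n' * e <= 4 * r)%N ->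
      P.-integrable [set: T] (EFin \o (fun w => Z w ^+ e)).
    by move=> pZ; apply: intp; exact: polyRVX pZ.
  have iL := iX _ _ _ (2 * r)%N (pL i) dB.
  have pY : polyRV Y predT 1 (Y (idx i)) by exact: polyRV_var.
  have iLY : P.-integrable [set: T] (EFin \o (fun w => L i w ^+ (2 * r) * Y (idx i) w ^+ (2 * r))).
    apply: (intp (polyRVM (polyRVX _ (polyRV_sub (S' := predT) _ (pL i))) (polyRVX _ pY))) => //.
  have iY4 : P.-integrable [set: T] (EFin \o (fun w => Y (idx i) w ^+ (4 * r))).
    exact: iX pY _.
  have ic : P.-integrable [set: T] (EFin \o (fun _ : T => sg2 ^+ (2 * r))).
    exact: finite_measure_integrable_cst.
  apply: (@le_trans _ _ (\int[P]_w (4 ^+ r * (L i w ^+ (2 * r) * Y (idx i) w ^+ (2 * r)) +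
      4 ^+ r * (B i i ^+ (2 * r) * 4 ^+ r) * (Y (idx i) w ^+ (4 * r) + sg2 ^+ (2 * r))))).
    apply: le_Rintegral => //.
    + exact: (intp (polyRVX (2 * r) (pD i))).
    + by apply: integrableDR; apply: integrableZR => //; exact: integrableDR.
    + move=> w _; rewrite /Dl; apply: le_trans (expr_add_le _ _) _.
      rewrite mulrDr -[in leRHS]exprMn lerD2l -!mulrA ler_wpM2l ?exprn_ge0//.
      rewrite exprMn ler_wpM2l//; first by rewrite exprM exprn_ge0// sqr_ge0.
      have := expr_add_le (Y (idx i) w ^+ 2) (- sg2).
      have -> : (- sg2) ^+ (2 * r) = sg2 ^+ (2 * r) by rewrite exprM sqrrN -exprM.
      by rewrite -[_ ^+ 2 ^+ _]exprM mulnA.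
  rewrite RintegralD//; [|by apply: integrableZR|by apply: integrableZR; exact: integrableDR].
  rewrite !RintegralZl//; last exact: integrableDR.
  rewrite RintegralD// Rintegral_probability_cst.
  rewrite (factor (polyRVX (2 * r) (pL i)) (beforeNn i))//.
  rewrite thv.
  have hL : \int[P]_w (L i w ^+ (2 * r)) <= expR (4 ^+ r) * (2 * ww i * mu) ^+ r.
    by apply: linform_moment => //; rewrite lerDl ltW.
  have hY := mu2 (idx i).
  have hY4 := mu4 (idx i).
  have Y0 : 0 <= \int[P]_w (Y (idx i) w ^+ (2 * r)).
    by apply: Rintegral_ge0 => w _; rewrite exprM exprn_ge0// sqr_ge0.
  have L0 : 0 <= \int[P]_w (L i w ^+ (2 * r)).
    by apply: Rintegral_ge0 => w _; rewrite exprM exprn_ge0// sqr_ge0.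
  apply: (@le_trans _ _ (4 ^+ r * (K1 * (ww i + B i i ^+ 2) ^+ r))); last first.
    rewrite !exprMn -mulrA ler_wpM2l ?exprn_ge0// ler_wpM2r//.
      by rewrite exprn_ge0// addr_ge0 ?sqr_ge0// ltW.
    exact: ler_eXnr.
  have wB : 0 <= ww i + B i i ^+ 2 by rewrite addr_ge0 ?sqr_ge0// ltW.
  have B0 : 0 <= B i i ^+ (2 * r) by rewrite exprM exprn_ge0// sqr_ge0.
  rewrite -!mulrA -mulrDr ler_wpM2l ?exprn_ge0// /K1 mulrDl lerD//.
    apply: le_trans (ler_pM L0 Y0 hL hY) _.
    rewrite [2 * ww i * mu](_ : _ = ww i * (2 * mu)); last by ring.
    rewrite exprMn [leLHS](_ : _ = expR (4 ^+ r) * (2 * mu) ^+ r * mu * ww i ^+ r); last by ring.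
    rewrite ler_wpM2l ?mulr_ge0 ?expR_ge0 ?exprn_ge0 ?mulr_ge0//.
    by rewrite lerXn2r ?nnegrE ?wB ?(ltW (ww0 i))// lerDl sqr_ge0.
  rewrite mulrC ler_pM//.
  + rewrite mulr_ge0 ?exprn_ge0// addr_ge0//; last by rewrite exprM exprn_ge0// sqr_ge0.
    by apply: Rintegral_ge0 => w _; rewrite (exprM _ 4) exprn_ge0// (exprM _ 2 2) sqr_ge0.
  + rewrite ler_wpM2l ?exprn_ge0// (_ : 2 * mu = mu + mu) ?lerD//; ring.
  + by rewrite exprM lerXn2r ?nnegrE ?wB ?sqr_ge0// lerDr ltW.
Qed.

End Forms.

(** * Integrals over [-pi, pi] and the Fejer kernel *)

Lemma integrable_addR {d} {T : measurableType d} {R : realType}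
    (mu : {measure set T -> \bar R}) (D : set T) (f g : T -> R) : measurable D ->
  mu.-integrable D (EFin \o f) -> mu.-integrable D (EFin \o g) ->
  mu.-integrable D (EFin \o (fun x => f x + g x)).
Proof.
move=> mD fi gi; rewrite (_ : _ \o _ = (EFin \o f) \+ (EFin \o g))%E; last by [].
exact: integrableD.
Qed.

Lemma young_sqr {R : realType} (p a b : R) : 0 < p ->
  a * b <= p * a ^+ 2 + (4 * p)^-1 * b ^+ 2.
Proof.
move=> p0; have pn0 := lt0r_neq0 p0.
rewrite -subr_ge0 (_ : _ - _ = (4 * p)^-1 * (2 * p * a - b) ^+ 2).
  by rewrite mulr_ge0 ?sqr_ge0// invr_ge0 mulr_ge0// ltW.
by field.
Qed.

Section TrigIntegrals.
Context {R : realType}.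
Implicit Types f g : R -> R.

Local Notation mu := (@lebesgue_measure R).

Definition pint g := \int[mu]_(u in `[(- pi)%R, pi%R]) g u.

Let mI : measurable (`[(- pi)%R, pi%R] : set R).
Proof. exact: measurable_itv. Qed.

Lemma pint_integrable g : continuous g -> mu.-integrable `[(- pi)%R, pi%R] (EFin \o g).
Proof.
move=> cg; apply: continuous_compact_integrable; first exact: segment_compact.
exact: continuous_subspaceT.
Qed.

Lemma continuousRD f g : continuous f -> continuous g -> continuous (fun x => f x + g x).
Proof. by move=> cf cg x; apply: cvgD; [exact: cf|exact: cg]. Qed.

Lemma continuousRM f g : continuous f -> continuous g -> continuous (fun x => f x * g x).
Proof. by move=> cf cg x; apply: cvgM; [exact: cf|exact: cg]. Qed.

Lemma continuousRZ (c : R) f : continuous f -> continuous (fun x => c * f x).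
Proof. by move=> cf; apply: continuousRM => //; exact: cst_continuous. Qed.

Lemma continuousRX f n : continuous f -> continuous (fun x => f x ^+ n).
Proof.
move=> cf; elim: n => [|n IH].
  by under eq_fun do rewrite expr0; exact: cst_continuous.
by under eq_fun do rewrite exprS; exact: continuousRM.
Qed.

Lemma continuousR_sum (J : Type) (s : seq J) (Pr : pred J) (F : J -> R -> R) :
  (forall j, continuous (F j)) -> continuous (fun x => \sum_(j <- s | Pr j) F j x).
Proof.
move=> cF; elim: s => [|j s IH].
  by under eq_fun do rewrite big_nil; exact: cst_continuous.
under eq_fun do rewrite big_cons.
by case: (Pr j) => //; exact: continuousRD.
Qed.

Lemma continuous_lin (a c : R) : continuous (fun x => a * x + c).
Proof.
apply: continuousRD; last exact: cst_continuous.
by apply: continuousRZ => x; exact: cvg_id.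
Qed.

Lemma continuous_cos_lin (a c : R) : continuous (fun x => cos (a * x + c)).
Proof. by move=> x; apply: continuous_comp; [exact: continuous_lin|exact: continuous_cos]. Qed.

Lemma continuous_sin_lin (a c : R) : continuous (fun x => sin (a * x + c)).
Proof. by move=> x; apply: continuous_comp; [exact: continuous_lin|exact: continuous_sin]. Qed.

Lemma pintD f g : continuous f -> continuous g ->
  pint (fun x => f x + g x) = pint f + pint g.
Proof. by move=> cf cg; rewrite /pint RintegralD//; exact: pint_integrable. Qed.

Lemma pintZ (c : R) f : continuous f -> pint (fun x => c * f x) = c * pint f.
Proof. by move=> cf; rewrite /pint RintegralZl//; exact: pint_integrable. Qed.

Lemma pint_cst (c : R) : pint (fun=> c) = 2 * pi * c.
Proof.
have E : mu (`[(- pi)%R, pi%R] : set R) = (2 * pi)%:E.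
  rewrite lebesgue_measure_itv /= lte_fin gtrN ?pi_gt0// -EFinB opprK.
  by rewrite mulr_natl mulr2n.
by rewrite /pint Rintegral_cst// [X in fine X]E /= mulrC.
Qed.

Lemma pint_le f g : continuous f -> continuous g ->
  (forall x, x \in `[- pi, pi] -> f x <= g x) -> pint f <= pint g.
Proof.
by move=> cf cg fg; apply: le_Rintegral => //; exact: pint_integrable.
Qed.

Lemma pint_sum (J : Type) (s : seq J) (Pr : pred J) (F : J -> R -> R) :
  (forall j, continuous (F j)) ->
  pint (fun x => \sum_(j <- s | Pr j) F j x) = \sum_(j <- s | Pr j) pint (F j).
Proof.
move=> cF; elim: s => [|j s IH].
  rewrite big_nil; under [X in pint X]eq_fun do rewrite big_nil.
  by rewrite pint_cst mulr0.
under [X in pint X]eq_fun do rewrite big_cons.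
rewrite big_cons; case: (Pr j) => //.
by rewrite pintD ?IH//; exact: continuousR_sum.
Qed.

Lemma sin_nat_pi (n : nat) : sin (n%:R * pi) = 0 :> R.
Proof.
elim: n => [|n IH]; first by rewrite mul0r sin0.
by rewrite -natr1 mulrDl mul1r sinDpi IH oppr0.
Qed.

Lemma sin_int_pi (n : int) : sin (n%:~R * pi) = 0 :> R.
Proof.
case: n => n; first exact: sin_nat_pi.
by rewrite NegzE mulrNz mulNr sinN sin_nat_pi oppr0.
Qed.

Lemma pint_cos (n : int) (c : R) :
  pint (fun v => cos (n%:~R * v + c)) = (n == 0)%:R * (2 * pi * cos c).
Proof.
have [->|n0] := eqVneq n 0.
  under [X in pint X]eq_fun do rewrite mul0r add0r.
  by rewrite pint_cst mul1r.
rewrite mul0r /pint /Rintegral.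
have n0' : (n%:~R : R) != 0 by rewrite intr_eq0.
pose F (v : R) := n%:~R^-1 * sin (n%:~R * v + c).
have dF (v : R) : is_derive v 1 F (cos (n%:~R * v + c)).
  have dl : is_derive v 1 (fun v : R => n%:~R * v + c) n%:~R.
    have := is_deriveD (is_deriveZ n%:~R (is_derive_id v 1)) (is_derive_cst c v 1).
    by rewrite addr0 /GRing.scale /= mulr1.
  have ds := @is_derive1_comp R sin _ v _ _ (is_derive_sin _) dl.
  have : is_derive v 1 (fun v => n%:~R^-1 *: (sin \o (fun v : R => n%:~R * v + c)) v)
    (n%:~R^-1 *: (cos (n%:~R * v + c) * n%:~R)) by exact: is_deriveZ.
  by rewrite /GRing.scale /= mulrCA mulVf// mulr1.
have cF : continuous F.
  by apply: continuousRZ; exact: continuous_sin_lin.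
rewrite (@continuous_FTC2 _ _ F)//.
- suff -> : F (- pi) = F pi by rewrite -EFinB subrr.
  by rewrite /F mulrN !sinD cosN sinN sin_int_pi oppr0.
- by rewrite gtrN// pi_gt0.
- by apply: continuous_subspaceT; exact: continuous_cos_lin.
- split; first by move=> x _; have [] := dF x.
  + by apply: cvg_at_right_filter; exact: cF.
  + by apply: cvg_at_left_filter; exact: cF.
- by move=> x _; rewrite derive1E; have [_ ->] := dF x.
Qed.

Lemma pint_cos_cos (h k : nat) :
  pint (fun u => cos (h%:R * u) * cos (k%:R * u)) =
  pi * ((h == k)%:R + ((h == 0%N) && (k == 0%N))%:R).
Proof.
have E u : cos (h%:R * u) * cos (k%:R * u) =
    2^-1 * cos ((h%:Z - k%:Z)%:~R * u + 0) + 2^-1 * cos ((h%:Z + k%:Z)%:~R * u + 0).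
  by rewrite !addr0 intrB intrD !mulrBl !mulrDl cosB cosD; field.
under [X in pint X]eq_fun do rewrite E.
have c1 (n : int) : continuous (fun u : R => 2^-1 * cos (n%:~R * u + 0)).
  by apply: continuousRZ; exact: continuous_cos_lin.
rewrite pintD// !pintZ; [|exact: continuous_cos_lin..].
rewrite !pint_cos cos0 subr_eq0 eqz_nat.
have -> : (h%:Z + k%:Z == 0) = (h == 0%N) && (k == 0%N) by case: h k {E} => [|h] [|k].
by field.
Qed.

Lemma integrable_mul_continuous (phi g : R -> R) :
  mu.-integrable `[(- pi)%R, pi%R] (EFin \o phi) -> continuous g ->
  mu.-integrable `[(- pi)%R, pi%R] (EFin \o (fun u => phi u * g u)).
Proof.
move=> iphi cg; rewrite (_ : EFin \o _ = ((EFin \o phi) \* (EFin \o g))%E); last first.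
  by apply/funext => u /=; rewrite EFinM.
apply: integrableMl => //.
  by apply: measurable_funTS; exact: continuous_measurable_fun.
have ctsg : {within `[(- pi)%R, pi%R], continuous g} by exact: continuous_subspaceT.
have /compact_bounded[M [_ mrt]] := continuous_compact ctsg (@segment_compact R (- pi) pi).
by exists M; split; rewrite ?num_real // => ? ? ? ?; exact: mrt.
Qed.

(** Bessel's inequality. With g the cosine polynomial whose coefficients are those of [phi], the sum
    S is the integral of [phi] g, hence at most pi times that of phi^2 plus 1 / (4 pi) times that of
    g^2, by Young's inequality. The first integral is at most M and the second at most 2 pi S, so
    that S <= pi M + S / 2. Applied to the kernel, of height O(m), this is the source of the factor
    m in the variance. *)
Lemma bessel_cos (phi : R -> R) (M : R) (n : nat) :
  mu.-integrable `[(- pi)%R, pi%R] (EFin \o phi) ->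
  (forall u, 0 <= phi u <= M) -> pint phi <= 1 ->
  \sum_(h < n) (pint (fun u => phi u * cos (h%:R * u))) ^+ 2 <= 2 * pi * M.
Proof.
move=> iphi phiM phi1.
have pi0 : (0 : R) < pi by exact: pi_gt0.
have M0 : 0 <= M by have /andP[] := phiM 0; exact: le_trans.
pose A h := pint (fun u => phi u * cos (h%:R * u)).
rewrite -/(A _); set S := \sum_(h < n) _.
pose g u := \sum_(h < n) A h * cos (h%:R * u).
have cc (h : nat) : continuous (fun u : R => cos (h%:R * u)).
  by under eq_fun do rewrite -[_ * _]addr0; exact: continuous_cos_lin.
have cg : continuous g.
  by apply: continuousR_sum => h; apply: continuousRZ.
have ipc (f : R -> R) : continuous f ->
    mu.-integrable `[(- pi)%R, pi%R] (EFin \o (fun u => phi u * f u)).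
  exact: integrable_mul_continuous.
have SE : S = pint (fun u => phi u * g u).
  rewrite /S /g /pint.
  have -> : (fun u => phi u * \sum_(h < n) A h * cos (h%:R * u)) =
            (fun u => \sum_(h < n) A h * (phi u * cos (h%:R * u))).
    by apply/funext => u; rewrite mulr_sumr; apply: eq_bigr => h _; rewrite mulrCA.
  rewrite (_ : \int[mu]_(u in _) _ = \sum_(h < n) A h * A h).
    by apply: eq_bigr => h _; rewrite expr2.
  elim: n {S g cg} => [|k IH].
    by rewrite big_ord0; under eq_Rintegral do rewrite big_ord0; rewrite Rintegral_cst// mul0r.
  rewrite big_ord_recr /= -IH.
  transitivity (\int[mu]_(u in `[(- pi)%R, pi%R])
      (\sum_(h < k) A h * (phi u * cos (h%:R * u)) + A k * (phi u * cos (k%:R * u)))).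
    by apply: eq_Rintegral => u _; rewrite big_ord_recr.
  rewrite RintegralD//.
  + congr (_ + _); rewrite RintegralZl//; exact: ipc.
  + rewrite (_ : EFin \o _ = (EFin \o (fun u => phi u * \sum_(h < k) A h * cos (h%:R * u)))).
      by apply: ipc; apply: continuousR_sum => h; apply: continuousRZ.
    apply/funext => u /=; congr EFin; rewrite mulr_sumr.
    by apply: eq_bigr => h _; rewrite mulrCA.
  + rewrite (_ : EFin \o _ = (EFin \o (fun u => phi u * (A k * cos (k%:R * u))))).
      by apply: ipc; exact: continuousRZ.
    by apply/funext => u /=; congr EFin; rewrite mulrCA.
have gE : pint (fun u => g u ^+ 2) <= 2 * pi * S.
  have E u : g u ^+ 2 = \sum_(h < n) \sum_(k < n) (A h * A k) * (cos (h%:R * u) * cos (k%:R * u)).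
    rewrite expr2 /g big_distrl /=; apply: eq_bigr => h _.
    by rewrite big_distrr /=; apply: eq_bigr => k _; rewrite mulrACA.
  under [X in pint X]eq_fun do rewrite E.
  have chk (h k : nat) : continuous (fun u : R => (A h * A k) * (cos (h%:R * u) * cos (k%:R * u))).
    by apply: continuousRZ; exact: continuousRM.
  rewrite pint_sum; last by move=> h; exact: continuousR_sum.
  rewrite /S mulr_sumr; apply: ler_sum => h _.
  rewrite pint_sum//.
  rewrite (bigD1 h) //= big1 => [|k kh].
    rewrite pintZ; last exact: continuousRM.
    rewrite pint_cos_cos eqxx addr0 andbb -expr2 mulrC ler_wpM2r ?sqr_ge0//.
    by rewrite mulrC ler_wpM2r ?(ltW pi0)//; case: (_ == _) => /=; lra.
  rewrite pintZ; last exact: continuousRM.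
  rewrite pint_cos_cos; have -> : (h == k :> nat) = false by rewrite eq_sym; exact: negbTE.
  have -> : ((h == 0%N :> nat) && (k == 0%N :> nat)) = false.
    apply/negP => /andP[/eqP h0 /eqP k0]; move: kh; rewrite -val_eqE /= h0 k0.
    by rewrite eqxx.
  by rewrite addr0 mulr0 mulr0.
have : S <= pi * M * pint phi + (4 * pi)^-1 * pint (fun u => g u ^+ 2).
  have ig2 : mu.-integrable `[(- pi)%R, pi%R] (EFin \o (fun u => (4 * pi)^-1 * g u ^+ 2)).
    by apply: pint_integrable; apply: continuousRZ; exact: continuousRX.
  have ipM : mu.-integrable `[(- pi)%R, pi%R] (EFin \o (fun u => pi * M * phi u)).
    rewrite (_ : EFin \o _ = (EFin \o (fun u => phi u * (pi * M)))).
      by apply: ipc; exact: cst_continuous.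
    by apply/funext => u /=; rewrite mulrC.
  rewrite SE -(pintZ _ (f := fun u => g u ^+ 2)); last exact: continuousRX.
  rewrite /pint -RintegralZl// -RintegralD//.
  apply: le_Rintegral => //; first exact: ipc.
    exact: integrable_addR.
  move=> u _; have /andP[p0 pM] := phiM u.
  apply: (@le_trans _ _ (pi * phi u ^+ 2 + (4 * pi)^-1 * g u ^+ 2)).
    exact: young_sqr.
  by rewrite lerD2r -mulrA expr2 ler_wpM2l ?(ltW pi0)// ler_wpM2r.
move=> /le_trans => /(_ (pi * M + 2^-1 * S)).
have h1 : pi * M * pint phi <= pi * M by rewrite ler_piMr// mulr_ge0// ltW.
have h2 : (4 * pi)^-1 * pint (fun u => g u ^+ 2) <= 2^-1 * S.
  have pn0 : (pi : R) != 0 by exact: lt0r_neq0.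
  have aux (x y : R) : x != 0 -> 2^-1 * y = (4 * x)^-1 * (2 * x * y).
    by move=> x0; field.
  rewrite (aux _ S pn0).
  by rewrite ler_wpM2l// invr_ge0 mulr_ge0// ltW.
move=> /(_ (lerD h1 h2)); rewrite (_ : 2 * pi * M = pi * M + pi * M); last by ring.
by move: (pi * M) => x; clearbody S; clear; lra.
Qed.

End TrigIntegrals.

Section Fejer.
Context {R : realType}.
Variables (c e M : nat) (b : nat -> nat -> R) (p : nat -> int) (C S : R -> R).
Hypothesis p_inj : injective p.
Hypothesis CE : forall s v, (c <= s < e)%N ->
  C v = \sum_(i < M) b s i * cos ((s%:Z - p i)%:~R * v).
Hypothesis SE : forall s v, (c <= s < e)%N ->
  S v = \sum_(i < M) b s i * sin ((s%:Z - p i)%:~R * v).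

(** The squared modulus of the transfer function can be read off from any two rows. Writing one
    factor with row s and its conjugate with row t, the phases of s and t cancel those of the kernel
    at v, and only the frequencies [p j - p i] remain. *)
Lemma cos_kernel_expand s t u v : (c <= s < e)%N -> (c <= t < e)%N ->
  cos ((s%:Z - t%:Z)%:~R * (u - v)) * (C v ^+ 2 + S v ^+ 2) =
  \sum_(i < M) \sum_(j < M) b s i * b t j *
    cos ((p j - p i)%:~R * v + (s%:Z - t%:Z)%:~R * u).
Proof.
move=> hs ht.
pose Cc s := \sum_(i < M) b s i * cos ((p i)%:~R * v).
pose Ss s := \sum_(i < M) b s i * sin ((p i)%:~R * v).
have EC r : (c <= r < e)%N -> C v = cos (r%:R * v) * Cc r + sin (r%:R * v) * Ss r.
  move=> hr; rewrite (CE v hr) !mulr_sumr -big_split /=; apply: eq_bigr => i _.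
  by rewrite intrB mulrBl cosB; ring.
have ES r : (c <= r < e)%N -> S v = sin (r%:R * v) * Cc r - cos (r%:R * v) * Ss r.
  move=> hr; rewrite (SE v hr) !mulr_sumr -sumrB /=; apply: eq_bigr => i _.
  by rewrite intrB mulrBl sinB; ring.
have Cinv r : (c <= r < e)%N -> Cc r = cos (r%:R * v) * C v + sin (r%:R * v) * S v.
  move=> hr; rewrite (EC r hr) (ES r hr); have := cos2Dsin2 (r%:R * v).
  move: (cos _) (sin _) (Cc r) (Ss r) => x y z z' xy.
  by rewrite -[LHS]mul1r -xy; ring.
have Sinv r : (c <= r < e)%N -> Ss r = sin (r%:R * v) * C v - cos (r%:R * v) * S v.
  move=> hr; rewrite (EC r hr) (ES r hr); have := cos2Dsin2 (r%:R * v).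
  move: (cos _) (sin _) (Cc r) (Ss r) => x y z z' xy.
  by rewrite -[LHS]mul1r -xy; ring.
have -> : \sum_(i < M) \sum_(j < M) b s i * b t j *
    cos ((p j - p i)%:~R * v + (s%:Z - t%:Z)%:~R * u) =
    cos ((s%:Z - t%:Z)%:~R * u) * (Cc s * Cc t + Ss s * Ss t) -
    sin ((s%:Z - t%:Z)%:~R * u) * (Cc s * Ss t - Ss s * Cc t).
  rewrite /Cc /Ss !big_distrlr /= -big_split -sumrB /= !mulr_sumr -sumrB.
  apply: eq_bigr => i _; rewrite -big_split -sumrB /= !mulr_sumr -sumrB.
  apply: eq_bigr => j _; rewrite intrB mulrBl addrC cosD cosB sinB.
  by ring.
rewrite (Cinv s hs) (Cinv t ht) (Sinv s hs) (Sinv t ht) mulrBr cosB.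
rewrite {2 4}intrB !mulrBl cosB sinB.
by ring.
Qed.

(** Since [p] is injective, only the terms with i = j have frequency 0 in v: what remains is the
    covariance of the times s and t. *)
Lemma pint_cos_kernel s t u : (c <= s < e)%N -> (c <= t < e)%N ->
  pint (fun v => cos ((s%:Z - t%:Z)%:~R * (u - v)) * (C v ^+ 2 + S v ^+ 2)) =
  2 * pi * (cos ((s%:Z - t%:Z)%:~R * u) * \sum_(i < M) b s i * b t i).
Proof.
move=> hs ht.
under [X in pint X]eq_fun do rewrite cos_kernel_expand//.
have cl (i j : nat) : continuous (fun v : R =>
    b s i * b t j * cos ((p j - p i)%:~R * v + (s%:Z - t%:Z)%:~R * u)).
  by apply: continuousRZ; exact: continuous_cos_lin.
rewrite pint_sum; last by move=> i; exact: continuousR_sum.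
rewrite !mulr_sumr; apply: eq_bigr => i _; rewrite pint_sum// (bigD1 i)//= big1.
  rewrite pintZ; last exact: continuous_cos_lin.
  by rewrite pint_cos subrr eqxx mul1r addr0; ring.
move=> j ji; rewrite pintZ; last exact: continuous_cos_lin.
rewrite pint_cos subr_eq0; have -> : (p j == p i) = false.
  by apply/negbTE; apply: contra ji => /eqP/p_inj/val_inj ->.
by rewrite mul0r mulr0.
Qed.

(** The squared modulus of the sum of e^(isw) over c <= s < e, which is e - c times the Fejer
    kernel. *)
Definition dirichlet_sqr (w : R) :=
  \sum_(c <= s < e) \sum_(c <= t < e) cos ((s%:Z - t%:Z)%:~R * w).

Lemma dirichlet_sqr_ge0 w : 0 <= dirichlet_sqr w.
Proof.
rewrite (_ : dirichlet_sqr w = (\sum_(c <= s < e) cos (s%:R * w)) ^+ 2 +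
    (\sum_(c <= s < e) sin (s%:R * w)) ^+ 2); first by rewrite addr_ge0 ?sqr_ge0.
rewrite !expr2 !big_distrlr /= -big_split; apply: eq_bigr => s _.
by rewrite -big_split; apply: eq_bigr => t _; rewrite /= intrB mulrBl cosB.
Qed.

Lemma continuous_cos_sub (n : int) (u : R) : continuous (fun v => cos (n%:~R * (u - v))).
Proof.
rewrite (_ : (fun v => _) = (fun v => cos ((- n%:~R) * v + n%:~R * u))).
  exact: continuous_cos_lin.
by apply/funext => v; congr cos; ring.
Qed.

Lemma continuous_dirichlet_sqr u : continuous (fun v => dirichlet_sqr (u - v)).
Proof.
by apply: continuousR_sum => s; apply: continuousR_sum => t; exact: continuous_cos_sub.
Qed.

Lemma pint_cos_sub (n : int) (u : R) :
  pint (fun v => cos (n%:~R * (u - v))) = 2 * pi * (n == 0)%:R.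
Proof.
rewrite (_ : (fun v => _) = (fun v => cos ((- n)%:~R * v + n%:~R * u))).
  rewrite pint_cos oppr_eq0; have [->|_] := eqVneq n 0; last by rewrite mul0r mulr0.
  by rewrite mul0r cos0; ring.
by apply/funext => v; congr cos; rewrite mulrNz; ring.
Qed.

Lemma pint_dirichlet_sqr u : pint (fun v => dirichlet_sqr (u - v)) = 2 * pi * (e - c)%:R.
Proof.
rewrite pint_sum; last by move=> s; apply: continuousR_sum => t; exact: continuous_cos_sub.
transitivity (\sum_(c <= s < e) (2 * pi : R)); last first.
  by rewrite sumr_const_nat mulr_natr.
rewrite big_nat [RHS]big_nat; apply: eq_bigr => s hs.
rewrite pint_sum; last by move=> t; exact: continuous_cos_sub.
rewrite (bigD1_seq s) ?mem_index_iota ?iota_uniq//= pint_cos_sub subrr eqxx mulr1.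
rewrite big1 ?addr0// => t ts; rewrite pint_cos_sub subr_eq0 eqz_nat eq_sym (negbTE ts).
by rewrite mulr0.
Qed.

Lemma sum_consecutive n :
  (n.-1%:R : R) <= \sum_(i < n) \sum_(j < n) ((i == j.+1 :> nat)%:R : R).
Proof.
elim: n => [|n IH]; first by rewrite big_ord0.
rewrite big_ord_recr /=; under eq_bigr do rewrite big_ord_recr /=.
rewrite big_split /=; case: n IH => [|n] IH; first by rewrite !big_ord0 big_ord_recl big_ord0 /= ?addr0.
apply: (@le_trans _ _ (n%:R + 0 + 1)); first by rewrite addr0 natr1.
apply: lerD; first by apply: lerD => //; apply: sumr_ge0 => i _.
rewrite big_ord_recr /= -[leLHS]addr0; apply: lerD => //.
rewrite big_ord_recr /= eqxx lerDr; apply: sumr_ge0 => i _.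
by [].
Qed.

(** The product with cos selects the pairs of consecutive times, e - c - 1 in each order. Combined
    with [pint_dirichlet_sqr], the integral of the kernel against 1 - cos is at most 2 pi, whatever
    the length of the block. *)
Lemma pint_dirichlet_sqr_cos u : (c < e)%N ->
  2 * pi * (e - c).-1%:R <= pint (fun v => dirichlet_sqr (u - v) * cos (u - v)).
Proof.
move=> ce.
have E w : dirichlet_sqr w * cos w =
    \sum_(c <= s < e) \sum_(c <= t < e)
      (2^-1 * cos ((s%:Z - t%:Z - 1)%:~R * w) + 2^-1 * cos ((t%:Z - s%:Z - 1)%:~R * w)).
  rewrite /dirichlet_sqr mulr_suml; apply: eq_bigr => s _.
  rewrite mulr_suml; apply: eq_bigr => t _.
  rewrite (_ : (t%:Z - s%:Z - 1)%:~R * w = - ((s%:Z - t%:Z)%:~R * w + w)).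
    rewrite cosN (_ : (s%:Z - t%:Z - 1)%:~R * w = (s%:Z - t%:Z)%:~R * w - w).
      by rewrite cosB cosD; field.
    by rewrite [in LHS]intrB; ring.
  by rewrite !intrB; ring.
under [X in _ <= pint X]eq_fun do rewrite E.
have cst (s t : nat) : continuous (fun v : R => 2^-1 * cos ((s%:Z - t%:Z - 1)%:~R * (u - v)) +
       2^-1 * cos ((t%:Z - s%:Z - 1)%:~R * (u - v))).
  by apply: continuousRD; apply: continuousRZ; exact: continuous_cos_sub.
rewrite pint_sum; last by move=> s; exact: continuousR_sum.
have Est s t : pint (fun v : R => 2^-1 * cos ((s%:Z - t%:Z - 1)%:~R * (u - v)) +
       2^-1 * cos ((t%:Z - s%:Z - 1)%:~R * (u - v))) =
    pi * (s == t.+1)%:R + pi * (t == s.+1)%:R.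
  rewrite pintD; [|by apply: continuousRZ; exact: continuous_cos_sub..].
  rewrite !pintZ; [|exact: continuous_cos_sub..].
  rewrite !pint_cos_sub.
  have -> : (s%:Z - t%:Z - 1 == 0) = (s == t.+1) by apply/eqP/eqP; lia.
  have -> : (t%:Z - s%:Z - 1 == 0) = (t == s.+1) by apply/eqP/eqP; lia.
  by field.
have -> : \sum_(c <= s < e) pint (fun v => \sum_(c <= t < e)
      (2^-1 * cos ((s%:Z - t%:Z - 1)%:~R * (u - v)) +
       2^-1 * cos ((t%:Z - s%:Z - 1)%:~R * (u - v)))) =
    pi * \sum_(c <= s < e) \sum_(c <= t < e) (s == t.+1)%:R +
    pi * \sum_(c <= s < e) \sum_(c <= t < e) (t == s.+1)%:R.
  rewrite !mulr_sumr -big_split; apply: eq_bigr => s _; rewrite pint_sum//.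
  by rewrite /= !mulr_sumr -big_split; apply: eq_bigr => t _; rewrite Est.
have shift (F : nat -> nat -> R) : \sum_(c <= s < e) \sum_(c <= t < e) F s t =
    \sum_(i < e - c) \sum_(j < e - c) F (i + c)%N (j + c)%N.
  rewrite -{1}[c]add0n big_addn big_mkord; apply: eq_bigr => i _.
  by rewrite -{1}[c]add0n big_addn big_mkord.
rewrite [X in _ + pi * X]exchange_big /= -mulrDr -[leLHS]mulrA mulrCA ler_wpM2l ?pi_ge0//.
rewrite !shift.
have := sum_consecutive (e - c).
under eq_bigr do under eq_bigr do rewrite -(eqn_add2r c).
rewrite (_ : 2 * _ = (e - c).-1%:R + (e - c).-1%:R); last by ring.
by move=> h; rewrite lerD.
Qed.

(* A modulus of continuity |u - v| is replaced by t (1 - cos (u - v)) + 1 / t, up to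
   a factor: the Fejer kernel then only enters through its first two Fourier
   coefficients, without logarithmic loss. *)
Lemma fejer_bias (u F eps L t : R) : (c < e)%N -> 0 < t -> 0 <= L ->
  continuous C -> continuous S ->
  (forall v, v \in `[- pi, pi] ->
    `|C v ^+ 2 + S v ^+ 2 - F| <= eps + L * (t * (1 - cos (u - v)) + t^-1)) ->
  `|\sum_(c <= s < e) \sum_(c <= r < e)
      (cos ((s%:Z - r%:Z)%:~R * u) * \sum_(i < M) b s i * b r i) - (e - c)%:R * F| <=
  (e - c)%:R * eps + L * (t + (e - c)%:R / t).
Proof.
move=> ce t0 L0 cC cS H.
have cf : continuous (fun v => C v ^+ 2 + S v ^+ 2).
  by apply: continuousRD; exact: continuousRX.
set Z := \sum_(c <= s < e) _.
have pi0 : (0 : R) < 2 * pi by rewrite mulr_gt0// pi_gt0.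
have cK : continuous (fun v => dirichlet_sqr (u - v)) by exact: continuous_dirichlet_sqr.
have ZE : 2 * pi * Z = pint (fun v => dirichlet_sqr (u - v) * (C v ^+ 2 + S v ^+ 2)).
  have cst (s r : nat) : continuous (fun v : R =>
      cos ((s%:Z - r%:Z)%:~R * (u - v)) * (C v ^+ 2 + S v ^+ 2)).
    by apply: continuousRM => //; exact: continuous_cos_sub.
  under [X in _ = pint X]eq_fun.
    move=> v; rewrite /dirichlet_sqr mulr_suml.
    under eq_bigr do rewrite mulr_suml. over.
  rewrite pint_sum; last by move=> s; exact: continuousR_sum.
  rewrite /Z mulr_sumr big_nat [RHS]big_nat; apply: eq_bigr => s hs.
  rewrite pint_sum// mulr_sumr big_nat [RHS]big_nat; apply: eq_bigr => r hr.
  by rewrite pint_cos_kernel.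
have FE : 2 * pi * ((e - c)%:R * F) = pint (fun v => dirichlet_sqr (u - v) * F).
  under [X in _ = pint X]eq_fun do rewrite mulrC.
  by rewrite pintZ// pint_dirichlet_sqr; ring.
pose dev v := eps + L * (t * (1 - cos (u - v)) + t^-1).
have cdev : continuous dev.
  rewrite (_ : dev = (fun v => (eps + L * t + L * t^-1) + (- (L * t)) * cos (1%:~R * (u - v)))).
    apply: continuousRD; first exact: cst_continuous.
    by apply: continuousRZ; exact: continuous_cos_sub.
  by apply/funext => v; rewrite /dev mul1r; ring.
have DE : pint (fun v => dirichlet_sqr (u - v) * dev v) <=
    2 * pi * ((e - c)%:R * eps + L * (t + (e - c)%:R / t)).
  have E v : dirichlet_sqr (u - v) * dev v =
     (eps + L * t + L * t^-1) * dirichlet_sqr (u - v) +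
     (- (L * t)) * (dirichlet_sqr (u - v) * cos (u - v)).
    by rewrite /dev; ring.
  under [X in pint X <= _]eq_fun do rewrite E.
  have cKc : continuous (fun v => dirichlet_sqr (u - v) * cos (u - v)).
    apply: continuousRM => //.
    rewrite (_ : (fun v => _) = (fun v => cos (1%:~R * (u - v)))).
      exact: continuous_cos_sub.
    by apply/funext => v; rewrite mul1r.
  rewrite pintD; [|exact: continuousRZ..].
  rewrite !pintZ// pint_dirichlet_sqr.
  have h := pint_dirichlet_sqr_cos u ce.
  have Lt : 0 <= L * t by rewrite mulr_ge0// ltW.
  have := ler_wpM2l Lt h.
  have -> : (e - c).-1%:R = (e - c)%:R - 1 :> R.
    by rewrite -subn1 natrB// subn_gt0.
  move: (pint _) => J; move: (e - c)%:R t^-1 => n ti hJ.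
  rewrite -subr_ge0 (_ : _ - _ = L * t * J - L * t * (2 * pi * (n - 1))) ?subr_ge0//.
  by ring.
have dK v : 0 <= dirichlet_sqr (u - v) by exact: dirichlet_sqr_ge0.
have cN1 : continuous (fun v => dirichlet_sqr (u - v) * (C v ^+ 2 + S v ^+ 2)) by exact: continuousRM.
have cN2 : continuous (fun v => dirichlet_sqr (u - v) * F).
  by apply: continuousRM => //; exact: cst_continuous.
have cN3 : continuous (fun v => dirichlet_sqr (u - v) * dev v) by exact: continuousRM.
have Hd v : v \in `[- pi, pi] -> `|C v ^+ 2 + S v ^+ 2 - F| <= dev v by move=> hv; exact: H.
rewrite -(ler_pM2l pi0) -[X in X * `|_|](gtr0_norm pi0) -normrM mulrBr.
apply: le_trans DE; rewrite ZE FE ler_norml; apply/andP; split.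
  rewrite lerNl opprB lerBlDl -pintD//; apply: pint_le => //; first exact: continuousRD.
  move=> v /Hd; rewrite -mulrDr ler_norml => /andP[h _]; rewrite ler_wpM2l//.
  by move: h; lra.
rewrite lerBlDl -pintD//; apply: pint_le => //; first exact: continuousRD.
move=> v /Hd; rewrite -mulrDr ler_norml => /andP[_ h]; rewrite ler_wpM2l//.
by move: h; lra.
Qed.

End Fejer.

(** * The spectral window *)

Section Affine.
Context {R : realType}.
Local Notation mu := (@lebesgue_measure R).
Variables (a l : R).
Hypothesis a0 : 0 < a.

Definition affine_rev (x : R) : measurableTypeR R := a * (l - x).

Lemma measurable_affine_rev : measurable_fun [set: R] affine_rev.
Proof.
apply: continuous_measurable_fun; rewrite (_ : affine_rev = (fun x => (- a) * x + a * l)).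
  exact: continuous_lin.
by apply/funext => x; rewrite /affine_rev; ring.
Qed.

(** By uniqueness of Lebesgue measure, half-open intervals are enough. The reflection exchanges
    their open and closed ends, which does not change the length. *)
Lemma pushforward_affine_rev (A : set R) : measurable A ->
  (a%:E * pushforward mu affine_rev A)%E = mu A.
Proof.
move=> mA.
have -> : (a%:E * pushforward mu affine_rev A = mscale (NngNum (ltW a0)) (pushforward mu affine_rev) A)%E.
- by [].
- exact: measurable_affine_rev.
move=> mf; apply/esym; apply: lebesgue_measure_unique => //= _ [[x y]] _ <-.
change (mu `]x, y] = (a%:E * mu (affine_rev @^-1` `]x, y]))%E).
have -> : affine_rev @^-1` `]x, y] = `[l - y / a, l - x / a[%classic.
  apply/seteqP; split => z /=; rewrite !in_itv /= /affine_rev.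
    move=> /andP[h1 h2]; rewrite lerBlDr -lerBlDl ltrBrDr -ltrBrDl.
    by rewrite ler_pdivlMr// ltr_pdivrMr// ![_ * a]mulrC h1 h2.
  rewrite lerBlDr -lerBlDl ltrBrDr -ltrBrDl ler_pdivlMr// ltr_pdivrMr//.
  by rewrite ![_ * a]mulrC => /andP[-> ->].
rewrite !lebesgue_measure_itv /= !lte_fin ltrD2l ltrN2 ltr_pM2r ?invr_gt0//.
case: ifP => _; last by rewrite mule0.
rewrite -!EFinB -EFinM; congr EFin; field.
exact: lt0r_neq0.
Qed.

Lemma ge0_integral_affine_rev (f : R -> \bar R) : measurable_fun [set: R] f ->
  (forall x, 0 <= f x)%E ->
  (a%:E * \int[mu]_x f (a * (l - x))%R = \int[mu]_x f x)%E.
Proof.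
move=> mf f0.
have mphi := measurable_affine_rev.
have <- : (\int[pushforward mu affine_rev]_y f y = \int[mu]_x f (a * (l - x))%R)%E.
  by rewrite ge0_integral_pushforward.
rewrite -(@ge0_integral_mscale _ _ R (pushforward mu affine_rev) setT _ (NngNum (ltW a0)))//.
by apply: eq_measure_integral => A mA _; exact: pushforward_affine_rev.
Qed.

End Affine.

Section Window.
Context {R : realType}.
Local Notation mu := (@lebesgue_measure R).
Variable W : R -> R.
Hypothesis W0 : forall u, 0 <= W u.
Hypothesis Weven : forall u, W (- u) = W u.
Variable MW : R.
Hypothesis WM : forall u, W u <= MW.
Hypothesis Wint : mu.-integrable [set: R] (fun u => (W u)%:E).
Hypothesis Wpi : (\int[mu]_(v in `[(- pi)%R, pi%R]) (W v)%:E = 1)%E.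
Hypothesis WR : (\int[mu]_v (W v)%:E = 1)%E.

Local Notation I := (`[(- pi)%R, pi%R]%classic : set R).

Lemma measurable_W : measurable_fun [set: R] W.
Proof. by apply/measurable_EFinP; exact: (measurable_int mu). Qed.

Let mind (A : set R) : measurable A -> measurable_fun [set: R] (fun v => W v * \1_A v).
Proof. by move=> mA; apply: measurable_funM; [exact: measurable_W|exact: measurable_indic]. Qed.

Let intE (A : set R) (f : R -> R) : (\int[mu]_(v in A) (f v)%:E = \int[mu]_v (f v * \1_A v)%:E)%E.
Proof.
by rewrite integral_mkcond; apply: eq_integral => v _; rewrite epatch_indic EFinM.
Qed.

(** The total mass of [W] is 1 on the line and already on [-pi, pi], so [W] vanishes almost
    everywhere outside, and |v| <= pi where it does not. *)
Lemma integral_W_abs : (\int[mu]_v (W v * `|v|)%:E <= pi%:E)%E.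
Proof.
have mI : measurable I by exact: measurable_itv.
have mWI := @measurable_W.
have mWa : measurable_fun [set: R] (fun v => W v * `|v|) by exact: measurable_funM.
have out0 : (\int[mu]_(v in ~` I) (W v)%:E = 0)%E.
  have E : (\int[mu]_v (W v)%:E =
      \int[mu]_(v in I) (W v)%:E + \int[mu]_(v in ~` I) (W v)%:E)%E.
    rewrite -ge0_integral_setU ?setUv//.
    - exact: measurableC.
    - exact/measurable_EFinP.
    - by move=> x _; rewrite lee_fin.
    - by apply/disj_set2P; rewrite setICr.
  move: E; rewrite WR Wpi; case: (\int[mu]_(v in ~` I) (W v)%:E)%E => [r||] //=.
  by rewrite -EFinD => -[] h; congr EFin; move: h; lra.
have outa : (\int[mu]_(v in ~` I) (W v * `|v|)%:E = 0)%E.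
  have h1 : ae_eq mu (~` I) (fun v => (W v)%:E) (cst 0%E).
    apply/ae_eq_integral_abs => //; first exact: measurableC.
      by apply/measurable_EFinP; exact: measurable_funTS.
    by under eq_integral do rewrite gee0_abs ?lee_fin//.
  rewrite -(@integral0 _ _ R mu (~` I)); apply: ae_eq_integral => //.
  - exact: measurableC.
  - by apply/measurable_EFinP; exact: measurable_funTS.
  - apply: filterS h1 => v h Iv; have := h Iv; rewrite /cst => -[->].
    by rewrite mul0r.
rewrite -(setUv I) ge0_integral_setU//; last 4 first.
- exact: measurableC.
- by apply/measurable_EFinP; exact: measurable_funTS.
- by move=> v _; rewrite lee_fin mulr_ge0.
- by apply/disj_set2P; rewrite setICr.
rewrite outa adde0 -[leRHS]mule1 -Wpi -ge0_integralZl//; last 3 first.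
- by apply/measurable_EFinP; exact: measurable_funTS.
- by move=> v _; rewrite lee_fin.
- by rewrite lee_fin pi_ge0.
apply: ge0_le_integral => //.
- by move=> v _; rewrite lee_fin mulr_ge0.
- by apply/measurable_EFinP; exact: measurable_funTS.
- by apply: emeasurable_funM => //; apply/measurable_EFinP; exact: measurable_funTS.
- move=> v; rewrite /= in_itv /= => /andP[h1 h2].
  by rewrite -EFinM lee_fin mulrC ler_wpM2r// ler_norml h1 h2.
Qed.

(** By evenness. One half of the window is all that is sure to remain when it is centred at an end
    of [-pi, pi]. *)
Lemma half_le_integral_W : (2^-1%:E <= \int[mu]_(v in `[0%R, pi%R]) (W v)%:E)%E.
Proof.
have mWI := @measurable_W.
have refl : (\int[mu]_(v in `[(- pi)%R, 0%R]) (W v)%:E = \int[mu]_(v in `[0%R, pi%R]) (W v)%:E)%E.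
  rewrite (intE `[(- pi)%R, 0%R]%classic) (intE `[0%R, pi%R]%classic) -[RHS](@ge0_integral_affine_rev _ 1 0)//.
  - rewrite mul1e; apply: eq_integral => v _.
    rewrite mul1r sub0r Weven; congr (_ * _)%:E; rewrite !indicE; congr (_%:R).
    by congr nat_of_bool; apply/idP/idP; rewrite !inE /= !in_itv /= => /andP[h1 h2]; apply/andP; split; lra.
  - by apply/measurable_EFinP; apply: mind; exact: measurable_itv.
  - by move=> v; rewrite lee_fin mulr_ge0.
have : ((1 : R)%:E <= \int[mu]_(v in `[0%R, pi%R]) (W v)%:E + \int[mu]_(v in `[0%R, pi%R]) (W v)%:E)%E.
  rewrite -{1}refl -Wpi (intE `[(- pi)%R, 0%R]%classic) (intE `[0%R, pi%R]%classic) (intE I) -ge0_integralD//; last 4 first.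
  - by move=> v _; rewrite lee_fin mulr_ge0.
  - by apply/measurable_EFinP; apply: mind; exact: measurable_itv.
  - by move=> v _; rewrite lee_fin mulr_ge0.
  - by apply/measurable_EFinP; apply: mind; exact: measurable_itv.
  apply: ge0_le_integral => //.
  - by move=> v _; rewrite lee_fin mulr_ge0.
  - by apply/measurable_EFinP; apply: mind; exact: measurable_itv.
  - by apply: emeasurable_funD; apply/measurable_EFinP; apply: mind; exact: measurable_itv.
  - move=> v _; rewrite -EFinD lee_fin -mulrDr ler_wpM2l//.
    rewrite !indicE !mem_setE !in_itv /=.
    have [/andP[v1 v2]|_] := boolP (- pi <= v <= pi); last by rewrite addr_ge0.
    have [v0|v0] := boolP (0 <= v); first by rewrite v2 lerDr.
    have vl : v <= 0 by rewrite ltW// ltNge.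
    by rewrite v1 vl lerDl.
case: (\int[mu]_(v in `[0%R, pi%R]) (W v)%:E)%E => [r||] //=.
  by rewrite -EFinD !lee_fin => h; lra.
by move=> _; rewrite leey.
Qed.

Variables (a l : R).
Hypothesis a1 : 1 <= a.
Hypothesis lI : l \in `[- pi, pi].

Definition kernel (u : R) := a * W (a * (l - u)).

Let a0 : 0 < a. Proof. exact: lt_le_trans a1. Qed.

Lemma kernel_ge0 u : 0 <= kernel u.
Proof. by rewrite mulr_ge0// ltW. Qed.

Lemma kernel_le u : kernel u <= a * MW.
Proof. by rewrite ler_wpM2l// ltW. Qed.

Lemma measurable_kernel : measurable_fun [set: R] kernel.
Proof.
apply: measurable_funM; first exact: measurable_cst.
apply: (@measurableT_comp _ _ _ _ _ _ W); first exact: measurable_W.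
exact: measurable_affine_rev.
Qed.

Let mindI : measurable_fun [set: R] (fun v : R => \1_I (l - v / a) : R).
Proof.
have mI : measurable I by exact: measurable_itv.
have m1 : measurable_fun [set: R] (\1_I : R -> R) by exact: measurable_indic.
apply: (measurableT_comp m1).
apply: continuous_measurable_fun; rewrite (_ : (fun v => _) = (fun v => (- a^-1) * v + l)).
  exact: continuous_lin.
by apply/funext => v; rewrite mulNr mulrC addrC.
Qed.

Lemma integral_kernel (g : R -> R) : measurable_fun [set: R] g -> (forall v, 0 <= g v) ->
  (\int[mu]_(u in I) (kernel u * g (a * (l - u)))%:E =
   \int[mu]_v (W v * g v * \1_I (l - v / a))%:E)%E.
Proof.
move=> mg g0.
have mI : measurable I by exact: measurable_itv.
have mF : measurable_fun [set: R] (fun v => W v * g v * \1_I (l - v / a)).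
  apply: measurable_funM; first by apply: measurable_funM => //; exact: measurable_W.
  exact: mindI.
rewrite -[RHS](@ge0_integral_affine_rev _ a l a0)//; last 2 first.
- exact/measurable_EFinP.
- by move=> v; rewrite lee_fin !mulr_ge0.
rewrite -ge0_integralZl//; last 3 first.
- apply/measurable_EFinP.
  apply: (@measurableT_comp _ _ _ _ _ _ (fun v => W v * g v * \1_I (l - v / a))) => //.
  exact: measurable_affine_rev.
- by move=> v _; rewrite lee_fin !mulr_ge0.
- by rewrite lee_fin ltW.
rewrite (intE I); apply: eq_integral => u _; rewrite -EFinM /kernel; congr EFin.
rewrite (_ : l - a * (l - u) / a = u); first by rewrite !mulrA.
have an0 := lt0r_neq0 a0.
by field.
Qed.

Lemma integrable_kernel : mu.-integrable I (EFin \o kernel).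
Proof.
apply: measurable_bounded_integrable => //.
- by apply: compact_finite_measure; exact: segment_compact.
- by apply: measurable_funTS; exact: measurable_kernel.
- exists (a * MW); split; first by rewrite num_real.
  move=> x ax u _ /=; rewrite ger0_norm ?kernel_ge0//.
  by apply: le_trans (kernel_le u) _; exact: ltW.
Qed.

Let fine_le_EFin (x : \bar R) (y : R) : (0 <= x)%E -> (x <= y%:E)%E -> fine x <= y.
Proof. by case: x => [r||]//=; rewrite lee_fin. Qed.

Let EFin_le_fine (x : \bar R) (y z : R) : (x <= z%:E)%E -> (y%:E <= x)%E -> y <= fine x.
Proof. by case: x => [r||]//=; rewrite !lee_fin. Qed.

Let mW1 : measurable_fun [set: R] (fun v => W v * cst 1 v * \1_I (l - v / a)).
Proof.
apply: measurable_funM; first by apply: measurable_funM => //; exact: measurable_W.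
exact: mindI.
Qed.

Let integral_kernel_le1 : (\int[mu]_(u in I) (kernel u)%:E <= 1)%E.
Proof.
have E := @integral_kernel (cst 1) (measurable_cst _) (fun=> ler01).
rewrite (_ : (\int[mu]_(u in I) (kernel u)%:E = \int[mu]_(u in I) (kernel u * cst 1 (a * (l - u)))%:E)%E).
  rewrite E -WR; apply: ge0_le_integral => //.
  - by move=> v _; rewrite lee_fin !mulr_ge0.
  - exact/measurable_EFinP.
  - by apply/measurable_EFinP; exact: measurable_W.
  - move=> v _; rewrite lee_fin /= mulr1 indicE; case: (_ \in _); first by rewrite mulr1.
    by rewrite mulr0.
by apply: eq_integral => u _; rewrite /= mulr1.
Qed.

Lemma pint_kernel_le1 : pint kernel <= 1.
Proof.
apply: fine_le_EFin integral_kernel_le1.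
by apply: integral_ge0 => u _; rewrite lee_fin kernel_ge0.
Qed.

Lemma pint_kernel_ge : 2^-1 <= pint kernel.
Proof.
apply: (EFin_le_fine integral_kernel_le1).
have E := @integral_kernel (cst 1) (measurable_cst _) (fun=> ler01).
rewrite (_ : (\int[mu]_(u in I) (kernel u)%:E = \int[mu]_(u in I) (kernel u * cst 1 (a * (l - u)))%:E)%E); last first.
  by apply: eq_integral => u _; rewrite /= mulr1.
rewrite E.
have ml : (- pi <= l <= pi)%R by move: lI; rewrite in_itv.
have va (v : R) : 0 <= v -> 0 <= v / a <= v.
  move=> v0; rewrite divr_ge0 ?(ltW a0)//= ler_pdivrMr// ler_peMr//.
(* The point l - v / a moves towards 0 when v has the sign of l, and by at most pi since a >= 1, so
   it stays in [-pi, pi]: the half of the window on that side is entirely inside. *)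
have [l0|l0] := lerP 0 l.
  apply: le_trans half_le_integral_W _; rewrite (intE `[0%R, pi%R]%classic); apply: ge0_le_integral => //.
  - by move=> v _; rewrite lee_fin mulr_ge0.
  - by apply/measurable_EFinP; apply: mind; exact: measurable_itv.
  - exact/measurable_EFinP.
  - move=> v _; rewrite lee_fin /= mulr1 ler_wpM2l// !indicE !mem_setE !in_itv /=.
    have [/andP[v0 vp]|_] := boolP (0 <= v <= pi); last by [].
    have /andP[h1 h2] := va v v0.
    rewrite (_ : - pi <= l - v / a <= pi)//; apply/andP; split; move: ml => /andP[]; lra.
have refl : (2^-1%:E <= \int[mu]_v (W v * \1_(`[(- pi)%R, 0%R]) v)%:E)%E.
  apply: le_trans half_le_integral_W _; rewrite (intE `[0%R, pi%R]%classic) -[leRHS](@ge0_integral_affine_rev _ 1 0)//.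
  - rewrite mul1e le_eqVlt; apply/orP; left; apply/eqP; apply: eq_integral => v _.
    rewrite mul1r sub0r Weven; congr (_ * _)%:E; rewrite !indicE; congr (_%:R).
    by congr nat_of_bool; apply/idP/idP; rewrite !inE /= !in_itv /= => /andP[h1 h2]; apply/andP; split; lra.
  - by apply/measurable_EFinP; apply: mind; exact: measurable_itv.
  - by move=> v; rewrite lee_fin mulr_ge0.
apply: le_trans refl _; apply: ge0_le_integral => //.
- by move=> v _; rewrite lee_fin mulr_ge0.
- by apply/measurable_EFinP; apply: mind; exact: measurable_itv.
- exact/measurable_EFinP.
- move=> v _; rewrite lee_fin /= mulr1 ler_wpM2l// !indicE !mem_setE !in_itv /=.
  have [/andP[v0 vp]|_] := boolP (- pi <= v <= 0); last by [].
  have nv0 : 0 <= - v by rewrite oppr_ge0.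
  have /andP[h1 h2] := va _ nv0; rewrite mulNr in h1 h2.
  rewrite (_ : - pi <= l - v / a <= pi)//; apply/andP; split; move: ml => /andP[]; lra.
Qed.

Lemma pint_kernel_dist : pint (fun u => kernel u * `|u - l|) <= pi / a.
Proof.
have mn : measurable_fun [set: R] (fun v : R => `|v| / a).
  exact: measurable_funM.
apply: fine_le_EFin.
  by apply: integral_ge0 => u _; rewrite lee_fin mulr_ge0// kernel_ge0.
rewrite (_ : (\int[mu]_(u in I) (kernel u * `|u - l|)%:E =
    \int[mu]_(u in I) (kernel u * ((fun v => `|v| / a) (a * (l - u))))%:E)%E); last first.
  apply: eq_integral => u _; congr (_ * _)%:E => /=.
  by rewrite distrC normrM (gtr0_norm a0) mulrAC divff ?mul1r// gt_eqF.
have g0 (v : R) : 0 <= `|v| / a by rewrite divr_ge0// ltW.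
have E := integral_kernel mn g0.
apply: (@le_trans _ _ (\int[mu]_v (W v * (`|v| / a) * \1_I (l - v / a))%:E)%E); first by rewrite -E.
apply: (@le_trans _ _ (\int[mu]_v ((a^-1)%:E * (W v * `|v|)%:E))%E).
  apply: ge0_le_integral => //.
  - by move=> v _; rewrite lee_fin !mulr_ge0// invr_ge0 ltW.
  - apply/measurable_EFinP; apply: measurable_funM.
      by apply: measurable_funM => //; exact: measurable_W.
    exact: mindI.
  - apply: emeasurable_funM => //; apply/measurable_EFinP; apply: measurable_funM => //.
    exact: measurable_W.
  - move=> v _; rewrite -EFinM lee_fin indicE.
    case: (_ \in _); rewrite ?mulr1 ?mulr0; first by rewrite mulrA mulrC.
    by rewrite !mulr_ge0// invr_ge0 ltW.
rewrite ge0_integralZl//; last 3 first.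
- apply/measurable_EFinP; apply: measurable_funM => //; exact: measurable_W.
- by move=> v _; rewrite lee_fin mulr_ge0.
- by rewrite lee_fin invr_ge0 ltW.
rewrite EFinM muleC lee_wpmul2r// ?lee_fin ?invr_ge0 ?(ltW a0)//.
exact: integral_W_abs.
Qed.

End Window.

(** * Kullback-Leibler divergence on a grid *)

Section Grid.
Context {R : realType}.
Variable s : seq R.
Hypothesis s0 : (0 < size s)%N.
Local Notation G := (grid_int s).

Let w0 : 0 < 2 * pi / (size s)%:R :> R.
Proof. by rewrite divr_gt0 ?mulr_gt0 ?pi_gt0// ltr0n. Qed.

Lemma grid_intD g h : G (fun u => g u + h u) = G g + G h.
Proof. by rewrite /grid_int big_split mulrDr. Qed.

Lemma grid_intZ c g : G (fun u => c * g u) = c * G g.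
Proof. by rewrite /grid_int -mulr_sumr mulrCA. Qed.

Lemma grid_intB g h : G (fun u => g u - h u) = G g - G h.
Proof. by rewrite /grid_int sumrB mulrBr. Qed.

Lemma grid_int_sum (J : Type) (r : seq J) (Pr : pred J) (F : J -> R -> R) :
  G (fun u => \sum_(j <- r | Pr j) F j u) = \sum_(j <- r | Pr j) G (F j).
Proof. by rewrite /grid_int exchange_big mulr_sumr. Qed.

Lemma grid_int_cst c : G (fun=> c) = 2 * pi * c.
Proof.
rewrite /grid_int big_const_seq count_predT iter_addr_0 -mulr_natr.
have : (size s)%:R != 0 :> R by rewrite pnatr_eq0 -lt0n.
by move=> h; field.
Qed.

Lemma grid_int_le g h : (forall u, u \in s -> g u <= h u) -> G g <= G h.
Proof.
move=> gh; rewrite /grid_int ler_wpM2l ?(ltW w0)//.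
by rewrite big_seq [leRHS]big_seq; apply: ler_sum.
Qed.

Lemma eq_grid_int g h : (forall u, u \in s -> g u = h u) -> G g = G h.
Proof.
by move=> gh; rewrite /grid_int; congr (_ * _); apply: eq_big_seq.
Qed.

Lemma grid_int_ge0 g : (forall u, u \in s -> 0 <= g u) -> 0 <= G g.
Proof.
by move=> g0; apply: le_trans (grid_int_le g0); rewrite grid_int_cst mulr0.
Qed.

Lemma grid_int_norm g e : (forall u, u \in s -> `|g u| <= e) -> `|G g| <= 2 * pi * e.
Proof.
move=> ge; rewrite ler_norml -mulrN -!grid_int_cst.
by apply/andP; split; apply: grid_int_le => u /ge; rewrite ler_norml => /andP[].
Qed.

Lemma grid_int_gt0 g : (forall u, u \in s -> 0 < g u) -> 0 < G g.
Proof.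
move=> g0; rewrite /grid_int mulr_gt0//.
case: s s0 g0 => // x r _ g0; rewrite big_cons ltr_pwDl ?g0 ?mem_head//.
by rewrite big_seq sumr_ge0// => u ur; rewrite ltW// g0// inE ur orbT.
Qed.

Lemma ln_le_sub1 (x : R) : 0 < x -> ln x <= x - 1.
Proof. by move=> x0; have := @le_ln1Dx _ (x - 1); rewrite addrCA subrr addr0; apply; lra. Qed.

(** The linear terms make the integrand of the divergence nonnegative pointwise; they sum to 0 over
    the grid once the two functions are scaled to the same mass, which is how [klE] inserts them. *)
Lemma klpt_ge0 (x y : R) : 0 < x -> 0 < y -> 0 <= x * ln (x / y) - x + y.
Proof.
move=> x0 y0; have := ln_le_sub1 (divr_gt0 y0 x0).
rewrite -[x / y]invf_div lnV ?posrE ?divr_gt0// => h.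
have := ler_wpM2l (ltW x0) h; rewrite mulrBr mulr1 mulrCA divff ?gt_eqF// mulr1.
by rewrite mulrN; lra.
Qed.

Lemma klpt_le (x y : R) : 0 < x -> 0 < y ->
  x * ln (x / y) - x + y <= (x - y) ^+ 2 / y.
Proof.
move=> x0 y0; have yn0 := lt0r_neq0 y0.
have := ler_wpM2l (ltW x0) (ln_le_sub1 (divr_gt0 x0 y0)).
rewrite (_ : (x - y) ^+ 2 / y = x * (x / y - 1) - x + y); last by field.
by lra.
Qed.

(** Goes through the Hellinger distance: the right-hand side is at least the square of the
    difference of the square roots, whose sum is at most 2 sqrt B. *)
Lemma klpt_ge (x y B : R) : 0 < x <= B -> 0 < y <= B ->
  (x - y) ^+ 2 / (4 * B) <= x * ln (x / y) - x + y.
Proof.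
move=> /andP[x0 xB] /andP[y0 yB].
pose a := Num.sqrt x; pose b := Num.sqrt y.
have a0 : 0 < a by rewrite sqrtr_gt0.
have b0 : 0 < b by rewrite sqrtr_gt0.
have xa : x = a ^+ 2 by rewrite sqr_sqrtr// ltW.
have yb : y = b ^+ 2 by rewrite sqr_sqrtr// ltW.
have B0 : 0 < B by exact: lt_le_trans xB.
have h1 : (a - b) ^+ 2 <= x * ln (x / y) - x + y.
  have := ln_le_sub1 (divr_gt0 b0 a0).
  have -> : x / y = (b / a) ^- 2 by rewrite xa yb expr_div_n invf_div.
  rewrite lnV ?posrE ?exprn_gt0 ?divr_gt0// lnXn ?divr_gt0// -mulr_natl.
  move=> h; have := ler_wpM2l (ltW x0) h.
  have -> : x * (b / a - 1) = a * b - a ^+ 2.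
    by rewrite xa; field; exact: lt0r_neq0.
  by rewrite yb {2 3}xa; nra.
apply: le_trans h1; rewrite ler_pdivrMr ?mulr_gt0//.
rewrite xa yb subr_sqr exprMn ler_wpM2l ?sqr_ge0//.
by move: (sqr_ge0 (a - b)); rewrite xa in xB; rewrite yb in yB; nra.
Qed.

(** The divergence of the normalized functions weighted by the mass of [g], which is how it enters
    the objective function, where the estimate outside the logarithm is not normalized. *)
Definition kl (g h : R -> R) := G (fun u => g u * ln (st s g u / st s h u)).

Let pos (g : R -> R) := forall u, u \in s -> 0 < g u.

Lemma klE g h : pos g -> pos h ->
  kl g h = G (fun u => g u * ln (g u / (G g / G h * h u)) - g u + G g / G h * h u).
Proof.
move=> g0 h0; have Gg := grid_int_gt0 g0; have Gh := grid_int_gt0 h0.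
rewrite grid_intD grid_intB grid_intZ divfK ?gt_eqF// subrK.
apply: eq_grid_int => u us; congr (_ * ln _).
have h1 := lt0r_neq0 Gg; have h2 := lt0r_neq0 Gh; have h3 := lt0r_neq0 (h0 u us).
by rewrite /st; field; rewrite h1 h2 h3.
Qed.

Lemma kl_ge0 g h : pos g -> pos h -> 0 <= kl g h.
Proof.
move=> g0 h0; rewrite klE//; apply: grid_int_ge0 => u us.
by apply: klpt_ge0; rewrite ?g0// mulr_gt0 ?h0// divr_gt0// grid_int_gt0.
Qed.

Lemma kl_ge g h B : pos g -> pos h ->
  (forall u, u \in s -> g u <= B) -> (forall u, u \in s -> G g / G h * h u <= B) ->
  G (fun u => (g u - G g / G h * h u) ^+ 2) / (4 * B) <= kl g h.
Proof.
move=> g0 h0 gB hB; rewrite klE// mulrC -grid_intZ; apply: grid_int_le => u us.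
rewrite mulrC klpt_ge// ?g0 ?gB//= hB// andbT.
by rewrite mulr_gt0 ?h0// divr_gt0// grid_int_gt0.
Qed.

(** Scaling [h] to the mass of [g] minimizes the sum of the pointwise terms: any other factor c adds
    the mass of [h] times the nonnegative quantity of [klpt_ge0] at the two factors. Hence c is
    free. *)
Lemma kl_le g h c : pos g -> pos h -> 0 < c ->
  kl g h <= G (fun u => (g u - c * h u) ^+ 2 / (c * h u)).
Proof.
move=> g0 h0 c0; have Gg := grid_int_gt0 g0; have Gh := grid_int_gt0 h0.
set c' := G g / G h.
have c'0 : 0 < c' by rewrite divr_gt0.
apply: (@le_trans _ _ (G (fun u => g u * ln (g u / (c * h u)) - g u + c * h u))); last first.
  by apply: grid_int_le => u us; rewrite klpt_le ?g0// mulr_gt0 ?h0.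
rewrite klE// -/c' -subr_ge0 -grid_intB.
have := mulr_ge0 (ltW Gh) (klpt_ge0 c'0 c0).
have GgE : G g = c' * G h by rewrite divfK// gt_eqF.
rewrite (_ : G h * _ = ln (c' / c) * G g - c' * G h + c * G h); last by rewrite GgE; ring.
rewrite -!grid_intZ -grid_intB -grid_intD.
move=> /le_trans; apply; apply: grid_int_le => u us.
have gu := g0 u us; have hu := h0 u us.
have L (x : R) : 0 < x -> ln (g u / (x * h u)) = ln (g u) - ln x - ln (h u).
  move=> x0; have xh : 0 < x * h u by rewrite mulr_gt0.
  rewrite lnM ?posrE ?invr_gt0// lnV ?posrE// lnM ?posrE//.
  by rewrite opprD addrA.
rewrite (L _ c0) (L _ c'0) lnM ?posrE ?invr_gt0// lnV ?posrE//.
by rewrite le_eqVlt; apply/orP; left; apply/eqP; ring.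
Qed.

Lemma KLdivE g h : pos g -> KLdiv s g h = kl g h / G g.
Proof.
move=> g0; rewrite /KLdiv /kl mulrC -grid_intZ; apply: eq_grid_int => u us.
by rewrite {1}/st mulrAC mulrC.
Qed.

Lemma grid_int_itv (g : R -> R) c1 c2 : (forall u, u \in s -> c1 <= g u <= c2) ->
  2 * pi * c1 <= G g <= 2 * pi * c2.
Proof.
move=> gc; rewrite -!grid_int_cst; apply/andP.
by split; apply: grid_int_le => u /gc /andP[].
Qed.

Lemma grid_int_ratio (g h : R -> R) c1 c2 : 0 < c1 -> 0 < c2 ->
  (forall u, u \in s -> c1 <= g u <= c2) -> (forall u, u \in s -> c1 <= h u <= c2) ->
  c1 / c2 <= G g / G h <= c2 / c1.
Proof.
move=> c10 c20 /grid_int_itv /andP[g1 g2] /grid_int_itv /andP[h1 h2].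
have pi0 : (0 : R) < 2 * pi by rewrite mulr_gt0// pi_gt0.
have Gh : 0 < G h by apply: lt_le_trans h1; rewrite mulr_gt0.
rewrite ler_pdivlMr// ler_pdivrMr// mulrAC ler_pdivrMr// [c2 / c1 * _]mulrAC ler_pdivlMr//.
apply/andP; split.
  apply: (@le_trans _ _ (c1 * (2 * pi * c2))); first by rewrite ler_wpM2l// ltW.
  by rewrite mulrA ler_wpM2r ?(ltW c20)// mulrC.
apply: (@le_trans _ _ (2 * pi * c2 * c1)); first by rewrite ler_wpM2r// ltW.
by rewrite [2 * pi * c2]mulrC -mulrA ler_wpM2l// ltW.
Qed.

(* The divergences of k g1 and k g2 from M bound the L2 distance of g1 to g2 up to
   a factor, hence that of g1 and g2; c0 and c1 control the ratios throughout. *)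
Definition gap_const (c0 c1 : R) : R :=
  let r := 2 * c1 / c0 in
  (8 * (4 * (r * c1)) * (1 + (r ^+ 2) ^+ 2)) * r ^+ 2 / (c0 * (2 * pi * c0)).

Lemma kl_gap (g1 g2 k M : R -> R) c0 c1 : 0 < c0 -> c0 <= c1 ->
  (forall u, u \in s -> c0 <= g1 u <= c1) -> (forall u, u \in s -> c0 <= g2 u <= c1) ->
  (forall u, u \in s -> 2^-1 <= k u <= 1) -> (forall u, u \in s -> c0 / 2 <= M u <= c1) ->
  KLdiv s g1 g2 <= gap_const c0 c1 *
    (kl (fun u => k u * g1 u) M + kl (fun u => k u * g2 u) M).
Proof.
move=> c00 c01 h1 h2 hk hM.
have c10 : 0 < c1 by exact: lt_le_trans c01.
have c02 : 0 < c0 / 2 by rewrite divr_gt0.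
have kg g : (forall u, u \in s -> c0 <= g u <= c1) ->
    forall u, u \in s -> c0 / 2 <= k u * g u <= c1.
  move=> hg u us; have /andP[a b] := hg u us; have /andP[p q] := hk u us.
  apply/andP; split; first by rewrite mulrC ler_pM// ?invr_ge0// ltW.
  by rewrite -[leRHS]mul1r ler_pM//; lra.
have posg g c d : 0 < c -> (forall u, u \in s -> c <= g u <= d) -> pos g.
  by move=> c_0 hg u us; have /andP[a _] := hg u us; exact: lt_le_trans a.
pose r := 2 * c1 / c0.
have rE : c1 / (c0 / 2) = r by rewrite invf_div mulrA [c1 * 2]mulrC.
have r1 : 1 <= r by rewrite /r ler_pdivlMr// mul1r; lra.
have r0 : 0 < r by exact: lt_le_trans r1.
have P0 : 0 < 4 * (r * c1) by apply: mulr_gt0 => //; exact: mulr_gt0.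
pose a g := G (fun u => k u * g u) / G M.
have ha g : (forall u, u \in s -> c0 <= g u <= c1) -> r^-1 <= a g <= r.
  by move=> hg; have := grid_int_ratio c02 c10 (kg g hg) hM; rewrite -[X in X <= _]invf_div rE.
have a0 g : (forall u, u \in s -> c0 <= g u <= c1) -> 0 < a g.
  by move=> /ha /andP[+ _]; apply: lt_le_trans; rewrite invr_gt0.
have kle g : (forall u, u \in s -> c0 <= g u <= c1) ->
    G (fun u => (k u * g u - a g * M u) ^+ 2) <= 4 * (r * c1) * kl (fun u => k u * g u) M.
  move=> hg; rewrite mulrC -ler_pdivrMr//.
  apply: kl_ge.
  - exact: posg c02 (kg _ hg).
  - exact: posg c02 hM.
  - move=> u us; have /andP[_ b] := kg _ hg u us; apply: le_trans b _.
    by rewrite ler_peMl// ltW.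
  - move=> u us; have /andP[m1 m2] := hM u us; have /andP[_ b] := ha _ hg.
    by rewrite ler_pM//; [exact: ltW (a0 _ hg)|lra].
pose c := a g1 / a g2.
have c_0 : 0 < c by rewrite divr_gt0// a0.
have cr : r ^- 2 <= c <= r ^+ 2.
  have /andP[x1 x2] := ha _ h1; have /andP[y1 y2] := ha _ h2.
  have ag := a0 _ h2; rewrite /c ler_pdivlMr// ler_pdivrMr//.
  have y2' : r^-1 * a g2 <= 1 by rewrite mulrC ler_pdivrMr// mul1r.
  have y1' : 1 <= r * a g2.
    have := ler_wpM2l (ltW r0) y1; rewrite divff//; exact: lt0r_neq0.
  apply/andP; split.
    apply: le_trans x1; rewrite expr2 invfM -[X in X <= _]mulrA -[leRHS]mulr1.
    by apply: ler_wpM2l => //; rewrite invr_ge0 ltW.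
  apply: le_trans x2 _; rewrite expr2 -[X in _ <= X]mulrA -[leLHS]mulr1.
  by apply: ler_wpM2l => //; exact: ltW.
rewrite KLdivE//; last exact: posg c00 h1.
have /andP[Gg1 _] := grid_int_itv h1.
have pc0 : 0 < 2 * pi * c0 by rewrite !mulr_gt0// pi_gt0.
have D10 := kl_ge0 (posg _ _ _ c02 (kg _ h1)) (posg _ _ _ c02 hM).
have D20 := kl_ge0 (posg _ _ _ c02 (kg _ h2)) (posg _ _ _ c02 hM).
set D1 := kl _ M in D10 *; set D2 := kl _ M in D20 *.
set Q := 8 * (4 * (r * c1)) * (1 + (r ^+ 2) ^+ 2) * (D1 + D2).
have HQ : G (fun u => (g1 u - c * g2 u) ^+ 2) <= Q.
  apply: (@le_trans _ _ (G (fun u => 8 * (k u * g1 u - a g1 * M u) ^+ 2 +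
      8 * (r ^+ 2) ^+ 2 * (k u * g2 u - a g2 * M u) ^+ 2))).
    apply: grid_int_le => u us; have /andP[k1 k2] := hk u us.
    set A := k u * g1 u - _; set B := k u * g2 u - _.
    (* The choice of c as the ratio of the two scalings of M eliminates M. The constant 8 below is
       4, because k is at least 1/2, times the 2 from the square of a difference. *)
    have E : k u * (g1 u - c * g2 u) = A - c * B.
      rewrite /A /B /c; have := lt0r_neq0 (a0 _ h2) => an.
      by field.
    have h : (g1 u - c * g2 u) ^+ 2 <= 4 * (A - c * B) ^+ 2.
      rewrite -E exprMn mulrA ler_peMl ?sqr_ge0//; nra.
    apply: le_trans h _.
    have c4 : c ^+ 2 <= (r ^+ 2) ^+ 2.
      by have /andP[_ b] := cr; rewrite lerXn2r ?nnegrE ?sqr_ge0// ltW.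
    have := ler_wpM2r (sqr_ge0 B) c4; have := sqr_ge0 (A + c * B).
    by move: ((r ^+ 2) ^+ 2) => rr; nra.
  rewrite grid_intD !grid_intZ /Q.
  have := kle _ h1; have := kle _ h2; rewrite -/D1 -/D2.
  set X1 := G _; set X2 := G _ => hX1 hX2.
  have rr0 : 0 <= (r ^+ 2) ^+ 2 by rewrite sqr_ge0.
  have e1 : 8 * X2 <= 8 * (4 * (r * c1) * D1) by rewrite ler_wpM2l.
  have e2 : 8 * (r ^+ 2) ^+ 2 * X1 <= 8 * (r ^+ 2) ^+ 2 * (4 * (r * c1) * D2).
    by rewrite ler_wpM2l// mulr_ge0.
  apply: le_trans (lerD e1 e2) _; rewrite -subr_ge0.
  move: (4 * (r * c1)) (ltW P0) ((r ^+ 2) ^+ 2) rr0 => p p0 q q0.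
  rewrite (_ : _ - _ = 8 * (p * D2) + 8 * (q * (p * D1))); last by ring.
  by apply: addr_ge0; do !apply: mulr_ge0 => //.
have Q0 : 0 <= Q.
  apply: le_trans HQ; apply: grid_int_ge0 => u _; exact: sqr_ge0.
have H2 : kl g1 g2 <= Q * (r ^+ 2 / c0).
  apply: le_trans (kl_le (posg _ _ _ c00 h1) (posg _ _ _ c00 h2) c_0) _.
  apply: (@le_trans _ _ (G (fun u => r ^+ 2 / c0 * (g1 u - c * g2 u) ^+ 2))); last first.
    by rewrite grid_intZ mulrC ler_wpM2r// divr_ge0 ?sqr_ge0// ltW.
  apply: grid_int_le => u us; rewrite mulrC ler_wpM2r ?sqr_ge0//.
  have /andP[a2 _] := h2 u us; have /andP[b2 _] := cr.
  have r2 : 0 < r ^- 2 by rewrite invr_gt0 exprn_gt0.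
  have cg : r ^- 2 * c0 <= c * g2 u by apply: ler_pM => //; exact: ltW.
  have p1 : 0 < r ^- 2 * c0 by apply: mulr_gt0.
  have p2 : 0 < c * g2 u by apply: lt_le_trans cg.
  rewrite (_ : r ^+ 2 / c0 = (r ^- 2 * c0)^-1); last by rewrite invfM invrK.
  by rewrite lef_pV2.
have k12 : 0 <= kl g1 g2 by apply: kl_ge0; [exact: posg c00 h1|exact: posg c00 h2].
have Gg1' : 0 < G g1 by exact: lt_le_trans Gg1.
apply: (@le_trans _ _ (Q * (r ^+ 2 / c0) / (2 * pi * c0))).
  apply: ler_pM => //; first by rewrite invr_ge0 ltW.
  by rewrite lef_pV2.
rewrite /Q /gap_const -/r le_eqVlt; apply/orP; left; apply/eqP.
have := lt0r_neq0 c00; have := lt0r_neq0 (@pi_gt0 R).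
clear -r D1 D2; move: (pi : R) (D1 + D2) => p DD; clearbody r => n1 n2.
by field; rewrite n1 n2.
Qed.

End Grid.

(** * The objective function on a partition *)

Section Counting.
Variables (K N : nat) (t0 : nat -> nat).
Hypothesis t00 : t0 0 = 0%N.
Hypothesis t0N : t0 K.+1 = N.
Hypothesis t0S : forall k, (k <= K)%N -> (t0 k <= t0 k.+1)%N.

(* The index t stands for the time t + 1, so that ]a, b] is a <= t < b. *)
Definition seg_count (l a b : nat) : nat := (\sum_(a <= t < b) (t0 l <= t < t0 l.+1)%N)%N.

Lemma t0_mono i j : (i <= j <= K.+1)%N -> (t0 i <= t0 j)%N.
Proof.
elim: j => [|j IH]; first by rewrite leqn0 => /andP[/eqP ->].
rewrite leq_eqVlt => /andP[/predU1P[-> //|ij] jK].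
by rewrite (leq_trans (IH _)) ?t0S// -ltnS ij ltnW.
Qed.

Lemma seg_unique t : (t < N)%N -> (\sum_(l < K.+1) (t0 l <= t < t0 l.+1)%N = 1)%N.
Proof.
rewrite -t0N; elim: K t0S => [|k IH] H.
  by rewrite big_ord_recl big_ord0 t00 /= => ->.
rewrite big_ord_recr /= => tk.
have [tk1|tk1] := ltnP t (t0 k.+1).
  by rewrite IH// => i ik; apply: H; exact: leqW.
rewrite tk /= big1// => i _; apply/eqP; rewrite eqb0 negb_and -leqNgt; apply/orP; right.
apply: leq_trans tk1; elim: {tk} k {IH} H i => [|k IH] H i.
  by case: i => [[]].
case: (ltngtP i k.+1) => ik.
- apply: leq_trans (H k.+1 _); last by rewrite leqW.
  by apply: (IH _ (Ordinal ik)) => j jk; apply: H; rewrite leqW.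
- by have := ltn_ord i; rewrite ltnS leqNgt ik.
- by rewrite ik.
Qed.

Lemma seg_count_total a b : (b <= N)%N -> (\sum_(l < K.+1) seg_count l a b = b - a)%N.
Proof.
move=> bN; rewrite /seg_count exchange_big /= big_nat.
under eq_bigr => t /andP[_ tb] do rewrite seg_unique ?(leq_trans tb)//.
by rewrite -big_nat sum_nat_const_nat muln1.
Qed.

Lemma seg_count_telescope (tau : nat -> nat) L l : tau 0 = 0%N ->
  (forall k, (k <= L)%N -> (tau k <= tau k.+1)%N) ->
  (\sum_(i < L.+1) seg_count l (tau i) (tau i.+1) = seg_count l 0 (tau L.+1))%N.
Proof.
move=> tau0; elim: L => [|L IH] H; first by rewrite big_ord_recl big_ord0 addn0 tau0.
rewrite big_ord_recr /= IH => [|k kL]; last by apply: H; rewrite leqW.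
by rewrite /seg_count -big_cat_nat //=; exact: H.
Qed.

Lemma seg_count_sub l a b : (a <= t0 l)%N -> (t0 l.+1 <= b)%N -> (t0 l <= t0 l.+1)%N ->
  seg_count l a b = (t0 l.+1 - t0 l)%N.
Proof.
move=> al lb ll; rewrite /seg_count (big_cat_nat (n := t0 l)) //=; last exact: leq_trans lb.
rewrite big_nat big1 => [|t /andP[_ tl]]; last by rewrite leqNgt tl.
rewrite add0n (big_cat_nat (n := t0 l.+1)) //= [X in (_ + X)%N]big_nat.
rewrite [X in (_ + X)%N]big1 => [|t /andP[tl _]]; last by rewrite [(t < _)%N]ltnNge tl andbF.
rewrite addn0 big_nat; under eq_bigr => t tt do rewrite tt.
by rewrite -big_nat sum_nat_const_nat muln1.
Qed.

Lemma seg_count_other l k : (l <= K)%N -> (k <= K)%N -> l != k -> seg_count l (t0 k) (t0 k.+1) = 0%N.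
Proof.
move=> lK kK lk; rewrite /seg_count big_nat big1// => t /andP[h1 h2].
apply/eqP; rewrite eqb0 negb_and -leqNgt -ltnNge.
move: lk; rewrite neq_ltn => /orP[lk|kl].
  by apply/orP; right; apply: leq_trans h1; apply: t0_mono; rewrite lk leqW.
by apply/orP; left; apply: leq_trans h2 _; apply: t0_mono; rewrite kl leqW.
Qed.

End Counting.

(** * Contribution of one segment, and of a whole partition, to the objective function *)

Section SegmentBounds.
Context {R : realType}.
Variables (s : seq R) (K N : nat) (t0 : nat -> nat) (f : 'I_K.+1 -> R -> R).
Variables (kap b : R -> R) (est : nat -> nat -> R -> R) (c0 c1 eta E dl ml : R).
Hypothesis s0 : (0 < size s)%N.
Hypothesis t00 : t0 0 = 0%N.
Hypothesis t0N : t0 K.+1 = N.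
Hypothesis t0S : forall k, (k <= K)%N -> (t0 k <= t0 k.+1)%N.
Hypothesis c00 : 0 < c0.
Hypothesis c01 : c0 <= c1.
Hypothesis fc : forall k u, u \in s -> c0 <= f k u <= c1.
Hypothesis kapc : forall u, u \in s -> 2^-1 <= kap u <= 1.
Local Notation cnt l x y := ((seg_count t0 l x y)%:R : R).
Hypothesis hest : forall x y u (k : 'I_K.+1), (x < y <= N)%N -> u \in s ->
  `|(y - x)%:R * est x y u - kap u * \sum_(l < K.+1) cnt l x y * f l u| <=
  E + dl * \sum_(l < K.+1 | l != k) cnt l x y.
Hypothesis E0 : 0 <= E.
Hypothesis Edl : E <= dl * ml.
Hypothesis dl0 : 0 <= dl.
Hypothesis dlc : dl <= c0 / 8.
Hypothesis ml0 : 0 < ml.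
(** A function with values in [c0 / 4, 2 c1] has mass at most 4 pi c1, so its normalization is at
    least c0 / (16 pi c1); the inverse of this number is also an upper bound for it. *)
Definition ln_bound := ln (16 * pi * c1 / c0).
Local Notation LL := ln_bound.
Hypothesis hb : forall u, u \in s -> 0 < b u.
Hypothesis hlnb : forall u, u \in s -> `|ln (b u)| <= LL.
Hypothesis hgap : forall k l, k != l ->
  2 * eta * gap_const c0 c1 <= KLdiv s (f k) (f l).
Hypothesis eta0 : 0 < eta.
Hypothesis hdl : 4 * pi * LL * dl <= eta / 2.
Local Notation G := (grid_int s).

Let c10 : 0 < c1. Proof. exact: lt_le_trans c01. Qed.

Lemma ln_bound_ge0 : 0 <= LL.
Proof.
rewrite ln_ge0// ler_pdivlMr// mul1r; apply: le_trans c01 _.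
rewrite ler_peMl ?(ltW c10)//; have := @pi_ge2 R; lra.
Qed.

Lemma ln_st_bound (g : R -> R) : (forall u, u \in s -> c0 / 4 <= g u <= 2 * c1) ->
  forall u, u \in s -> 0 < st s g u /\ `|ln (st s g u)| <= LL.
Proof.
move=> hg u us; have /andP[g1 g2] := hg u us.
have c04 : 0 < c0 / 4 by rewrite divr_gt0.
have pi0 := @pi_gt0 R.
have /andP[G1 G2] := grid_int_itv s0 hg.
have Gp : 0 < G g by apply: lt_le_trans G1; rewrite !mulr_gt0.
have gp : 0 < g u by exact: lt_le_trans g1.
have sp : 0 < st s g u by rewrite divr_gt0.
have q0 : 0 < 16 * pi * c1 / c0 by rewrite divr_gt0// !mulr_gt0.
set q := 16 * pi * c1 / c0 in q0 *.
have qc : q * (c0 / 4) = 4 * pi * c1.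
  by rewrite /q; have := lt0r_neq0 c00 => n0; field.
split => //; rewrite ler_norml /LL -/q; apply/andP; split.
  rewrite lerNl -lnV ?posrE// ler_ln ?posrE ?invr_gt0// /st invf_div ler_pdivrMr//.
  apply: le_trans G2 _; apply: (@le_trans _ _ (q * (c0 / 4))).
    by rewrite qc le_eqVlt; apply/orP; left; apply/eqP; ring.
  by rewrite ler_wpM2l// ltW.
rewrite ler_ln ?posrE// /st ler_pdivrMr//.
apply: le_trans g2 _; apply: (@le_trans _ _ (q * (2 * pi * (c0 / 4)))); last first.
  by rewrite ler_wpM2l// ltW.
rewrite mulrCA qc (_ : 2 * pi * (4 * pi * c1) = 8 * (pi * pi) * c1); last by ring.
rewrite ler_wpM2r ?(ltW c10)//; have : 1 * 1 <= pi * pi :> R.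
  by have := @pi_ge2 R => p2; rewrite ler_pM//; lra.
by move: (pi * pi : R) => x; lra.
Qed.

(** Formed with [kap u * f k u], the target of the estimator on a pure segment. The baseline, which
    may be random, is kept inside: every partition has the same total of these terms, so it cancels
    in comparisons. *)
Let theta k := G (fun u => kap u * f k u * ln (st s (fun u => kap u * f k u) u)) -
               G (fun u => kap u * f k u * ln (b u)).

Let mix x y u := kap u * \sum_(l < K.+1) (cnt l x y / (y - x)%:R) * f l u.

Let hkf k u : u \in s -> c0 / 2 <= kap u * f k u <= c1.
Proof.
move=> us; have /andP[p q] := kapc us; have /andP[r t] := fc k us.
apply/andP; split; first by rewrite mulrC ler_pM// ?invr_ge0// ltW.
rewrite -[leRHS]mul1r ler_pM//; first by apply: le_trans p; rewrite invr_ge0.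
by apply: le_trans r; exact: ltW.
Qed.

Let wsum x y : (x < y <= N)%N -> \sum_(l < K.+1) cnt l x y = (y - x)%:R :> R.
Proof.
by move=> /andP[_ yN]; rewrite -natr_sum (seg_count_total t00 t0N t0S).
Qed.

Let mixE x y u : (x < y <= N)%N ->
  (y - x)%:R * mix x y u = kap u * \sum_(l < K.+1) cnt l x y * f l u.
Proof.
move=> xyN; have n0 : (y - x)%:R != 0 :> R.
  by rewrite pnatr_eq0 -lt0n subn_gt0; case/andP: xyN.
rewrite /mix mulrCA; congr (_ * _); rewrite mulr_sumr; apply: eq_bigr => l _.
by rewrite mulrA mulrCA divff// mulr1.
Qed.

Let mixE2 x y u : mix x y u = \sum_(l < K.+1) (cnt l x y / (y - x)%:R) * (kap u * f l u).
Proof. by rewrite /mix mulr_sumr; apply: eq_bigr => l _; rewrite mulrCA. Qed.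

Let mixc x y u : (x < y <= N)%N -> u \in s -> c0 / 2 <= mix x y u <= c1.
Proof.
move=> xyN us; have n0 : 0 < (y - x)%:R :> R.
  by rewrite ltr0n subn_gt0; case/andP: xyN.
have Ec c : c = \sum_(l < K.+1) (cnt l x y / (y - x)%:R) * c.
  by rewrite -!mulr_suml wsum// divff ?mul1r// gt_eqF.
rewrite mixE2 [X in X <= _](Ec (c0 / 2)) [X in _ && (_ <= X)](Ec c1).
by apply/andP; split; apply: ler_sum => l _; rewrite ler_wpM2l ?divr_ge0//;
  have /andP[] := hkf l us.
Qed.

Let off (k : 'I_K.+1) x y := \sum_(l < K.+1 | l != k) cnt l x y.

Let off_le k x y : (x < y <= N)%N -> off k x y <= (y - x)%:R.
Proof.
by move=> xyN; rewrite -wsum// [leRHS](bigD1 k)//= lerDr.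
Qed.

Let off_ge0 k x y : 0 <= off k x y.
Proof. by rewrite sumr_ge0. Qed.

Let err_le x y k u : (x < y <= N)%N -> u \in s ->
  `|(y - x)%:R * (est x y u - mix x y u)| <= E + dl * off k x y.
Proof. by move=> xyN us; rewrite mulrBr mixE//; exact: hest. Qed.

Lemma est_itv x y u : (x < y <= N)%N -> ml <= (y - x)%:R -> u \in s ->
  c0 / 4 <= est x y u <= 2 * c1.
Proof.
move=> xyN mlxy us; have n0 : 0 < (y - x)%:R :> R.
  by rewrite ltr0n subn_gt0; case/andP: xyN.
(* Each part of the error is at most dl per unit of time: E because E <= dl ml and the segment is at
   least ml long, the other because the foreign times are at most all of its times. *)
have h : `|est x y u - mix x y u| <= 2 * dl.
  rewrite -(ler_pM2l n0) -[X in X * `|_|](gtr0_norm n0) -normrM.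
  apply: le_trans (err_le ord0 xyN us) _.
  have h1 := ler_wpM2l dl0 (off_le ord0 xyN); have h2 := ler_wpM2l dl0 mlxy.
  rewrite (_ : _ * (2 * dl) = dl * (y - x)%:R + dl * (y - x)%:R); last by ring.
  by rewrite lerD//; exact: le_trans Edl h2.
have /andP[m1 m2] := mixc xyN us; move: h; rewrite ler_norml => /andP[h1 h2].
have := dlc; have := c01; have := c00; move: m1 m2 h1 h2.
by move: (mix x y u) (est x y u) => m e *; apply/andP; split; lra.
Qed.

(** The estimate is replaced by the mixture that it targets. The objective of the mixture is linear
    in the true spectra once its logarithm is fixed, which gives the terms [theta l] minus the
    divergence of each spectrum from the mixture. All but one of these divergences are at least eta;
    half of that pays for the error dl per foreign time. *)
Lemma seg_upper x y : (x < y <= N)%N -> ml <= (y - x)%:R ->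
  exists k : 'I_K.+1,
  (y - x)%:R * G (fun u => est x y u * ln (st s (est x y) u / b u)) <=
  \sum_(l < K.+1) cnt l x y * theta l + 4 * pi * LL * E -
  eta / 2 * \sum_(l < K.+1 | l != k) cnt l x y.
Proof.
move=> xyN mlxy; have n0 : 0 < (y - x)%:R :> R.
  by rewrite ltr0n subn_gt0; case/andP: xyN.
set n := (y - x)%:R in n0 mlxy *; set g := est x y; set m := mix x y.
have hg u : u \in s -> c0 / 4 <= g u <= 2 * c1 by exact: est_itv.
have hm u : u \in s -> c0 / 2 <= m u <= c1 by exact: mixc.
have c02 : 0 < c0 / 2 by rewrite divr_gt0.
have posm u : u \in s -> 0 < m u by move=> /hm /andP[h _]; exact: lt_le_trans h.
have posg u : u \in s -> 0 < g u.
  by move=> /hg /andP[h _]; apply: lt_le_trans h; rewrite divr_gt0.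
have poskf k u : u \in s -> 0 < kap u * f k u.
  by move=> /(hkf k) /andP[h _]; exact: lt_le_trans h.
pose D k := kl s (fun u => kap u * f k u) m.
have D0 k : 0 <= D k by apply: kl_ge0 => //; exact: poskf.
(* The dominant segment is defined by its divergence and not by its number of times: it is the only
   one that may be closer than eta to the mixture, since by [kl_gap] two such segments would
   contradict [hgap]. *)
have [kk hkk] : exists kk, forall l, l != kk -> eta <= D l.
  have [[kk Dkk]|none] := pselect (exists kk, D kk < eta); last first.
    by exists ord0 => l _; rewrite leNgt; apply/negP => h; apply: none; exists l.
  exists kk => l lk; rewrite leNgt; apply/negP => Dl.
  have := kl_gap s0 c00 c01 (fc l) (fc kk) kapc hm; rewrite -/(D l) -/(D kk).
  have C0 : 0 < gap_const c0 c1.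
    have i0 : 0 < c0^-1 by rewrite invr_gt0.
    rewrite /gap_const divr_gt0 ?mulr_gt0 ?exprn_gt0 ?divr_gt0 ?pi_gt0 ?mulr_gt0//.
    by rewrite ltr_pwDl// sqr_ge0.
  move=> /(le_trans (hgap lk)); rewrite mulrC ler_pM2l// => h.
  by move: h; rewrite leNgt => /negP; apply; rewrite mulr_natl mulr2n ltrD.
exists kk.
have eb : forall u, u \in s -> `|n * (g u - m u)| <= E + dl * off kk x y.
  by move=> u us; exact: err_le.
set e := E + dl * off kk x y in eb.
have lng u : u \in s -> 0 < st s g u /\ `|ln (st s g u)| <= LL by exact: ln_st_bound.
have split1 : n * G (fun u => g u * ln (st s g u / b u)) =
    G (fun u => n * (g u - m u) * ln (st s g u)) + n * G (fun u => m u * ln (st s g u)) -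
    (G (fun u => n * (g u - m u) * ln (b u)) + n * G (fun u => m u * ln (b u))).
  rewrite -!grid_intZ -!grid_intD -grid_intB; apply: eq_grid_int => u us.
  have [sg _] := lng u us.
  by rewrite lnM ?posrE ?invr_gt0 ?hb// lnV ?posrE ?hb//; ring.
have b1 : G (fun u => n * (g u - m u) * ln (st s g u)) <= 2 * pi * (e * LL).
  apply: le_trans (ler_norm _) _; apply: grid_int_norm => // u us.
  by rewrite normrM ler_pM// ?eb//; have [] := lng u us.
have b2 : - G (fun u => n * (g u - m u) * ln (b u)) <= 2 * pi * (e * LL).
  apply: le_trans (ler_norm _) _; rewrite normrN; apply: grid_int_norm => // u us.
  by rewrite normrM ler_pM// ?eb ?hlnb.
(* Gibbs' inequality: it replaces the estimate by the mixture inside the logarithm without any error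
   term. *)
have b3 : G (fun u => m u * ln (st s g u)) <= G (fun u => m u * ln (st s m u)).
  have h := kl_ge0 s0 posm posg; rewrite /kl in h.
  rewrite -subr_ge0 -grid_intB; apply: le_trans h _; apply: grid_int_le => // u us.
  have [sg _] := lng u us; have sm : 0 < st s m u.
    by rewrite divr_gt0 ?posm//; exact: grid_int_gt0.
  by rewrite lnM ?posrE ?invr_gt0// lnV ?posrE// mulrDr mulrN.
have mixlin h : n * G (fun u => m u * h u) = \sum_(l < K.+1) cnt l x y * G (fun u => kap u * f l u * h u).
  rewrite -grid_intZ; under [RHS]eq_bigr do rewrite -grid_intZ.
  rewrite -grid_int_sum; apply: eq_grid_int => u us.
  rewrite mulrA (mixE u xyN) mulrC mulrA mulr_sumr; apply: eq_bigr => l _.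
  by ring.
have b4 l : G (fun u => kap u * f l u * ln (st s m u)) =
    G (fun u => kap u * f l u * ln (st s (fun u => kap u * f l u) u)) - D l.
  rewrite /D /kl -grid_intB; apply: eq_grid_int => u us.
  have sm : 0 < st s m u by rewrite divr_gt0 ?posm//; exact: grid_int_gt0.
  have sk : 0 < st s (fun u => kap u * f l u) u.
    by rewrite divr_gt0 ?poskf//; apply: grid_int_gt0 => //; exact: poskf.
  by rewrite lnM ?posrE ?invr_gt0// lnV ?posrE//; ring.
have b5 : \sum_(l < K.+1) cnt l x y * D l >= eta * off kk x y.
  rewrite [leRHS](bigD1 kk)//= /off mulr_sumr -[leLHS]add0r; apply: lerD.
    exact: mulr_ge0.
  by apply: ler_sum => l lk; rewrite mulrC ler_wpM2l// hkk.
rewrite split1.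
have b3' := ler_wpM2l (ltW n0) b3.
have EQ : n * G (fun u => m u * ln (st s m u)) - n * G (fun u => m u * ln (b u)) =
    \sum_(l < K.+1) cnt l x y * theta l - \sum_(l < K.+1) cnt l x y * D l.
  rewrite (mixlin (fun u => ln (st s m u))) (mixlin (fun u => ln (b u))) -!sumrB.
  by apply: eq_bigr => l _; rewrite b4 /theta; ring.
have hd := ler_wpM2r (off_ge0 kk x y) hdl.
rewrite -/(off kk x y) /e in b1 b2 *.
have -> : 4 * pi * LL * E = 2 * pi * (E * LL) + 2 * pi * (E * LL) by ring.
have hd' : 2 * pi * ((E + dl * off kk x y) * LL) <= 2 * pi * (E * LL) + eta / 4 * off kk x y.
  rewrite -subr_ge0 (_ : _ - _ = (eta / 2 * off kk x y - 4 * pi * LL * dl * off kk x y) / 2); last by field.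
  by rewrite divr_ge0// subr_ge0.
move: b1 b2 b3' b5 hd' EQ.
set X1 := G _; set X2 := n * G _; set X3 := G _; set X4 := n * G _; set X5 := n * G _.
move: (2 * pi * ((E + dl * off kk x y) * LL)) (2 * pi * (E * LL)) (\sum_(l < K.+1) cnt l x y * theta l)
  (\sum_(l < K.+1) cnt l x y * D l) (off kk x y) => Y1 Y2 Y3 Y4 o.
move: X1 X2 X3 X4 X5 => {}X1 {}X2 {}X3 {}X4 {}X5 h1 h2 h3 h4 h5 h6.
have : eta * o = eta / 2 * o + eta / 4 * o + eta / 4 * o by field.
by move: (eta * o) (eta / 2 * o) (eta / 4 * o) h4 h5 => z1 z2 z3; lra.
Qed.

(** On a true segment the mixture is the spectrum itself and there are no foreign times. Gibbs'
    inequality now serves with the estimate as weight: replacing the logarithm of the estimate by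
    that of the spectrum can only decrease the objective. *)
Lemma seg_lower (k : 'I_K.+1) : ml <= (t0 k.+1 - t0 k)%:R ->
  (t0 k.+1 - t0 k)%:R * theta k - 4 * pi * LL * E <=
  (t0 k.+1 - t0 k)%:R *
    G (fun u => est (t0 k) (t0 k.+1) u * ln (st s (est (t0 k) (t0 k.+1)) u / b u)).
Proof.
move=> mlk; have n0 : 0 < (t0 k.+1 - t0 k)%:R :> R by exact: lt_le_trans mlk.
have xyN : (t0 k < t0 k.+1 <= N)%N.
  rewrite -subn_gt0 -(ltr0n R) n0 /= -t0N; apply: (t0_mono t0S).
  by rewrite leqnn andbT -ltnS ltnS ltn_ord.
have kK : (k <= K)%N by rewrite -ltnS ltn_ord.
have cnt0 l : l != k -> cnt l (t0 k) (t0 k.+1) = 0.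
  by move=> lk; rewrite (seg_count_other t0S) // -ltnS.
have off0 : off k (t0 k) (t0 k.+1) = 0 by rewrite /off big1.
have cntk : cnt k (t0 k) (t0 k.+1) = (t0 k.+1 - t0 k)%:R.
  by rewrite -(wsum xyN) (bigD1 k)//= [X in _ + X]big1 ?addr0.
set M := fun u => kap u * f k u.
have ME u : mix (t0 k) (t0 k.+1) u = M u.
  rewrite mixE2 (bigD1 k)//= big1 ?addr0 => [|l lk]; last by rewrite cnt0// mul0r mul0r.
  by rewrite cntk divff ?mul1r// gt_eqF.
set n := (t0 k.+1 - t0 k)%:R in n0 mlk cntk *; set g := est (t0 k) (t0 k.+1).
have eb u : u \in s -> `|n * (g u - M u)| <= E.
  by move=> us; rewrite -ME; apply: le_trans (err_le k xyN us) _; rewrite off0 mulr0 addr0.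
have hg u : u \in s -> c0 / 4 <= g u <= 2 * c1 by exact: est_itv.
have posg u : u \in s -> 0 < g u.
  by move=> /hg /andP[h _]; apply: lt_le_trans h; rewrite divr_gt0.
have posM u : u \in s -> 0 < M u.
  by move=> /(hkf k) /andP[h _]; apply: lt_le_trans h; rewrite divr_gt0.
have lng u : u \in s -> 0 < st s g u /\ `|ln (st s g u)| <= LL by exact: ln_st_bound.
have lnM' u : u \in s -> 0 < st s M u /\ `|ln (st s M u)| <= LL.
  apply: ln_st_bound => v vs; have /andP[p q] := hkf k vs.
  by apply/andP; split; [apply: le_trans p|apply: le_trans q _]; have := c00; have := c10; lra.
have split1 : n * G (fun u => g u * ln (st s g u / b u)) =
    n * (G (fun u => g u * ln (st s g u)) - G (fun u => g u * ln (st s M u))) +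
    n * (G (fun u => M u * ln (st s M u)) - G (fun u => M u * ln (b u))) +
    (G (fun u => n * (g u - M u) * ln (st s M u)) - G (fun u => n * (g u - M u) * ln (b u))).
  rewrite -!grid_intB -!grid_intZ -!grid_intD; apply: eq_grid_int => u us.
  have [sg _] := lng u us.
  by rewrite lnM ?posrE ?invr_gt0 ?hb// lnV ?posrE ?hb//; ring.
have b3 : 0 <= G (fun u => g u * ln (st s g u)) - G (fun u => g u * ln (st s M u)).
  have := kl_ge0 s0 posg posM; rewrite /kl -grid_intB.
  move=> /le_trans; apply; apply: grid_int_le => // u us.
  have [sg _] := lng u us; have [sm _] := lnM' u us.
  by rewrite lnM ?posrE ?invr_gt0// lnV ?posrE// mulrDr mulrN.
have b1 : `|G (fun u => n * (g u - M u) * ln (st s M u))| <= 2 * pi * (E * LL).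
  by apply: grid_int_norm => // u us; rewrite normrM ler_pM// ?eb//; have [] := lnM' u us.
have b2 : `|G (fun u => n * (g u - M u) * ln (b u))| <= 2 * pi * (E * LL).
  by apply: grid_int_norm => // u us; rewrite normrM ler_pM// ?eb ?hlnb.
rewrite split1 -/(theta k).
have := mulr_ge0 (ltW n0) b3; move: b1 b2; rewrite !ler_norml => /andP[h1 _] /andP[_ h2] h3.
have -> : 4 * pi * LL * E = 2 * pi * (E * LL) + 2 * pi * (E * LL) by ring.
move: h1 h2 h3; move: (n * (G _ - _)) (n * theta k) (2 * pi * (E * LL)) => X1 X2 X3.
by move: (G _) (G _) => X4 X5; lra.
Qed.

Definition total_count (k : 'I_K.+1) : nat := (t0 k.+1 - t0 k)%N.

Hypothesis mlN : forall k : 'I_K.+1, ml <= (total_count k)%:R.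
Variable Nm : R.
Hypothesis NmN : forall k : 'I_K.+1, Nm <= (total_count k)%:R.

Definition total_objective L (tau : nat -> nat) :=
  \sum_(k < L.+1) (tau k.+1 - tau k)%:R *
    G (fun u => est (tau k) (tau k.+1) u * ln (st s (est (tau k) (tau k.+1)) u / b u)).

Lemma admissible_lt L tau i : admissible N ml L tau -> (i <= L)%N ->
  (tau i < tau i.+1 <= N)%N.
Proof.
move=> [_ tauN H] iL; have [-> _] := H i iL.
rewrite /= -tauN; apply: (@t0_mono L tau _ i.+1 L.+1); last by rewrite ltnS iL leqnn.
by move=> k kL; apply: ltnW; have [] := H k kL.
Qed.

Let theta_total := \sum_(l < K.+1) (total_count l)%:R * theta l.

Lemma seg_count_full (l : 'I_K.+1) : seg_count t0 l 0 N = total_count l.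
Proof.
apply: seg_count_sub => //; last by apply: t0S; rewrite -ltnS ltn_ord.
by rewrite -t0N; apply: (t0_mono t0S); rewrite leqnn andbT ltn_ord.
Qed.

Lemma total_objective_le L tau : admissible N ml L tau ->
  total_objective L tau <= theta_total + L.+1%:R * (4 * pi * LL * E) -
    eta / 2 * ((L < K)%N%:R * Nm).
Proof.
move=> adm; have [tau0 tauN H] := adm.
have tauS k : (k <= L)%N -> (tau k <= tau k.+1)%N.
  by move=> kL; apply: ltnW; have [] := H k kL.
have /fin_all_exists [kk hkk] (i : 'I_L.+1) := seg_upper
  (admissible_lt adm (ltn_ord i : i <= L)%N) (proj2 (H i (ltn_ord i))).
apply: le_trans (ler_sum _ (fun i _ => hkk i)) _.
rewrite sumrB big_split /= sumr_const card_ord -[_ *+ L.+1]mulr_natl.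
have cntT (l : 'I_K.+1) : \sum_(i < L.+1) cnt l (tau i) (tau i.+1) = (total_count l)%:R.
  by rewrite -natr_sum seg_count_telescope// tauN seg_count_full.
rewrite exchange_big /=; under eq_bigr do rewrite -mulr_suml cntT.
rewrite -/theta_total lerB// -mulr_sumr ler_wpM2l ?divr_ge0 ?(ltW eta0)//.
have [LK|_] := ltnP L K; last first.
  by rewrite mul0r; apply: sumr_ge0 => i _; exact: sumr_ge0.
rewrite mul1r.
(* Pigeonhole: at most K segments cannot have all K + 1 true segments as dominant ones. All the
   times of [k0] are then foreign wherever they fall. *)
have [k0 hk0] : exists k0, forall i, kk i != k0.
  apply: contrapT => none.
  have surj k : exists i, kk i = k.
    apply: contrapT => nk; apply: none; exists k => i; apply/eqP => ik.
    by apply: nk; exists i.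
  have h : (K.+1 <= #|codom kk|)%N.
    rewrite -[X in (X <= _)%N]card_ord -cardsT; apply: subset_leq_card.
    by apply/fintype.subsetP => k _; have [i <-] := surj k; exact: codom_f.
  have := leq_trans h (card_size _); rewrite size_codom card_ord => h2.
  by move: LK; rewrite ltnNge -ltnS h2.
apply: le_trans (NmN k0) _; rewrite -cntT; apply: ler_sum => i _.
rewrite (bigD1 k0) /=; last by rewrite eq_sym.
by rewrite lerDl sumr_ge0.
Qed.

Lemma total_objective_ge : theta_total - K.+1%:R * (4 * pi * LL * E) <= total_objective K t0.
Proof.
have -> : K.+1%:R * (4 * pi * LL * E) = \sum_(k < K.+1) (4 * pi * LL * E).
  by rewrite sumr_const card_ord mulr_natl.
by rewrite /theta_total -sumrB; apply: ler_sum => k _; apply: seg_lower; exact: mlN.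
Qed.

End SegmentBounds.

(** * From the objective function to the penalized criterion *)

Section BICUnique.
Context {R : realType}.
Variables (B : baseline) (Lam : seq R) (W : R -> R) (m : R) (N : nat) (x : nat -> R).
Variables (ml C : R) (Kmax K : nat) (t0 : nat -> nat) (A D : R).
Hypothesis KK : (1 <= K <= Kmax)%N.
Hypothesis adm : admissible N ml K t0.
Hypothesis obj_le : forall L tau, (L <= Kmax)%N -> admissible N ml L tau ->
  objective B Lam W m N x L tau <= objective B Lam W m N x K t0 + A - (L < K)%N%:R * D.
Hypothesis A0 : 0 <= A.
Hypothesis AC : A < C.
Hypothesis ACD : A + K%:R * C < D.

(** [A] is the most that another partition can gain by chance and [D] what is lost for want of
    change points. With L > K the extra penalty is at least C > A; with L < K the penalty saved is
    at most K C, less than D - A. *)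
Lemma BIC_minimizer_unique L : BIC_minimizer B Lam W m N x ml C Kmax L -> L = K.
Proof.
move=> [[/andP[L1 LK] [tau htau]] min].
have candK : candidate N ml Kmax K by split=> //; exists t0.
have := min K candK; rewrite /BIC.
set SL := [set objective _ _ _ _ _ _ L _ | _ in _].
set SK := [set objective _ _ _ _ _ _ K _ | _ in _].
set o := objective B Lam W m N x K t0.
have supL : sup SL <= o + A - (L < K)%N%:R * D.
  apply: ge_sup; first by exists (objective B Lam W m N x L tau), tau.
  by move=> _ [t ht <-]; exact: obj_le.
have supK : o <= sup SK.
  apply: ub_le_sup; last by exists t0.
  exists (o + A); move=> _ [t ht <-].
  by have := obj_le (andP KK).2 ht; rewrite ltnn mul0r subr0.
move=> h.
have {}h : L%:R * C + (L < K)%N%:R * D <= A + K%:R * C by lra.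
have C0 : 0 < C by exact: le_lt_trans AC.
case: (ltngtP L K) => // LK'; exfalso.
  move: h; rewrite LK' mul1r => h.
  have : 0 <= L%:R * C by rewrite mulr_ge0// ltW.
  by have := ACD; lra.
have : K.+1%:R * C <= L%:R * C by rewrite ler_wpM2r ?(ltW C0)// ler_nat.
have -> : K.+1%:R * C = K%:R * C + C by rewrite -natr1 mulrDl mul1r.
move: h; rewrite ltnNge (ltnW LK') /= mul0r addr0.
by have := AC; lra.
Qed.

End BICUnique.

(** * Covariances of truncated linear processes *)

Definition zseq (n : nat) : seq int := [seq i%:Z - n%:Z | i <- iota 0 n.*2.+1].

Lemma zseq_uniq n : uniq (zseq n).
Proof. by rewrite map_inj_uniq ?iota_uniq// => x y; lia. Qed.

Lemma mem_zseq n j : (j \in zseq n) = (`|j| <= n)%N.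
Proof.
apply/mapP/idP => [[i]|jn]; first by rewrite mem_iota => hi ->; lia.
by exists (absz (j + n%:Z)); [rewrite mem_iota; lia|lia].
Qed.

Section ZSum.
Context {R : realType}.
Variable a : int -> R.

Lemma zsumE (F : int -> R) n : zsum F n = \sum_(j <- zseq n) F j.
Proof. by rewrite /zsum /zseq big_map -(big_mkord xpredT (fun i => F (i%:Z - n%:Z))). Qed.

Lemma zsum_sub (F : int -> R) n m : (n <= m)%N ->
  zsum F m - zsum F n = \sum_(j <- [seq j <- zseq m | (n < `|j|)%N]) F j.
Proof.
move=> nm; rewrite !zsumE big_filter.
rewrite [X in X - _](bigID (fun j : int => (n < `|j|)%N)) /= addrC.
rewrite [X in X + _ - _](_ : _ = \sum_(j <- zseq n) F j); first by rewrite addrAC addrN add0r.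
rewrite -big_filter; apply: perm_big; apply: uniq_perm; rewrite ?filter_uniq ?zseq_uniq//.
by move=> j; rewrite mem_filter !mem_zseq -leqNgt; apply/andP/idP => [[]//|jn]; lia.
Qed.

Lemma zsum_le_bound (F : int -> R) (G : R) : (forall j, `|F j| <= `|a j|) ->
  (forall s : seq int, uniq s -> \sum_(j <- s) `|a j| <= G) -> forall n, `|zsum F n| <= G.
Proof.
move=> Fa hG n; rewrite zsumE; apply: le_trans (ler_norm_sum _ _ _) _.
apply: le_trans (hG _ (zseq_uniq n)); exact: ler_sum.
Qed.

Lemma zsum_tail (F : int -> R) (eps : R) (H : nat) : (forall j, `|F j| <= `|a j|) ->
  (forall s : seq int, uniq s -> all (fun j => (H < `|j|)%N) s -> \sum_(j <- s) `|a j| <= eps) ->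
  forall n m, (H <= n <= m)%N -> `|zsum F m - zsum F n| <= eps.
Proof.
move=> Fa hH n m /andP[Hn nm]; rewrite zsum_sub//.
apply: le_trans (ler_norm_sum _ _ _) _.
apply: le_trans (hH [seq j <- zseq m | (n < `|j|)%N] _ _); first exact: ler_sum.
  by rewrite filter_uniq// zseq_uniq.
by apply/allP => j; rewrite mem_filter => /andP[nj _]; lia.
Qed.

End ZSum.

Section SummableInt.
Context {R : realType}.
Variable a : int -> R.
Hypothesis ha : summable [set: int] (fun j => (a j)%:E).

Lemma summable_bound : exists2 G : R, 0 < G &
  forall s : seq int, uniq s -> \sum_(j <- s) `|a j| <= G.
Proof.
have fin : (\esum_(j in [set: int]) `|(a j)%:E|)%E \is a fin_num.
  rewrite ge0_fin_numE; first exact: ha.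
  by apply: esum_ge0.
exists (fine (\esum_(j in [set: int]) `|(a j)%:E|)%E + 1).
  by rewrite ltr_wpDl// fine_ge0//; apply: esum_ge0.
move=> s us; apply: (@le_trans _ _ (fine (\esum_(j in [set: int]) `|(a j)%:E|)%E)); last first.
  by rewrite lerDl.
rewrite -lee_fin fineK// -sumEFin.
apply: esum_ge; exists [set` s]; first by split=> //; exact: finite_seq.
rewrite -fsbig_seq//.
Qed.

(** A finite set of lags that attains the supremum of the finite sums up to eps is contained in
    [-H, H]; sums over larger lags are disjoint from it. *)
Lemma summable_tail (eps : R) : 0 < eps -> exists H : nat,
  forall s : seq int, uniq s -> all (fun j => (H < `|j|)%N) s -> \sum_(j <- s) `|a j| <= eps.
Proof.
move=> e0; have [G G0 hG] := summable_bound.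
pose E := [set \sum_(j <- s) `|a j| | s in [set s : seq int | uniq s]].
have supE : has_sup E.
  split; first by exists (\sum_(j <- [::]) `|a j|), [::].
  by exists G => _ [s us <-]; exact: hG.
have [_ [s0 us0 <-] hs0] := sup_adherent e0 supE.
exists (\max_(j <- s0) `|j|%N) => s us hs.
have dis : uniq (s0 ++ s).
  rewrite cat_uniq us0 us andbT /=; apply/hasPn => j js; apply/negP => js0.
  have := allP hs j js; rewrite ltnNge => /negP; apply.
  exact: (leq_bigmax_seq (F := fun j : int => `|j|%N)).
have : \sum_(j <- s0 ++ s) `|a j| <= sup E.
  by apply: ub_le_sup; [exact: supE.2|exists (s0 ++ s)].
by rewrite big_cat /=; move: hs0; lra.
Qed.

(** Both F + |a| and |a| are nonnegative, with bounded and nondecreasing symmetric sums; F is their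
    difference. *)
Lemma is_cvg_zsum (F : int -> R) : (forall j, `|F j| <= `|a j|) -> cvgn (zsum F).
Proof.
move=> Fa; have [G G0 hG] := summable_bound.
have mono (F' : int -> R) : (forall j, 0 <= F' j) -> {homo zsum F' : n m / (n <= m)%N >-> n <= m}.
  by move=> F0 n m nm; rewrite -subr_ge0 zsum_sub// sumr_ge0.
have c2 : cvgn (zsum (fun j => `|a j|)).
  apply: nondecreasing_is_cvgn; first by apply: mono => j.
  exists G => _ [n _ <-]; apply: le_trans (ler_norm _) _.
  by apply: (zsum_le_bound (a := a) (F := fun j => `|a j|)) => // j; rewrite normr_id.
have c1 : cvgn (zsum (fun j => F j + `|a j|)).
  apply: nondecreasing_is_cvgn.
    by apply: mono => j; have := Fa j; rewrite ler_norml => /andP[]; lra.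
  exists (G + G) => _ [n _ <-]; rewrite /zsum big_split /=.
  apply: lerD; apply: le_trans (ler_norm _) _; first exact: zsum_le_bound.
  by apply: (zsum_le_bound (a := a) (F := fun j => `|a j|)) => // j; rewrite normr_id.
rewrite (_ : zsum F = (fun n => zsum (fun j => F j + `|a j|) n - zsum (fun j => `|a j|) n)).
  exact: is_cvgB.
by apply/funext => n; rewrite /zsum -sumrB; apply: eq_bigr => j _; rewrite addrK.
Qed.

Lemma zsum_lim_tail (F : int -> R) (eps : R) (H : nat) : (forall j, `|F j| <= `|a j|) ->
  (forall s : seq int, uniq s -> all (fun j => (H < `|j|)%N) s -> \sum_(j <- s) `|a j| <= eps) ->
  forall n, (H <= n)%N -> `|zsum F n - limn (zsum F)| <= eps.
Proof.
move=> Fa hH n Hn; have cF := is_cvg_zsum Fa.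
have cd : (fun m => `|zsum F n - zsum F m|) @ \oo --> `|zsum F n - limn (zsum F)|.
  by apply: cvg_norm; apply: cvgB => //; exact: cvg_cst.
rewrite -(cvg_lim _ cd)//; apply: limr_le; first by apply/cvg_ex; eexists; exact: cd.
by near=> m; rewrite distrC; apply: (zsum_tail Fa hH); rewrite Hn /=; near: m; exact: nbhs_infty_ge.
Unshelve. all: by end_near. Qed.

End SummableInt.

(** * Lipschitz functions on the circle *)

Section TrigBounds.
Context {R : realType}.

Lemma sin_ge_mul_cos (z : R) : 0 <= z <= pi -> z * cos z <= sin z.
Proof.
move=> /andP[]; rewrite le_eqVlt => /predU1P[<-|z0] zp; first by rewrite mul0r sin0.
have [x xz] : exists2 x : R, x \in `]0, z[ & sin z - sin 0 = cos x * (z - 0).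
  apply: (@MVT _ sin cos _ _ z0).
  by apply: continuous_subspaceT => x; exact: continuous_sin.
move: xz; rewrite in_itv /= => /andP[x0 xz].
rewrite sin0 !subr0 mulrC => ->; rewrite ler_wpM2l ?(ltW z0)//.
apply: ltW; rewrite ltr_cos// in_itv /= ?(ltW z0) ?(ltW x0)//.
by rewrite ltW// (lt_le_trans xz).
Qed.

(** With x = 4 y, the right-hand side is 16 sin(2 y)^2, and y <= sin(2 y) for 0 <= y <= pi / 4. The
    constant is not sharp. *)
Lemma sqr_le_cos (x : R) : `|x| <= pi -> x ^+ 2 <= 8 * (1 - cos x).
Proof.
wlog x0 : x / 0 <= x.
  move=> H xp; have [x0|/ltW x0] := lerP 0 x; first exact: H.
  by rewrite -sqrrN -cosN; apply: H; rewrite ?normrN// oppr_ge0.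
rewrite ger0_norm// => xp.
have [y yx] : exists y, x = 4 * y by exists (x / 4); field.
have y0 : 0 <= y by lra.
have yp : y <= pi / 4 by lra.
have pi0 := @pi_gt0 R.
have h1 : y * cos y <= sin y by apply: sin_ge_mul_cos; rewrite y0/=; lra.
have c2 : 1 / 2 <= cos y ^+ 2.
  have : 0 <= cos (y *+ 2).
    by apply: cos_ge0_pihalf; apply/andP; split; lra.
  by rewrite cos_mulr2n mulr2n; lra.
have cy : 0 <= cos y by apply: cos_ge0_pihalf; apply/andP; split; lra.
have h2 : y <= sin (y *+ 2).
  rewrite sin_mulr2n mulr2n; have := ler_wpM2l cy h1.
  have := ler_wpM2l y0 c2; move: (sin y) (cos y) => sy cy'; rewrite expr2; nra.
have h3 : y ^+ 2 <= sin (y *+ 2) ^+ 2 by rewrite lerXn2r// nnegrE// (le_trans y0).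
have -> : x = (y *+ 2) *+ 2 by rewrite yx !mulr2n; ring.
rewrite cos_mulr2n cos2sin2.
move: h3; rewrite !mulr2n; move: (sin (y + y) ^+ 2) => s; nra.
Qed.

(** Produces the modulus that [fejer_bias] asks for. Equal values at both ends make [f] Lipschitz
    for the distance d on the circle: if |u - v| > pi, the path goes through the end points. Then d
    is at most t d^2 + 1 / t, and d^2 at most 8 (1 - cos d). *)
Lemma lipschitz_circle (f : R -> R) (B : R) : 0 <= B -> f pi = f (- pi) ->
  (forall u v, u \in `[- pi, pi] -> v \in `[- pi, pi] -> `|f u - f v| <= B * `|u - v|) ->
  forall t u v, 0 < t -> u \in `[- pi, pi] -> v \in `[- pi, pi] ->
  `|f v - f u| <= 8 * B * (t * (1 - cos (u - v)) + t^-1).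
Proof.
move=> B0 fpi hf t u v t0 uI vI; have pi0 := @pi_gt0 R.
suff [d [d0 dp fd cd]] : exists d, [/\ 0 <= d, d <= pi, `|f v - f u| <= B * d & cos d = cos (u - v)].
  have h := @sqr_le_cos d; rewrite ger0_norm// cd in h; have {}h := h dp.
  apply: le_trans fd _; rewrite [8 * B]mulrC -mulrA ler_wpM2l//.
  have ti0 : 0 < t^-1 by rewrite invr_gt0.
  have : d <= t * d ^+ 2 + t^-1.
    have := mulr_ge0 (ltW ti0) (sqr_ge0 (t * d - 1)).
    have -> : t^-1 * (t * d - 1) ^+ 2 = t * d ^+ 2 - 2 * d + t^-1 by field; rewrite gt_eqF.
    by lra.
  by have := ler_wpM2l (ltW t0) h; lra.
have [h|h] := lerP `|u - v| pi.
  exists `|u - v|; split => //; last by rewrite cos_norm.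
  by rewrite distrC; exact: hf.
exists (2 * pi - `|u - v|).
have pI : (pi : R) \in `[- pi, pi] by rewrite in_itv /= lexx andbT; lra.
have nI : (- pi : R) \in `[- pi, pi] by rewrite in_itv /= lexx /=; lra.
move: (uI) (vI); rewrite !in_itv /= => /andP[u1 u2] /andP[v1 v2].
have c2 (x : R) : cos (2 * pi - x) = cos x.
  by rewrite addrC mulr_natl cosD2pi cosN.
split.
- by rewrite subr_ge0 ler_norml; apply/andP; split; lra.
- by move: h; lra.
- have [uv|uv] := lerP 0 (u - v).
    rewrite (_ : f v - f u = (f v - f (- pi)) - (f u - f pi)); last by rewrite fpi; ring.
    apply: le_trans (ler_normB _ _) _.
    have := hf _ _ vI nI; have := hf _ _ uI pI.
    rewrite (ger0_norm (_ : 0 <= v - - pi)) ?(ler0_norm (_ : u - pi <= 0)); [|lra|lra].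
    move=> e1 e2; apply: le_trans (lerD e2 e1) _.
    by rewrite -mulrDr ler_wpM2l//; rewrite (ger0_norm uv); lra.
  rewrite (_ : f v - f u = (f v - f pi) - (f u - f (- pi))); last by rewrite fpi; ring.
  apply: le_trans (ler_normB _ _) _.
  have := hf _ _ vI pI; have := hf _ _ uI nI.
  rewrite (ger0_norm (_ : 0 <= u - - pi)) ?(ler0_norm (_ : v - pi <= 0)); [|lra|lra].
  move=> e1 e2; apply: le_trans (lerD e2 e1) _.
  by rewrite -mulrDr ler_wpM2l//; rewrite (ltr0_norm uv); lra.
- by rewrite c2 cos_norm.
Qed.

End TrigBounds.

(** * Covariances bounded through a dominating sequence *)

Section Dominated.
Context {R : realType}.
Variables (A : int -> R) (G : R).
Hypothesis A0 : forall j, 0 <= A j.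
Hypothesis hG : forall s : seq int, uniq s -> \sum_(j <- s) A j <= G.

Lemma dominated_ge0 : 0 <= G.
Proof. by have := hG (s := [::]) isT; rewrite big_nil. Qed.

Lemma dominated_sum (s : seq nat) (Pr : pred nat) (phi : nat -> int) :
  injective phi -> uniq s -> \sum_(i <- s | Pr i) A (phi i) <= G.
Proof.
move=> inj us; rewrite -big_filter -(big_map phi xpredT A).
by apply: hG; rewrite map_inj_uniq// filter_uniq.
Qed.

(* The innovations that the observations truncated at lag J involve are numbered
   from 0: the i-th one is xi (noise_idx J i). *)
Definition noise_idx (J i : nat) : int := i%:Z - J%:Z.

(** The lag of the i-th innovation seen from the time s + 1, for which the index s stands. *)
Definition lag (J s i : nat) : int := s.+1%:Z - noise_idx J i.

Lemma lag_injl J s : injective (lag J s).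
Proof. by rewrite /lag /noise_idx => i j; lia. Qed.

Lemma lag_injr J i : injective (fun s => lag J s i).
Proof. by rewrite /lag /noise_idx => s r; lia. Qed.

Definition dom_corr (M J s r : nat) : R := \sum_(i < M) A (lag J s i) * A (lag J r i).

Lemma dom_corr_ge0 M J s r : 0 <= dom_corr M J s r.
Proof. by apply: sumr_ge0 => i _; rewrite mulr_ge0. Qed.

Lemma dom_corrC M J s r : dom_corr M J s r = dom_corr M J r s.
Proof. by apply: eq_bigr => i _; rewrite mulrC. Qed.

Lemma sum_ordE M (F : nat -> R) : \sum_(i < M) F i = \sum_(i <- iota 0 M) F i.
Proof. by rewrite -(big_mkord xpredT F) /index_iota subn0. Qed.

Lemma dominated_row M J s : \sum_(i < M) A (lag J s i) <= G.
Proof.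
rewrite (sum_ordE M (fun i => A (lag J s i))).
by apply: dominated_sum; [exact: lag_injl|exact: iota_uniq].
Qed.

Lemma dominated_col J i (x y : nat) (Pr : pred nat) : \sum_(x <= s < y | Pr s) A (lag J s i) <= G.
Proof. by apply: (@dominated_sum _ _ (fun s => lag J s i)); [exact: lag_injr|exact: iota_uniq]. Qed.

Lemma dom_corr_row M J s x y (Pr : pred nat) :
  \sum_(x <= r < y | Pr r) dom_corr M J s r <= G ^+ 2.
Proof.
have G0 := dominated_ge0.
rewrite /dom_corr exchange_big /=; apply: (@le_trans _ _ (\sum_(i < M) A (lag J s i) * G)).
  by apply: ler_sum => i _; rewrite -mulr_sumr ler_wpM2l// dominated_col.
by rewrite -mulr_suml expr2 ler_wpM2r// dominated_row.
Qed.

Variables (eps : R) (H : nat).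
Hypothesis tailA : forall s : seq int, uniq s -> all (fun j => (H < `|j|)%N) s ->
  \sum_(j <- s) A j <= eps.

Lemma dominated_sum_tail (s : seq nat) (phi : nat -> int) : injective phi -> uniq s ->
  \sum_(i <- s | (H < `|phi i|)%N) A (phi i) <= eps.
Proof.
move=> inj us; rewrite -big_filter -(big_map phi xpredT A).
apply: tailA; first by rewrite map_inj_uniq// filter_uniq.
by apply/allP => j /mapP[i]; rewrite mem_filter => /andP[h _] ->.
Qed.

(* If s and r are more than 2 H apart, each innovation is at a lag larger than H
   from s or from r. *)
Lemma dom_corr_far M J s x y (Pr : pred nat) :
  (forall r, Pr r -> (H.*2 < `|s%:Z - r%:Z|)%N) ->
  \sum_(x <= r < y | Pr r) dom_corr M J s r <= 2 * eps * G.
Proof.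
move=> far; have G0 := dominated_ge0.
have e0 : 0 <= eps by have := tailA (s := [::]) isT isT; rewrite big_nil.
pose fst i := (H < `|lag J s i|)%N%:R * A (lag J s i).
pose snd r i := (H < `|lag J r i|)%N%:R * A (lag J r i).
have f0 i : 0 <= fst i by rewrite mulr_ge0.
have s0 r i : 0 <= snd r i by rewrite mulr_ge0.
apply: (@le_trans _ _ (\sum_(i < M) fst i * (\sum_(x <= r < y | Pr r) A (lag J r i)) +
    \sum_(i < M) A (lag J s i) * (\sum_(x <= r < y | Pr r) snd r i))).
  rewrite /dom_corr exchange_big -big_split /=; apply: ler_sum => i _.
  rewrite !mulr_sumr -big_split /=; apply: ler_sum => r /far hr.
  rewrite /fst /snd; have := A0 (lag J s i); have := A0 (lag J r i) => a1 a2.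
  have p0 : 0 <= A (lag J s i) * A (lag J r i) by rewrite mulr_ge0.
  have : (H < `|lag J s i|)%N || (H < `|lag J r i|)%N.
    by move: hr; rewrite /lag /noise_idx; lia.
  case: (H < `|lag J s i|)%N => /= [_|->]; last by rewrite mul0r mul0r add0r mul1r.
  by rewrite mul1r lerDl !mulr_ge0.
rewrite (_ : 2 * eps * G = eps * G + G * eps); last by ring.
apply: lerD.
  apply: (@le_trans _ _ (\sum_(i < M) fst i * G)).
    by apply: ler_sum => i _; rewrite ler_wpM2l// dominated_col.
  rewrite -mulr_suml ler_wpM2r// (sum_ordE M fst) /fst.
  under eq_bigr do rewrite mulr_natl mulrb.
  by rewrite -big_mkcond; apply: dominated_sum_tail; [exact: lag_injl|exact: iota_uniq].
apply: (@le_trans _ _ (\sum_(i < M) A (lag J s i) * eps)).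
  apply: ler_sum => i _; rewrite ler_wpM2l//.
  apply: (@le_trans _ _ (\sum_(x <= r < y) snd r i)).
    by rewrite [leRHS](bigID Pr) /= lerDl sumr_ge0.
  rewrite /snd; under eq_bigr do rewrite mulr_natl mulrb.
  rewrite -big_mkcond; apply: (@dominated_sum_tail _ (fun s => lag J s i)).
    exact: lag_injr.
  exact: iota_uniq.
by rewrite -mulr_suml ler_wpM2r// dominated_row.
Qed.

End Dominated.

Section SegOf.
Variables (K N : nat) (t0 : nat -> nat).
Hypothesis t00 : t0 0 = 0%N.
Hypothesis t0N : t0 K.+1 = N.
Hypothesis t0S : forall k, (k <= K)%N -> (t0 k <= t0 k.+1)%N.

(** Indices s >= N lie in no segment; they get the default value [ord0]. *)
Definition seg_of (s : nat) : 'I_K.+1 := odflt ord0 [pick l : 'I_K.+1 | (t0 l <= s < t0 l.+1)%N].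

Lemma seg_ofE s (l : 'I_K.+1) : (s < N)%N -> (seg_of s == l) = (t0 l <= s < t0 l.+1)%N.
Proof.
move=> sN; have uni (i j : 'I_K.+1) : (t0 i <= s < t0 i.+1)%N -> (t0 j <= s < t0 j.+1)%N -> i = j.
  move=> /andP[i1 i2] /andP[j1 j2]; apply: val_inj => /=; apply/eqP; rewrite eqn_leq.
  apply/andP; split; rewrite leqNgt; apply/negP => ij.
    have := t0_mono t0S (i := j.+1) (j := i); rewrite ij ltnW ?ltn_ord// => /(_ isT) h.
    by have := leq_trans j2 (leq_trans h i1); rewrite ltnn.
  have := t0_mono t0S (i := i.+1) (j := j); rewrite ij ltnW ?ltn_ord// => /(_ isT) h.
  by have := leq_trans i2 (leq_trans h j1); rewrite ltnn.
rewrite /seg_of; case: pickP => [i hi|no] /=.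
  by apply/eqP/idP => [<- //|hl]; exact: uni.
have := seg_unique t00 t0N t0S sN; rewrite big1// => i _; by rewrite no.
Qed.

Lemma sum_seg_of (V : nmodType) (F : nat -> V) (l : 'I_K.+1) x y : (y <= N)%N ->
  (\sum_(x <= s < y | seg_of s == l) F s =
   \sum_(maxn x (t0 l) <= s < minn y (t0 l.+1)) F s)%R.
Proof.
move=> yN; rewrite (big_nat_widenl _ 0)//.
rewrite [RHS](big_nat_widenl _ 0)// [RHS](big_nat_widen _ _ y) ?geq_minl//.
rewrite big_nat_cond [RHS]big_nat_cond; apply: eq_bigl => s.
have [sy|] := ltnP s y; last by rewrite andbF.
by rewrite (seg_ofE l (leq_trans sy yN)); lia.
Qed.

Lemma seg_countE (l : 'I_K.+1) x y : (y <= N)%N ->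
  seg_count t0 l x y = (minn y (t0 l.+1) - maxn x (t0 l))%N.
Proof.
move=> yN; transitivity (\sum_(x <= s < y | seg_of s == l) 1)%N.
  rewrite /seg_count [RHS]big_mkcond big_nat [RHS]big_nat; apply: eq_bigr => s /andP[_ sy].
  by rewrite (seg_ofE l (leq_trans sy yN)); case: (_ <= _ < _)%N.
have := @sum_seg_of nat (fun=> 1%N) l x y yN.
by rewrite sum_nat_const_nat muln1 => <-.
Qed.

End SegOf.

(** Rewrites the sum over lags as a sum over innovations numbered independently of s. Numbers below
    N + 2 J + 1 cover the innovations from -J to N + J, all that the times 1, ..., N involve. *)
Lemma zsum_lag {R : realType} (F : int -> R) N J s : (s < N)%N ->
  zsum F J = \sum_(i < N + J.*2.+1) (if (`|lag J s i| <= J)%N then F (lag J s i) else 0).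
Proof.
move=> sN; rewrite zsumE (sum_ordE (N + J.*2.+1) (fun i => if (`|lag J s i| <= J)%N then F (lag J s i) else 0)).
rewrite -big_mkcond -big_filter /= -(big_map (lag J s) xpredT F); apply: perm_big; apply: uniq_perm.
- exact: zseq_uniq.
- by rewrite map_inj_uniq ?filter_uniq ?iota_uniq//; exact: lag_injl.
move=> j; rewrite mem_zseq; apply/idP/mapP => [jJ|[i]]; last first.
  by rewrite mem_filter => /andP[h _] ->.
exists (absz (s.+1%:Z - j + J%:Z)); last by rewrite /lag /noise_idx; lia.
by rewrite mem_filter mem_iota /lag /noise_idx; lia.
Qed.

(** * Bias of the truncated covariances *)

Section Bias.
Context {R : realType}.
Variables (K N : nat) (t0 : nat -> nat).
Hypothesis t00 : t0 0 = 0%N.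
Hypothesis t0N : t0 K.+1 = N.
Hypothesis t0S : forall k, (k <= K)%N -> (t0 k <= t0 k.+1)%N.
Variables (c : 'I_K.+1 -> int -> R) (f : 'I_K.+1 -> R -> R) (A : int -> R) (G : R).
Hypothesis cA : forall l j, `|c l j| <= A j.
Hypothesis hG : forall s : seq int, uniq s -> \sum_(j <- s) A j <= G.
Local Notation seg := (seg_of K t0).
Local Notation M J := (N + J.*2.+1)%N.

Let A0 j : 0 <= A j.
Proof. exact: le_trans (cA ord0 j). Qed.

Definition trunc_coef J s i : R :=
  if (`|lag J s i| <= J)%N then c (seg s) (lag J s i) else 0.

Definition trunc_cov J s r : R := \sum_(i < M J) trunc_coef J s i * trunc_coef J r i.

Lemma trunc_coef_le J s i : `|trunc_coef J s i| <= A (lag J s i).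
Proof. by rewrite /trunc_coef; case: ifP => // _; rewrite normr0. Qed.

Lemma trunc_cov_le J s r : `|trunc_cov J s r| <= dom_corr A (M J) J s r.
Proof.
apply: le_trans (ler_norm_sum _ _ _) _; apply: ler_sum => i _.
by rewrite normrM ler_pM// trunc_coef_le.
Qed.

Definition cov_term u J s r : R := cos ((s%:Z - r%:Z)%:~R * u) * trunc_cov J s r.

Lemma cov_term_le u J s r : `|cov_term u J s r| <= dom_corr A (M J) J s r.
Proof.
rewrite normrM -[leRHS]mul1r ler_pM//; last exact: trunc_cov_le.
by rewrite ler_norml cos_geN1 cos_le1.
Qed.

Variables (u eps1 L t : R) (J : nat).
Hypothesis t_gt0 : 0 < t.
Hypothesis L0 : 0 <= L.
Hypothesis eps10 : 0 <= eps1.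
Hypothesis approx : forall l v, v \in `[- pi, pi] ->
  `|zsum (fun j => c l j * cos (j%:~R * v)) J ^+ 2 +
    zsum (fun j => c l j * sin (j%:~R * v)) J ^+ 2 - f l u| <=
  eps1 + L * (t * (1 - cos (u - v)) + t^-1).

(** The times of ]x, y] in the l-th segment form a block on which the coefficients depend on the lag
    only, so [fejer_bias] applies; an empty block is treated apart. *)
Lemma bias_block (l : 'I_K.+1) x y : (y <= N)%N ->
  `|\sum_(x <= s < y | seg s == l) \sum_(x <= r < y | seg r == l) cov_term u J s r -
    (seg_count t0 l x y)%:R * f l u| <=
  (seg_count t0 l x y)%:R * eps1 + L * (t + (seg_count t0 l x y)%:R / t).
Proof.
move=> yN; rewrite (seg_countE t00 t0N t0S l x yN) (sum_seg_of t00 t0N t0S _ l x yN).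
under eq_bigr do rewrite (sum_seg_of t00 t0N t0S _ l x yN).
set b := maxn _ _; set e := minn _ _.
have [be|eb] := ltnP b e; last first.
  rewrite (eqP (_ : (e - b)%N == 0%N)) ?subn_eq0// big_geq// !mul0r subrr normr0 add0r addr0.
  by rewrite mulr_ge0// ltW.
pose C v := zsum (fun j => c l j * cos (j%:~R * v)) J.
pose S v := zsum (fun j => c l j * sin (j%:~R * v)) J.
pose p i : int := noise_idx J i - 1.
have segl s : (b <= s < e)%N -> (s < N)%N /\ seg s = l.
  move=> bse; have sN : (s < N)%N by move: bse; rewrite /b /e; lia.
  split => //; apply/eqP; rewrite (seg_ofE t00 t0N t0S l sN).
  by move: bse; rewrite /b /e; lia.
have lagE s i : s%:Z - p i = lag J s i by rewrite /p /lag; lia.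
apply: (@fejer_bias _ b e (M J) (trunc_coef J) p C S) => //.
- by rewrite /p /noise_idx => i j; lia.
- move=> s v /segl[sN sl]; rewrite /C (zsum_lag _ J sN); apply: eq_bigr => i _.
  by rewrite lagE /trunc_coef sl; case: ifP => // _; rewrite mul0r.
- move=> s v /segl[sN sl]; rewrite /S (zsum_lag _ J sN); apply: eq_bigr => i _.
  by rewrite lagE /trunc_coef sl; case: ifP => // _; rewrite mul0r.
- apply: continuousR_sum => j; apply: continuousRZ.
  by under eq_fun do rewrite -[_ * _]addr0; exact: continuous_cos_lin.
- apply: continuousR_sum => j; apply: continuousRZ.
  by under eq_fun do rewrite -[_ * _]addr0; exact: continuous_sin_lin.
- by move=> v vI; exact: approx.
Qed.

Variables (eps : R) (H : nat).
Hypothesis tailA : forall s : seq int, uniq s -> all (fun j => (H < `|j|)%N) s ->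
  \sum_(j <- s) A j <= eps.

Lemma count_near (b h x y : nat) :
  \sum_(x <= s < y) ((b <= s + h) && (s <= b + h))%N%:R <= h.*2.+1%:R :> R.
Proof.
rewrite -natr_sum ler_nat.
rewrite (eq_bigr (fun s => if (b <= s + h) && (s <= b + h) then 1 else 0)%N); last first.
  by move=> s _; case: (_ && _).
rewrite -big_mkcond sum1_count -size_filter.
rewrite -[leqRHS](size_iota (b - h)); apply: uniq_leq_size.
  by rewrite filter_uniq// iota_uniq.
by move=> s; rewrite mem_filter mem_iota => /andP[/andP[h1 h2] _]; lia.
Qed.

Let G0 : 0 <= G.
Proof. by have := hG (s := [::]) isT; rewrite big_nil. Qed.

Let e0 : 0 <= eps.
Proof. by have := tailA (s := [::]) isT isT; rewrite big_nil. Qed.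

Local Notation near s l := ((t0 l <= s + H.*2.+1) && (s <= t0 l + H.*2.+1))%N.

(** If s is more than 2 H + 1 away from all ends of segments, the times of other segments are more
    than 2 H away and [dom_corr_far] applies. Otherwise the whole row is bounded by G^2; this
    happens for boundedly many s. *)
Lemma off_row s x y : (s < N)%N -> (y <= N)%N ->
  \sum_(x <= r < y | seg s != seg r) dom_corr A (M J) J s r <=
  2 * eps * G + G ^+ 2 * \sum_(l < K.+2) (near s l)%:R.
Proof.
move=> sN yN.
have [/existsP[l hl]|/existsPn no] := boolP [exists l : 'I_K.+2, near s l].
  apply: (@le_trans _ _ (G ^+ 2)); first exact: dom_corr_row.
  rewrite -[leLHS]add0r lerD ?mulr_ge0//.
  rewrite -[leLHS]mulr1 ler_wpM2l ?sqr_ge0//.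
  by rewrite (bigD1 l)//= hl lerDl sumr_ge0.
apply: (@le_trans _ _ (2 * eps * G)); last first.
  by rewrite lerDl mulr_ge0 ?sqr_ge0// sumr_ge0.
rewrite big_nat_cond; apply: (dom_corr_far A0 hG tailA) => r.
move=> /andP[/andP[_ ry] sr].
have rN := leq_trans ry yN.
have := seg_ofE t00 t0N t0S (seg s) sN; rewrite eqxx => /esym s1.
have /negbTE r1 := sr; rewrite eq_sym (seg_ofE t00 t0N t0S (seg s) rN) in r1.
have n1 := no (widen_ord (leqnSn K.+1) (seg s)); have n2 := no (lift ord0 (seg s)).
move: s1 r1 n1 n2; rewrite /= /bump /= add1n; lia.
Qed.

(* Two times of different segments cannot both lie in the k-th one, and their
   interaction is small unless one of them is near a change point. *)
Lemma off_total (k : 'I_K.+1) x y : (y <= N)%N ->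
  \sum_(x <= s < y) \sum_(x <= r < y | seg s != seg r) dom_corr A (M J) J s r <=
  2 * (2 * eps * G * \sum_(l < K.+1 | l != k) (seg_count t0 l x y)%:R +
       G ^+ 2 * (K.+2%:R * (H.*2.+1).*2.+1%:R)).
Proof.
move=> yN.
pose D s r : R := (seg s != seg r)%:R * dom_corr A (M J) J s r.
have D0 s r : 0 <= D s r by rewrite mulr_ge0// dom_corr_ge0.
have DC s r : D s r = D r s by rewrite /D dom_corrC eq_sym.
have DE s : \sum_(x <= r < y | seg s != seg r) dom_corr A (M J) J s r = \sum_(x <= r < y) D s r.
  by rewrite big_mkcond; apply: eq_bigr => r _; rewrite /D; case: ifP => _; rewrite ?mul1r ?mul0r.
under eq_bigr do rewrite DE.
apply: (@le_trans _ _ (2 * \sum_(x <= s < y) (seg s != k)%:R * \sum_(x <= r < y) D s r)).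
  rewrite mulr_natl mulr2n; set Z := \sum_(x <= s < y) (seg s != k)%:R * _.
  have -> : Z + Z = \sum_(x <= s < y) \sum_(x <= r < y)
      ((seg s != k)%:R * D s r + (seg r != k)%:R * D s r).
    under [RHS]eq_bigr do rewrite big_split /=.
    rewrite big_split /=; congr (_ + _); first by apply: eq_bigr => s _; rewrite mulr_sumr.
    rewrite exchange_big /=; apply: eq_bigr => s _; rewrite mulr_sumr.
    by apply: eq_bigr => r _; rewrite DC.
  apply: ler_sum => s _; apply: ler_sum => r _.
  have [E|E] := eqVneq (seg s) (seg r); first by rewrite /D E eqxx /= !mul0r !mulr0 addr0.
  rewrite -mulrDl -[leLHS]mul1r ler_wpM2r// -natrD ler1n.
  case: (eqVneq (seg s) k) => // e1; case: (eqVneq (seg r) k) => // e2.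
  by rewrite e1 e2 eqxx in E.
rewrite ler_wpM2l//.
apply: (@le_trans _ _ (\sum_(x <= s < y) ((seg s != k)%:R * (2 * eps * G) +
   G ^+ 2 * \sum_(l < K.+2) (near s l)%:R))).
  rewrite big_nat [leRHS]big_nat; apply: ler_sum => s /andP[_ sy].
  rewrite -DE; have h := off_row x (leq_trans sy yN) yN.
  have G2 : 0 <= G ^+ 2 * \sum_(l < K.+2) (near s l)%:R by rewrite mulr_ge0 ?sqr_ge0// sumr_ge0.
  by case: (seg s != k) => /=; rewrite ?mul1r ?mul0r ?add0r.
rewrite big_split /= -mulr_suml -mulr_sumr; apply: lerD.
  rewrite mulrC ler_wpM2l ?mulr_ge0//.
  have -> : \sum_(l < K.+1 | l != k) (seg_count t0 l x y)%:R =
     \sum_(l < K.+1 | l != k) \sum_(x <= s < y | seg s == l) (1 : R).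
    apply: eq_bigr => l _; rewrite (sum_seg_of t00 t0N t0S _ l x yN) sumr_const_nat.
    by rewrite -(seg_countE t00 t0N t0S l x yN).
  rewrite le_eqVlt; apply/orP; left; apply/eqP.
  transitivity (\sum_(x <= s < y | seg s != k) (1 : R)).
    by rewrite [RHS]big_mkcond; apply: eq_bigr => s _; case: (seg s != k).
  rewrite (partition_big seg (fun l => l != k)) //=; apply: eq_bigr => l lk.
  by apply: eq_bigl => s; have [->|] := eqVneq (seg s) l; rewrite ?lk ?andbF.
rewrite ler_wpM2l ?sqr_ge0// exchange_big /=.
have -> : K.+2%:R * (H.*2.+1).*2.+1%:R = \sum_(l < K.+2) (H.*2.+1).*2.+1%:R :> R.
  by rewrite sumr_const card_ord mulr_natl.
by apply: ler_sum => l _; exact: count_near.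
Qed.

Lemma cov_bias (k : 'I_K.+1) x y : (y <= N)%N ->
  `|\sum_(x <= s < y) \sum_(x <= r < y) cov_term u J s r -
    \sum_(l < K.+1) (seg_count t0 l x y)%:R * f l u| <=
  N%:R * eps1 + L * (K.+1%:R * t + N%:R / t) +
  2 * (2 * eps * G * \sum_(l < K.+1 | l != k) (seg_count t0 l x y)%:R +
       G ^+ 2 * (K.+2%:R * (H.*2.+1).*2.+1%:R)).
Proof.
move=> yN.
have -> : \sum_(x <= s < y) \sum_(x <= r < y) cov_term u J s r =
  \sum_(l < K.+1) \sum_(x <= s < y | seg s == l) \sum_(x <= r < y | seg r == l) cov_term u J s r +
  \sum_(x <= s < y) \sum_(x <= r < y | seg s != seg r) cov_term u J s r.
  have -> : \sum_(l < K.+1) \sum_(x <= s < y | seg s == l) \sum_(x <= r < y | seg r == l) cov_term u J s r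
    = \sum_(x <= s < y) \sum_(x <= r < y | seg r == seg s) cov_term u J s r.
    rewrite [RHS](partition_big seg xpredT) //=; apply: eq_bigr => l _.
    by apply: eq_bigr => s /eqP ->.
  rewrite -big_split /=; apply: eq_bigr => s _; rewrite (bigID (fun r => seg r == seg s)) /=.
  by congr (_ + _); apply: eq_bigl => r; rewrite eq_sym.
rewrite addrAC -sumrB; apply: le_trans (ler_normD _ _) _; apply: lerD; last first.
  apply: le_trans (off_total k x yN).
  apply: le_trans (ler_norm_sum _ _ _) _; apply: ler_sum => s _.
  by apply: le_trans (ler_norm_sum _ _ _) _; apply: ler_sum => r _; exact: cov_term_le.
apply: le_trans (ler_norm_sum _ _ _) _.
apply: (@le_trans _ _ (\sum_(l < K.+1) ((seg_count t0 l x y)%:R * eps1 +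
    L * (t + (seg_count t0 l x y)%:R / t)))).
  by apply: ler_sum => l _; exact: bias_block.
have cN : \sum_(l < K.+1) (seg_count t0 l x y)%:R <= N%:R :> R.
  by rewrite -natr_sum ler_nat (seg_count_total t00 t0N t0S)// (leq_trans (leq_subr _ _)).
rewrite big_split /= -mulr_suml -mulr_sumr; apply: lerD; first by rewrite ler_wpM2r.
rewrite ler_wpM2l// big_split /= sumr_const card_ord mulr_natl -mulr_suml.
by rewrite lerD2l ler_wpM2r// invr_ge0 ltW.
Qed.

End Bias.

(** * Deviations of the spectral estimator *)

Section KernelForm.
Context {R : realType}.
Local Notation mu := (@lebesgue_measure R).
Local Notation integrableI phi := (mu.-integrable `[(- pi)%R, pi%R] (EFin \o phi)).
Variable phi : R -> R.
Hypothesis phiI : integrableI phi.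

Lemma pint_mulD (g h : R -> R) : continuous g -> continuous h ->
  pint (fun u => phi u * (g u + h u)) = pint (fun u => phi u * g u) + pint (fun u => phi u * h u).
Proof.
move=> cg ch; rewrite /pint -RintegralD//; first by apply: eq_Rintegral => u _; rewrite mulrDr.
  exact: integrable_mul_continuous.
exact: integrable_mul_continuous.
Qed.

Lemma pint_mulZ (c : R) (g : R -> R) : continuous g ->
  pint (fun u => phi u * (c * g u)) = c * pint (fun u => phi u * g u).
Proof.
move=> cg; rewrite /pint -RintegralZl//; last exact: integrable_mul_continuous.
by apply: eq_Rintegral => u _; rewrite mulrCA.
Qed.

Lemma pint_mul_sum (J : Type) (s : seq J) (g : J -> R -> R) : (forall j, continuous (g j)) ->
  pint (fun u => phi u * \sum_(j <- s) g j u) = \sum_(j <- s) pint (fun u => phi u * g j u).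
Proof.
move=> cg; elim: s => [|j s IH].
  rewrite big_nil (_ : (fun u => _) = (fun u => phi u * (0 * 1))).
    by rewrite pint_mulZ ?mul0r//; exact: cst_continuous.
  by apply/funext => u; rewrite big_nil mul0r.
rewrite big_cons -IH -pint_mulD//; last exact: continuousR_sum.
by congr pint; apply/funext => u; rewrite big_cons.
Qed.

Lemma pint_mul_sum2 (c : nat -> nat -> R) (x y : nat) :
  pint (fun u => phi u * \sum_(x <= s < y) \sum_(x <= r < y) cos ((s%:Z - r%:Z)%:~R * u) * c s r) =
  \sum_(x <= s < y) \sum_(x <= r < y) pint (fun u => phi u * cos ((s%:Z - r%:Z)%:~R * u)) * c s r.
Proof.
have cc (n : int) : continuous (fun u : R => cos (n%:~R * u)).
  by under eq_fun do rewrite -[_ * _]addr0; exact: continuous_cos_lin.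
have cc1 (n : int) (z : R) : continuous (fun u : R => cos (n%:~R * u) * z).
  by move=> u; under eq_fun do rewrite mulrC; exact: continuousRZ.
rewrite pint_mul_sum; last by move=> s; exact: continuousR_sum.
apply: eq_bigr => s _; rewrite pint_mul_sum//; apply: eq_bigr => r _.
rewrite [RHS]mulrC -pint_mulZ//; congr pint; apply/funext => u; congr (_ * _).
by rewrite mulrC.
Qed.

Lemma pint_mul_le (g h : R -> R) : (forall u, 0 <= phi u) -> continuous g -> continuous h ->
  (forall u, u \in `[- pi, pi] -> g u <= h u) ->
  pint (fun u => phi u * g u) <= pint (fun u => phi u * h u).
Proof.
move=> phi0 cg ch gh; apply: le_Rintegral => //.
- exact: integrable_mul_continuous.
- exact: integrable_mul_continuous.
- by move=> u uI; rewrite ler_wpM2l// gh.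
Qed.

Lemma pint_mul_norm (g : R -> R) (c z e b l : R) : (forall u, 0 <= phi u) -> continuous g ->
  pint phi <= 1 -> pint (fun u => phi u * `|u - l|) <= z -> 0 <= b -> 0 <= e ->
  (forall u, u \in `[- pi, pi] -> `|g u - c| <= e + b * `|u - l|) ->
  `|pint (fun u => phi u * g u) - pint phi * c| <= e + b * z.
Proof.
move=> phi0 cg p1 pz b0 e0 hg.
have ce (k : R) : continuous (fun _ : R => k) by exact: cst_continuous.
have cn : continuous (fun u => `|u - l|).
  move=> u; apply: cvg_norm; apply: cvgB; [exact: cvg_id|exact: cvg_cst].
have pe (k : R) : pint (fun u => phi u * k) = pint phi * k.
  by have := @pint_mulZ k (fun=> 1) (ce 1); under [X in pint X = _ -> _]eq_fun do rewrite mulr1;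
     move=> ->; rewrite mulrC; congr (_ * _); congr pint; apply/funext => u; rewrite mulr1.
have cen : continuous (fun u => e + b * `|u - l|) by apply: continuousRD => //; exact: continuousRZ.
have h1 : pint (fun u => phi u * (e + b * `|u - l|)) <= e + b * z.
  rewrite pint_mulD//; last exact: continuousRZ.
  rewrite pint_mulZ// pe; apply: lerD; last by rewrite ler_wpM2l.
  by rewrite -[leRHS]mul1r ler_wpM2r.
rewrite -pe ler_norml; apply/andP; split.
  rewrite lerNl opprB; apply: le_trans h1.
  have -> : pint (fun u => phi u * c) - pint (fun u => phi u * g u) = pint (fun u => phi u * (c + -1 * g u)).
    rewrite pint_mulD//; last exact: continuousRZ.
    by rewrite pint_mulZ//; lra.
  apply: pint_mul_le => //; first by apply: continuousRD => //; exact: continuousRZ.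
  by move=> u /hg; rewrite ler_norml => /andP[]; lra.
apply: le_trans h1.
have -> : pint (fun u => phi u * g u) - pint (fun u => phi u * c) = pint (fun u => phi u * (g u + -1 * c)).
  by rewrite pint_mulD// pint_mulZ//; lra.
apply: pint_mul_le => //; first by apply: continuousRD.
by move=> u /hg; rewrite ler_norml => /andP[]; lra.
Qed.

Definition kcoef (s r : nat) : R := pint (fun u => phi u * cos ((s%:Z - r%:Z)%:~R * u)).

Lemma kcoefE s r : kcoef s r = pint (fun u => phi u * cos (`|s%:Z - r%:Z|%N%:R * u)).
Proof.
congr pint; apply/funext => u; congr (_ * _).
have [h|h] := leqP r s.
  by rewrite (_ : s%:Z - r%:Z = (absz (s%:Z - r%:Z))%:Z)// ; lia.
rewrite (_ : s%:Z - r%:Z = - (absz (s%:Z - r%:Z))%:Z); last by lia.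
by rewrite mulrNz mulNr cosN abszN absz_nat.
Qed.

(** The coefficients depend on |s - r| only. On each side of the diagonal a row meets a given
    difference at most once, so it is bounded by twice the sum of [bessel_cos]. *)
Lemma kcoef_sqr_sum (M : R) N x y : (forall u, 0 <= phi u <= M) -> pint phi <= 1 -> (y <= N)%N ->
  \sum_(x <= s < y) \sum_(x <= r < y) kcoef s r ^+ 2 <= N%:R * (2 * (2 * pi * M)).
Proof.
move=> phiM phi1 yN.
pose h k := (pint (fun u => phi u * cos (k%:R * u))) ^+ 2.
have hb : \sum_(i < N) h i <= 2 * pi * M by exact: bessel_cos.
have M0 : 0 <= M by have /andP[p1 p2] := phiM 0; exact: le_trans p2.
have row s : (x <= s < y)%N -> \sum_(x <= r < y) kcoef s r ^+ 2 <= 2 * (2 * pi * M).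
  move=> /andP[xs sy].
  have inj_le (b e : nat) (g : nat -> nat) : {in index_iota b e &, injective g} ->
      (forall r, (b <= r < e)%N -> (g r < N)%N) -> \sum_(b <= r < e) h (g r) <= 2 * pi * M.
    move=> inj gN; apply: le_trans hb.
    rewrite -(big_mkord xpredT h) -(big_map g xpredT h) /index_iota subn0.
    have -> : \sum_(j <- [seq g i | i <- iota b (e - b)]) h j =
        \sum_(j <- iota 0 N | j \in [seq g i | i <- iota b (e - b)]) h j.
      rewrite -[RHS]big_filter; apply: perm_big; apply: uniq_perm.
      - by rewrite map_inj_in_uniq ?iota_uniq.
      - by rewrite filter_uniq ?iota_uniq.
      move=> j; rewrite mem_filter mem_iota /= add0n; apply/idP/andP => [jm|[]//].
      split=> //; move: jm => /mapP[i]; rewrite mem_iota => hi ->; apply: gN; move: hi; lia.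
    by rewrite [leRHS](bigID (mem [seq g i | i <- iota b (e - b)])) /= lerDl sumr_ge0// => i _; exact: sqr_ge0.
  rewrite (big_cat_nat (n := s)) ?(ltnW sy)//= mulr_natl mulr2n; apply: lerD.
    under eq_bigr do rewrite kcoefE; apply: (inj_le _ _ (fun r => `|s%:Z - r%:Z|%N)).
      by move=> i j; rewrite !mem_index_iota; lia.
    by move=> r; lia.
  under eq_bigr do rewrite kcoefE; apply: (inj_le _ _ (fun r => `|s%:Z - r%:Z|%N)).
    by move=> i j; rewrite !mem_index_iota; lia.
  by move=> r; lia.
apply: (@le_trans _ _ (\sum_(x <= s < y) (2 * (2 * pi * M)))).
  by rewrite big_nat [leRHS]big_nat; apply: ler_sum => s; exact: row.
rewrite sumr_const_nat -[leLHS]mulr_natl; apply: ler_wpM2r; first by rewrite !mulr_ge0 ?pi_ge0.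
rewrite ler_nat.
exact: leq_trans (leq_subr _ _) yN.
Qed.

End KernelForm.

Section SpecEst.
Context {R : realType}.

Lemma periodogramE (x : nat -> R) (a b : nat) u : (a < b)%N ->
  (b - a)%:R * periodogram x a b u =
  \sum_(a <= s < b) \sum_(a <= r < b) cos ((s%:Z - r%:Z)%:~R * u) * (x s.+1 * x r.+1).
Proof.
move=> ab; have n0 : (b - a)%:R != 0 :> R by rewrite pnatr_eq0 subn_eq0 -ltnNge.
rewrite /periodogram mulrC divfK// !big_add1 /= !expr2 !big_distrlr /= -big_split /=.
apply: eq_bigr => s _; rewrite -big_split /=; apply: eq_bigr => r _.
have -> : (s%:Z - r%:Z)%:~R * u = s.+1%:R * u - r.+1%:R * u.
  by rewrite -!natr1 rmorphB /= -!pmulrn; ring.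
by rewrite cosB; ring.
Qed.

Lemma spec_estE (W : R -> R) (m : R) (x : nat -> R) (a b : nat) l : (a < b)%N -> m != 0 ->
  (@lebesgue_measure R).-integrable `[(- pi)%R, pi%R] (EFin \o kernel W m l) ->
  (b - a)%:R * spec_est W m x a b l =
  \sum_(a <= s < b) \sum_(a <= r < b) kcoef (kernel W m l) s r * (x s.+1 * x r.+1).
Proof.
move=> ab m0 ki; rewrite -(pint_mul_sum2 ki (fun s r => x s.+1 * x r.+1)).
set S := fun u => \sum_(a <= s < b) \sum_(a <= r < b) cos ((s%:Z - r%:Z)%:~R * u) * (x s.+1 * x r.+1).
have n0 : (b - a)%:R != 0 :> R by rewrite pnatr_eq0 subn_eq0 -ltnNge.
have cS : continuous S.
  apply: continuousR_sum => s; apply: continuousR_sum => r; under eq_fun do rewrite mulrC.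
  by apply: continuousRZ; under eq_fun do rewrite -[_ * _]addr0; exact: continuous_cos_lin.
have -> : spec_est W m x a b l = m * pint (fun u => kernel W m l u * ((m * (b - a)%:R)^-1 * S u)).
  congr (_ * _); congr pint; apply/funext => u; rewrite /S -periodogramE// /kernel.
  by move: ((b - a)%:R : R) n0 => z z0; field; rewrite m0 z0.
rewrite pint_mulZ// mulrA [_ * m]mulrC mulVKf ?mulf_neq0//.
Qed.

End SpecEst.

Section WeightedSums.
Context {R : realType}.

Lemma weighted_sum_sqr (s : seq nat) (v k : nat -> R) (G : R) : 0 < G ->
  (forall i, 0 <= v i) -> \sum_(i <- s) v i <= G ->
  (\sum_(i <- s) v i * k i) ^+ 2 <= G * \sum_(i <- s) v i * k i ^+ 2.
Proof.
move=> G0 v0 vG; set S := \sum_(i <- s) v i * k i; set Q := \sum_(i <- s) v i * k i ^+ 2.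
have : 0 <= \sum_(i <- s) v i * (G * k i - S) ^+ 2.
  by apply: sumr_ge0 => i _; rewrite mulr_ge0// sqr_ge0.
have -> : \sum_(i <- s) v i * (G * k i - S) ^+ 2 =
    G ^+ 2 * Q - 2 * G * S * S + S ^+ 2 * \sum_(i <- s) v i.
  have SE : S = \sum_(i <- s) v i * k i by [].
  rewrite -[X in _ = _ - _ * X + _]/S [X in _ = _ - _ * X + _]SE; clearbody S.
  rewrite /Q !mulr_sumr -sumrB -big_split /=; apply: eq_bigr => i _; ring.
move=> h; have h2 : S ^+ 2 * \sum_(i <- s) v i <= S ^+ 2 * G by rewrite ler_wpM2l ?sqr_ge0.
rewrite -(ler_pM2l G0).
have -> : G * (G * Q) = G ^+ 2 * Q by ring.
by move: h h2; rewrite expr2; lra.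
Qed.

(** A Schur test for the sum of the squared entries: Cauchy-Schwarz in s and then in r, each with
    weights of mass at most G, gives G^2; the sums over i and j of the remaining weights give G^2
    again. The bound depends neither on the truncation J nor on the number of innovations. *)
Lemma schur_sqr_sum (A : int -> R) (G : R) (beta k : nat -> nat -> R) J M x y : 0 < G ->
  (forall j, 0 <= A j) -> (forall s : seq int, uniq s -> \sum_(j <- s) A j <= G) ->
  (forall s i, `|beta s i| <= A (lag J s i)) ->
  \sum_(i < M) \sum_(j < M) (\sum_(x <= s < y) \sum_(x <= r < y) k s r * (beta s i * beta r j)) ^+ 2 <=
  G ^+ 4 * \sum_(x <= s < y) \sum_(x <= r < y) k s r ^+ 2.
Proof.
move=> G0 A0 hG hb.
pose a s i := A (lag J s i).
have a0 s i : 0 <= a s i by exact: A0.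
have col i : \sum_(x <= s < y) a s i <= G by exact: (dominated_col hG J i x y xpredT).
apply: (@le_trans _ _ (\sum_(i < M) \sum_(j < M) (G * (\sum_(x <= s < y) a s i *
   (G * (\sum_(x <= r < y) a r j * k s r ^+ 2)))))).
  apply: ler_sum => i _; apply: ler_sum => j _.
  apply: (@le_trans _ _ ((\sum_(x <= s < y) a s i * (\sum_(x <= r < y) a r j * `|k s r|)) ^+ 2)).
    rewrite -[leLHS]real_normK ?num_real// lerXn2r ?nnegrE//.
      by rewrite !sumr_ge0// => s _; rewrite mulr_ge0// sumr_ge0// => r _; rewrite mulr_ge0.
    apply: le_trans (ler_norm_sum _ _ _) _; apply: ler_sum => s _.
    apply: le_trans (ler_norm_sum _ _ _) _; rewrite mulr_sumr; apply: ler_sum => r _.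
    rewrite !normrM mulrC -mulrA; apply: ler_pM; [by []|by rewrite mulr_ge0|exact: hb|].
    by rewrite ler_wpM2r//; exact: hb.
  apply: le_trans (weighted_sum_sqr (fun s => \sum_(x <= r < y) a r j * `|k s r|) G0 (a0^~ i) (col i)) _.
  rewrite ler_wpM2l ?(ltW G0)//; apply: ler_sum => s _; rewrite ler_wpM2l//.
  apply: le_trans (weighted_sum_sqr (fun r => `|k s r|) G0 (a0^~ j) (col j)) _.
  by rewrite ler_wpM2l ?(ltW G0)//; apply: ler_sum => r _; rewrite real_normK ?num_real.
have E i : \sum_(j < M) (G * (\sum_(x <= s < y) a s i * (G * (\sum_(x <= r < y) a r j * k s r ^+ 2)))) =
   G ^+ 2 * \sum_(x <= s < y) a s i * (\sum_(x <= r < y) (\sum_(j < M) a r j) * k s r ^+ 2).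
  rewrite -mulr_sumr expr2 -mulrA; congr (_ * _); rewrite exchange_big mulr_sumr /=.
  apply: eq_bigr => s _; rewrite -mulr_sumr mulrCA; congr (_ * _).
  rewrite -mulr_sumr; congr (_ * _); rewrite exchange_big; apply: eq_bigr => r _.
  by rewrite mulr_suml.
under eq_bigr do rewrite E.
rewrite -mulr_sumr (_ : G ^+ 4 = G ^+ 2 * (G * G)); last by ring.
rewrite -[leRHS]mulrA ler_wpM2l ?sqr_ge0// exchange_big /= -mulrA mulr_sumr.
rewrite mulr_sumr; apply: ler_sum => s _; rewrite -mulr_suml; apply: ler_pM => //.
- by rewrite sumr_ge0.
- by rewrite sumr_ge0// => r _; rewrite mulr_ge0 ?sqr_ge0// sumr_ge0.
- exact: (dominated_row hG M J s).
rewrite mulr_sumr; apply: ler_sum => r _; rewrite ler_wpM2r ?sqr_ge0//.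
exact: (dominated_row hG M J r).
Qed.

End WeightedSums.

(** * Bounds on probabilities *)

Section ProbBounds.
Context {d : measure_display} {T : measurableType d} {R : realType}.
Variable P : probability T R.

Lemma markov_pow (Z : T -> R) (n : nat) (z M : R) : measurable_fun [set: T] Z -> 0 < z ->
  P.-integrable [set: T] (fun w => (Z w ^+ (2 * n))%:E) ->
  \int[P]_w (Z w ^+ (2 * n)) <= M ->
  (P [set w | (z < `|Z w|)%R] <= (M / z ^+ (2 * n))%:E)%E.
Proof.
move=> mZ z0 iZ hM.
have zn0 : 0 < z ^+ (2 * n) by rewrite exprn_gt0.
have mE : measurable [set w | (z < `|Z w|)%R].
  rewrite -[X in measurable X]setTI; apply: (@measurable_fun_ltr _ _ _ _ (cst z)) => //.
  exact: measurableT_comp.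
have Z0 w : 0 <= Z w ^+ (2 * n) by rewrite exprM exprn_ge0// sqr_ge0.
rewrite EFinM muleC lee_pdivlMl// muleC.
have : ((z ^+ (2 * n))%:E * P [set w | (z < `|Z w|)%R] <= \int[P]_w (Z w ^+ (2 * n))%:E)%E.
  rewrite -integral_cst//; apply: (@le_trans _ _ (\int[P]_(w in [set w | (z < `|Z w|)%R]) (Z w ^+ (2 * n))%:E)%E).
    apply: ge0_le_integral => //.
    - by move=> w _; rewrite lee_fin ltW.
    - apply: measurable_funS (measurable_int P iZ) => //.
    - move=> w /= zw; rewrite lee_fin !exprM lerXn2r ?nnegrE ?sqr_ge0//.
      by rewrite -[leRHS]real_normK ?num_real// lerXn2r ?nnegrE// ltW.
  by apply: ge0_subset_integral => //; [exact: (measurable_int P iZ)|move=> w _; rewrite lee_fin].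
rewrite muleC => h; apply: le_trans h _.
by rewrite -[X in (X <= _)%E]fineK ?lee_fin//; exact: integrable_fin_num.
Qed.

(** Up to a null set, [F] lies in the lower limit of the [E n], an increasing union of intersections
    of probability at most c. It carries bounds over from the truncations to the observations with
    almost sure convergence alone. *)
Lemma probability_liminf_le (E : nat -> set T) (F : set T) (c : \bar R) (n0 : nat) :
  measurable F -> (forall n, measurable (E n)) -> (forall n, (n0 <= n)%N -> (P (E n) <= c)%E) ->
  {ae P, forall w, F w -> \forall n \near \oo, E n w} -> (P F <= c)%E.
Proof.
move=> mF mE hE aeF.
pose U n := \bigcap_(j in [set j | (n <= j)%N]) E j.
have mU n : measurable (U n) by exact: bigcap_measurableType.
have mUU : measurable (\bigcup_n U n) by exact: bigcup_measurable.
have PU : (P (\bigcup_n U n) <= c)%E.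
  have cv := @nondecreasing_cvg_mu _ _ _ P U mU mUU.
  have nd : {homo U : n m / (n <= m)%N >-> (n <= m)%O}.
    by move=> n m nm; apply/subsetPset => w h j /= mj; apply: h => /=; exact: leq_trans mj.
  move/(_ nd): cv => cv; rewrite -(cvg_lim _ cv)//; apply: lime_le; first by apply/cvg_ex; eexists; exact: cv.
  near=> n; apply: le_trans (hE n _); last by near: n; exact: nbhs_infty_ge.
  by apply: le_measure; rewrite ?inE//; apply: bigcap_inf => /=.
case: aeF => D [mD D0 sub].
apply: (@le_trans _ _ (P (\bigcup_n U n `|` D))).
  apply: le_measure; rewrite ?inE//; first exact: measurableU.
  move=> w Fw; have [Dw|nD] := pselect (D w); [by right|left].
  have : F w -> \forall n \near \oo, E n w by apply: contrapT => h; apply: nD; exact: sub.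
  move=> /(_ Fw) [n _ hn]; exists n => // j /= nj; exact: hn.
apply: (@le_trans _ _ (P (\bigcup_n U n) + P D)%E); first exact: measureU2.
by rewrite D0 adde0.
Unshelve. all: by end_near. Qed.

Lemma probability_bigcup_seq (I : eqType) (s : seq I) (F : I -> set T) (c : R) :
  (forall i, measurable (F i)) -> (forall i, i \in s -> (P (F i) <= c%:E)%E) ->
  (P (\bigcup_(i in [set` s]) F i) <= ((size s)%:R * c)%:E)%E.
Proof.
move=> mF; elim: s => [|i s IH] hs; first by rewrite set_nil bigcup_set0 measure0 mul0r.
have -> : \bigcup_(j in [set` i :: s]) F j = F i `|` \bigcup_(j in [set` s]) F j.
  apply/seteqP; split=> w /=.
    by move=> [j /=]; rewrite in_cons => /predU1P[->|js] Fj; [left|right; exists j].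
  by move=> [Fi|[j js Fj]]; [exists i; rewrite //= mem_head|exists j; rewrite //= in_cons js orbT].
apply: (@le_trans _ _ (P (F i) + P (\bigcup_(j in [set` s]) F j))%E).
  by apply: measureU2 => //; apply: fin_bigcup_measurable => //; exact: finite_seq.
rewrite /= -natr1 mulrDl mul1r [X in (_ <= X%:E)%E]addrC EFinD; apply: leeD; first by apply: hs; rewrite mem_head.
by apply: IH => j js; apply: hs; rewrite in_cons js orbT.
Qed.

End ProbBounds.

(** * Deviation of a quadratic statistic of the observations *)

Section Deviation.
Context {d : measure_display} {T : measurableType d} {R : realType}.
Variable P : probability T R.
Variables (xi : int -> T -> R) (sigma mu : R) (q : nat).
Hypothesis q0 : (0 < q)%N.
Hypothesis mxi : forall t, measurable_fun [set: T] (xi t).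
Hypothesis indep : mutually_independent P xi.
Hypothesis momxi : forall i, P.-integrable [set: T] (fun w => (`|xi i w| ^+ (4 * q))%:E).
Hypothesis meanxi : forall i, \int[P]_w xi i w = 0.
Hypothesis varxi : forall i, \int[P]_w (xi i w ^+ 2) = sigma ^+ 2.
Hypothesis mu1 : 1 <= mu.
Hypothesis mu2 : forall i, \int[P]_w (xi i w ^+ (2 * q)) <= mu.
Hypothesis mu4 : forall i, \int[P]_w (xi i w ^+ (4 * q)) <= mu.
Hypothesis sgmu : (sigma ^+ 2) ^+ (2 * q) <= mu.
Variables (K N : nat) (t0 : nat -> nat).
Hypothesis t00 : t0 0 = 0%N.
Hypothesis t0N : t0 K.+1 = N.
Hypothesis t0S : forall k, (k <= K)%N -> (t0 k <= t0 k.+1)%N.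
Variables (a : 'I_K.+1 -> int -> R) (X : nat -> T -> R).
Hypothesis mX : forall t, measurable_fun [set: T] (X t).
Hypothesis hX : forall (k : 'I_K.+1) t, (t0 k < t <= t0 k.+1)%N ->
  {ae P, forall w, zsum (fun j => a k j * xi (t%:Z - j) w) @ \oo --> X t w}.
Variables (A : int -> R) (G : R).
Hypothesis G0 : 0 < G.
Hypothesis aA : forall l j, `|a l j| <= A j.
Hypothesis hG : forall s : seq int, uniq s -> \sum_(j <- s) A j <= G.
Variables (k : nat -> nat -> R) (x y : nat).
Hypothesis yN : (y <= N)%N.
Local Notation seg := (seg_of K t0).
Local Notation M J := (N + J.*2.+1)%N.
Local Notation beta J := (trunc_coef t0 a J).

Let A0 j : 0 <= A j.
Proof. exact: le_trans (aA ord0 j). Qed.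

Definition trunc_obs J s w := \sum_(i < M J) beta J s i * xi (noise_idx J i) w.

Definition stat w := \sum_(x <= s < y) \sum_(x <= r < y) k s r * (X s.+1 w * X r.+1 w).

Definition trunc_mean J :=
  \sum_(x <= s < y) \sum_(x <= r < y) k s r * (sigma ^+ 2 * trunc_cov N t0 a J s r).

Definition trunc_mx J i j :=
  \sum_(x <= s < y) \sum_(x <= r < y) k s r * (beta J s i * beta J r j).

Lemma trunc_obs_zsum J s w : (s < N)%N ->
  trunc_obs J s w = zsum (fun j => a (seg s) j * xi (s.+1%:Z - j) w) J.
Proof.
move=> sN; rewrite (zsum_lag _ J sN); apply: eq_bigr => i _.
rewrite /trunc_coef; case: ifP => _; last by rewrite mul0r.
by congr (_ * xi _ _); rewrite /lag; lia.
Qed.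

Lemma trunc_obs_cvg : {ae P, forall w, forall s : 'I_N, trunc_obs J s w @[J --> \oo] --> X s.+1 w}.
Proof.
apply: filter_forall => s.
have sN := ltn_ord s; have := seg_ofE t00 t0N t0S (seg s) sN; rewrite eqxx => /esym hs.
have := hX (k := seg s) (t := s.+1); rewrite ltnS => /(_ hs).
apply: filterS => w; apply: cvg_trans; apply: near_eq_cvg; apply: nearW => J.
by rewrite trunc_obs_zsum.
Qed.

Lemma trunc_statE J w :
  \sum_(x <= s < y) \sum_(x <= r < y) k s r * (trunc_obs J s w * trunc_obs J r w) =
  quadform xi (sigma ^+ 2) (noise_idx J) (trunc_mx J) (M J) w + trunc_mean J.
Proof.
apply/eqP; rewrite -subr_eq; apply/eqP.
pose Z i j := xi (noise_idx J i) w * xi (noise_idx J j) w - (i == j :> nat)%:R * sigma ^+ 2.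
have E s r : trunc_obs J s w * trunc_obs J r w - sigma ^+ 2 * trunc_cov N t0 a J s r =
    \sum_(i < M J) \sum_(j < M J) beta J s i * beta J r j * Z i j.
  rewrite /trunc_obs big_distrlr /= /trunc_cov mulr_sumr -sumrB; apply: eq_bigr => i _.
  have -> : sigma ^+ 2 * (beta J s i * beta J r i) =
      \sum_(j < M J) beta J s i * beta J r j * ((i == j :> nat)%:R * sigma ^+ 2).
    rewrite (bigD1 i)//= eqxx mul1r big1 ?addr0; first by rewrite mulrC.
    by move=> j ji; rewrite eq_sym -val_eqE /= in ji; rewrite (negbTE ji) mul0r mulr0.
  by rewrite -sumrB; apply: eq_bigr => j _; rewrite /Z; ring.
rewrite /trunc_mean -sumrB.
transitivity (\sum_(x <= s < y) \sum_(i < M J) \sum_(j < M J) \sum_(x <= r < y)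
    k s r * (beta J s i * beta J r j) * Z i j).
  apply: eq_bigr => s _; rewrite -sumrB.
  under eq_bigr do rewrite -mulrBr E mulr_sumr.
  rewrite exchange_big; apply: eq_bigr => i _ /=.
  under eq_bigr do rewrite mulr_sumr.
  by rewrite exchange_big; apply: eq_bigr => j _; apply: eq_bigr => r _; rewrite !mulrA.
rewrite exchange_big /quadform; apply: eq_bigr => i _ /=.
rewrite exchange_big; apply: eq_bigr => j _ /=.
by rewrite -/(Z i j) /trunc_mx mulr_suml; apply: eq_bigr => s _; rewrite mulr_suml.
Qed.

Lemma measurable_stat : measurable_fun [set: T] stat.
Proof.
apply: measurable_sum => s; apply: measurable_sum => r.
by apply: measurable_funM => //; exact: measurable_funM.
Qed.

(** The event is given by a strict inequality, so almost surely on it the truncated statistics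
    satisfy it for all large J. As their means are within [bd] of p, the centred form then exceeds
    z, and its moment is bounded uniformly in J. *)
Lemma deviation (p bd z v : R) (J0 : nat) : 0 < z -> 0 < v ->
  G ^+ 4 * (\sum_(x <= s < y) \sum_(x <= r < y) k s r ^+ 2) <= v ->
  (forall J, (J0 <= J)%N -> `|trunc_mean J - p| <= bd) ->
  (P [set w | (bd + z < `|stat w - p|)%R] <=
   (expR (4 ^+ q) * (quad_const q mu * v) ^+ q / z ^+ (2 * q))%:E)%E.
Proof.
move=> z0 v0 kv hp.
pose Q J := quadform xi (sigma ^+ 2) (noise_idx J) (trunc_mx J) (M J).
have inj J : injective (noise_idx J) by rewrite /noise_idx => i j; lia.
have iQ J n : (2 * n <= 4 * q)%N -> P.-integrable [set: T] (fun w => (Q J w ^+ n)%:E).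
  move=> nq; apply: (integrable_polyRV mxi indep momxi _ nq).
  have := polyRV_quadform xi (sigma ^+ 2) (noise_idx J) (trunc_mx J) (M J).
  by move/(polyRVX n); exact.
have mQ J : measurable_fun [set: T] (Q J).
  apply/measurable_EFinP; apply: (measurable_int P); have := @iQ J 1%N.
  by under eq_fun do rewrite expr1; apply; lia.
apply: (@probability_liminf_le _ _ _ P (fun J => [set w | (z < `|Q J w|)%R]) _ _ J0).
- rewrite -[X in measurable X]setTI; apply: (@measurable_fun_ltr _ _ _ _ (cst (bd + z))) => //.
  apply: measurableT_comp => //; apply: measurable_funB => //; exact: measurable_stat.
- move=> J; rewrite -[X in measurable X]setTI.
  by apply: (@measurable_fun_ltr _ _ _ _ (cst z)) => //; exact: measurableT_comp.
- move=> J _; apply: markov_pow => //; first by apply: iQ; lia.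
  apply: (quadform_moment mxi indep q0 momxi meanxi varxi mu1 mu2 mu4 sgmu (inj J)) => //.
  apply: le_trans kv; apply: schur_sqr_sum => // s i.
  exact: trunc_coef_le.
apply: filterS trunc_obs_cvg => w cw hw.
have cs : (Q J w + trunc_mean J) @[J --> \oo] --> stat w.
  have csum (F : nat -> nat -> R) (l : nat -> R) :
      (forall s, (x <= s < y)%N -> F J s @[J --> \oo] --> l s) ->
      \sum_(x <= s < y) F J s @[J --> \oo] --> \sum_(x <= s < y) l s.
    move=> hF; rewrite big_nat; under eq_cvg do rewrite big_nat.
    by apply: (cvg_big (op := +%R)); first exact: add_continuous.
  under eq_cvg do rewrite -trunc_statE.
  apply: (csum (fun J s => \sum_(x <= r < y) k s r * (trunc_obs J s w * trunc_obs J r w))) => s hs.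
  apply: (csum (fun J r => k s r * (trunc_obs J s w * trunc_obs J r w))) => r hr.
  have sN : (s < N)%N by lia.
  have rN : (r < N)%N by lia.
  apply: cvgM; first exact: cvg_cst.
  by apply: cvgM; [exact: (cw (Ordinal sN))|exact: (cw (Ordinal rN))].
have cn : `|Q J w + trunc_mean J - p| @[J --> \oo] --> `|stat w - p|.
  by apply: cvg_norm; apply: cvgB => //; exact: cvg_cst.
near=> J.
have h1 : bd + z < `|Q J w + trunc_mean J - p| by near: J; exact: (cvgr_gt _ cn).
have h2 : `|trunc_mean J - p| <= bd by apply: hp; near: J; exact: nbhs_infty_ge.
rewrite -addrA in h1; have := ler_normD (Q J w) (trunc_mean J - p).
by move: h1 h2 => /=; lra.
Unshelve. all: by end_near. Qed.

End Deviation.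

(** * Truncated transfer functions and spectral densities *)

Section SpectralApprox.
Context {R : realType}.
Variables (K : nat) (a : 'I_K.+1 -> int -> R) (sigma : R).
Hypothesis ha : forall k, summable [set: int] (fun j => (a k j)%:E).

(** One sequence for all segments, since covariances mix two of them. It dominates the coefficients,
    for the quadratic forms, and sigma times them, for the means, where sigma^2 is shared between
    the two factors of a covariance. *)
Lemma dominating_sequence : exists (A : int -> R) (G : R),
  [/\ 0 < G, (forall l j, `|a l j| <= A j), (forall l j, `|sigma * a l j| <= A j),
   (forall s : seq int, uniq s -> \sum_(j <- s) A j <= G) &
   (forall eps, 0 < eps -> exists H, forall s : seq int, uniq s ->
      all (fun j => (H < `|j|)%N) s -> \sum_(j <- s) A j <= eps)].
Proof.
pose A j := (1 + `|sigma|) * \sum_(l < K.+1) `|a l j|.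
have s0 : 0 < 1 + `|sigma| by rewrite ltr_pwDl.
have /choice[g hg] : forall l, exists g : R, 0 < g /\
    forall s : seq int, uniq s -> \sum_(j <- s) `|a l j| <= g.
  by move=> l; have [G G0 hG] := summable_bound (ha l); exists G.
have aA l j : `|a l j| <= \sum_(l < K.+1) `|a l j|.
  by rewrite (bigD1 l)//= lerDl sumr_ge0.
have sA (s : seq int) : \sum_(j <- s) A j = (1 + `|sigma|) * \sum_(l < K.+1) \sum_(j <- s) `|a l j|.
  by rewrite exchange_big mulr_sumr.
exists A, ((1 + `|sigma|) * \sum_(l < K.+1) g l); split.
- rewrite mulr_gt0// (bigD1 ord0)//= ltr_pwDl//; first by case: (hg ord0).
  by apply: sumr_ge0 => l _; have [/ltW] := hg l.
- move=> l j; apply: le_trans (aA l j) _.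
  by rewrite /A mulrDl mul1r lerDl mulr_ge0// sumr_ge0.
- move=> l j; rewrite normrM /A; apply: ler_pM => //; first by rewrite lerDr.
- move=> s us; rewrite sA ler_wpM2l ?(ltW s0)//; apply: ler_sum => l _.
  by have [_] := hg l; apply.
move=> eps eps0; pose e := eps / ((1 + `|sigma|) * K.+1%:R).
have e0 : 0 < e by rewrite divr_gt0// mulr_gt0.
have /choice[h hh] : forall l, exists h : nat, forall s : seq int, uniq s ->
    all (fun j => (h < `|j|)%N) s -> \sum_(j <- s) `|a l j| <= e.
  by move=> l; have [H hH] := summable_tail (ha l) e0; exists H.
exists (\max_(l < K.+1) h l) => s us hs; rewrite sA.
apply: (@le_trans _ _ ((1 + `|sigma|) * \sum_(l < K.+1) e)).
  rewrite ler_wpM2l ?(ltW s0)//; apply: ler_sum => l _; apply: hh => //.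
  by apply: sub_all hs => j; apply: leq_ltn_trans; exact: leq_bigmax.
by rewrite sumr_const card_ord -mulr_natl mulrA /e mulrC divfK// gt_eqF// mulr_gt0.
Qed.

Lemma zsum_trig_le (g : R -> R) l v : (forall z, `|g z| <= 1) ->
  forall j : int, `|a l j * g (j%:~R * v)| <= `|a l j|.
Proof. by move=> g1 j; rewrite normrM -[leRHS]mulr1 ler_wpM2l. Qed.

Lemma cos_norm_le1 (z : R) : `|cos z| <= 1.
Proof. by rewrite ler_norml cos_geN1 cos_le1. Qed.

Lemma sin_norm_le1 (z : R) : `|sin z| <= 1.
Proof. by rewrite ler_norml sin_geN1 sin_le1. Qed.

Lemma spectral_approx (eps : R) : 0 < eps -> exists J0, forall J, (J0 <= J)%N -> forall l v,
  `|zsum (fun j => sigma * a l j * cos (j%:~R * v)) J ^+ 2 +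
    zsum (fun j => sigma * a l j * sin (j%:~R * v)) J ^+ 2 -
    spectral_density sigma (a l) v| <= eps.
Proof.
move=> eps0.
have /choice[g hg] : forall l, exists g : R, 0 < g /\
    forall s : seq int, uniq s -> \sum_(j <- s) `|a l j| <= g.
  by move=> l; have [G G0 hG] := summable_bound (ha l); exists G.
(* The cosine and sine parts each have an error of at most 2 g sigma^2 e; the summand 1 keeps the
   denominator positive when sigma is 0. *)
pose e l := eps / (4 * g l * sigma ^+ 2 + 1).
have d0 l : 0 < 4 * g l * sigma ^+ 2 + 1.
  have [/ltW gl _] := hg l; apply: ltr_wpDl => //.
  by rewrite mulr_ge0 ?sqr_ge0// mulr_ge0.
have e0 l : 0 < e l by rewrite divr_gt0.
have /choice[h hh] : forall l, exists h : nat, forall s : seq int, uniq s ->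
    all (fun j => (h < `|j|)%N) s -> \sum_(j <- s) `|a l j| <= e l.
  by move=> l; have [H hH] := summable_tail (ha l) (e0 l); exists H.
exists (\max_(l < K.+1) h l) => J hJ l v.
have hlJ : (h l <= J)%N by apply: leq_trans hJ; exact: leq_bigmax.
have [gl0 hgl] := hg l.
have one (w : R -> R) : (forall z, `|w z| <= 1) ->
    `|zsum (fun j => sigma * a l j * w (j%:~R * v)) J ^+ 2 -
      sigma ^+ 2 * limn (zsum (fun j => a l j * w (j%:~R * v))) ^+ 2| <= 2 * g l * sigma ^+ 2 * e l.
  move=> w1; set F := fun j : int => a l j * w (j%:~R * v).
  have Fa : forall j, `|F j| <= `|a l j| by exact: zsum_trig_le.
  have -> : zsum (fun j => sigma * a l j * w (j%:~R * v)) J = sigma * zsum F J.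
    by rewrite /zsum mulr_sumr; apply: eq_bigr => j _; rewrite mulrA.
  have h1 : `|zsum F J - limn (zsum F)| <= e l by exact: (zsum_lim_tail (ha l) Fa (hh l) hlJ).
  have h2 : forall n, `|zsum F n| <= g l by exact: zsum_le_bound.
  have h3 : `|limn (zsum F)| <= g l.
    have cF := is_cvg_zsum (ha l) Fa.
    have cn : `|zsum F n| @[n --> \oo] --> `|limn (zsum F)| by exact: cvg_norm.
    by rewrite -(cvg_lim _ cn)//; apply: limr_le; [apply/cvg_ex; eexists; exact: cn|apply: nearW].
  rewrite exprMn -mulrBr normrM (ger0_norm (sqr_ge0 _)) subr_sqr normrM.
  rewrite [leRHS](_ : _ = sigma ^+ 2 * (e l * (2 * g l))); last by ring.
  rewrite ler_wpM2l ?sqr_ge0//; apply: ler_pM => //.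
  by apply: le_trans (ler_normD _ _) _; have := h2 J; lra.
rewrite /spectral_density mulrDr opprD addrACA.
apply: le_trans (ler_normD _ _) _.
apply: le_trans (lerD (one _ cos_norm_le1) (one _ sin_norm_le1)) _.
rewrite -mulrDl /e mulrA ler_pdivrMr// mulrC ler_wpM2l ?(ltW eps0)//; lra.
Qed.

Lemma spectral_density_pi l : spectral_density sigma (a l) pi = spectral_density sigma (a l) (- pi).
Proof.
rewrite /spectral_density; congr (_ * (limn (zsum _) ^+ 2 + limn (zsum _) ^+ 2)); apply/funext => j.
  by rewrite mulrN cosN.
by rewrite mulrN sinN sin_int_pi oppr0.
Qed.

End SpectralApprox.

(** In this order: truncation of the transfer functions; Fejer bias of the K + 1 blocks, with the
    free parameter t; covariances across change points, far from them and near them; smoothing of a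
    Lipschitz spectrum by a window of width O(1 / m). *)
Definition bias_bound {R : realType} (Bf G eps t m : R) (H K N : nat) (off : R) : R :=
  1 + 8 * Bf * (K.+1%:R * t + N%:R / t) +
  2 * (2 * eps * G * off + G ^+ 2 * (K.+2%:R * (H.*2.+1).*2.+1%:R)) + N%:R * Bf * (pi / m).

Section SpecDeviation.
Context {d : measure_display} {T : measurableType d} {R : realType}.
Variable P : probability T R.
Variables (xi : int -> T -> R) (sigma mu : R) (q : nat).
Hypothesis q0 : (0 < q)%N.
Hypothesis mxi : forall t, measurable_fun [set: T] (xi t).
Hypothesis indep : mutually_independent P xi.
Hypothesis momxi : forall i, P.-integrable [set: T] (fun w => (`|xi i w| ^+ (4 * q))%:E).
Hypothesis meanxi : forall i, \int[P]_w xi i w = 0.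
Hypothesis varxi : forall i, \int[P]_w (xi i w ^+ 2) = sigma ^+ 2.
Hypothesis mu1 : 1 <= mu.
Hypothesis mu2 : forall i, \int[P]_w (xi i w ^+ (2 * q)) <= mu.
Hypothesis mu4 : forall i, \int[P]_w (xi i w ^+ (4 * q)) <= mu.
Hypothesis sgmu : (sigma ^+ 2) ^+ (2 * q) <= mu.
Variables (K N : nat) (t0 : nat -> nat).
Hypothesis t00 : t0 0 = 0%N.
Hypothesis t0N : t0 K.+1 = N.
Hypothesis t0S : forall k, (k <= K)%N -> (t0 k <= t0 k.+1)%N.
Variables (a : 'I_K.+1 -> int -> R) (X : nat -> T -> R).
Hypothesis ha : forall k, summable [set: int] (fun j => (a k j)%:E).
Hypothesis mX : forall t, measurable_fun [set: T] (X t).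
Hypothesis hX : forall (k : 'I_K.+1) t, (t0 k < t <= t0 k.+1)%N ->
  {ae P, forall w, zsum (fun j => a k j * xi (t%:Z - j) w) @ \oo --> X t w}.
Variables (A : int -> R) (G : R).
Hypothesis G0 : 0 < G.
Hypothesis aA : forall l j, `|a l j| <= A j.
Hypothesis saA : forall l j, `|sigma * a l j| <= A j.
Hypothesis hG : forall s : seq int, uniq s -> \sum_(j <- s) A j <= G.
Variables (eps : R) (H : nat).
Hypothesis tailA : forall s : seq int, uniq s -> all (fun j => (H < `|j|)%N) s ->
  \sum_(j <- s) A j <= eps.
Variable Bf : R.
Hypothesis Bf0 : 0 <= Bf.
Local Notation f l := (spectral_density sigma (a l)).
Hypothesis flip : forall l u1 u2, u1 \in `[- pi, pi] -> u2 \in `[- pi, pi] ->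
  `|f l u1 - f l u2| <= Bf * `|u1 - u2|.
Variables (W : R -> R) (MW : R).
Hypothesis W0 : forall u, 0 <= W u.
Hypothesis MW0 : 0 < MW.
Hypothesis WM : forall u, W u <= MW.
Hypothesis Wint : (@lebesgue_measure R).-integrable [set: R] (fun u => (W u)%:E).
Hypothesis Wpi : (\int[@lebesgue_measure R]_(v in `[(- pi)%R, pi%R]) (W v)%:E = 1)%E.
Hypothesis WR : (\int[@lebesgue_measure R]_v (W v)%:E = 1)%E.
Variables (m lam t : R).
Hypothesis m1 : 1 <= m.
Hypothesis lamI : lam \in `[- pi, pi].
Hypothesis t_gt0 : 0 < t.
Local Notation cnt l x y := ((seg_count t0 l x y)%:R : R).
Local Notation off k x y := (\sum_(l < K.+1 | l != k) cnt l x y).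

Let saE J x y u : \sum_(x <= s < y) \sum_(x <= r < y) cov_term N t0 (fun l j => sigma * a l j) u J s r =
  \sum_(x <= s < y) \sum_(x <= r < y) cos ((s%:Z - r%:Z)%:~R * u) * (sigma ^+ 2 * trunc_cov N t0 a J s r).
Proof.
apply: eq_bigr => s _; apply: eq_bigr => r _; rewrite /cov_term; congr (_ * _).
rewrite /trunc_cov mulr_sumr; apply: eq_bigr => i _.
by rewrite /trunc_coef; do 2 case: ifP => _; rewrite ?mulr0 ?mul0r ?mulr0//; ring.
Qed.

Lemma mean_bias (k : 'I_K.+1) x y : (x < y <= N)%N -> exists J0, forall J, (J0 <= J)%N ->
  `|trunc_mean sigma N t0 a (kcoef (kernel W m lam)) x y J -
    pint (kernel W m lam) * \sum_(l < K.+1) cnt l x y * f l lam| <=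
  bias_bound Bf G eps t m H K N (off k x y).
Proof.
move=> /andP[xy yN].
have N1 : (0 : R) < N%:R + 1 by rewrite ltr_wpDl.
(* The precision required of the truncation: N times it is below the summand 1 of [bias_bound]. *)
have e1 : 0 < (N%:R + 1)^-1 :> R by rewrite invr_gt0.
have [J0 hJ0] := spectral_approx sigma ha e1; exists J0 => J /hJ0 hJ.
have ki := integrable_kernel W0 WM Wint lam m1.
have cS : continuous (fun u : R => \sum_(x <= s < y) \sum_(x <= r < y) cos ((s%:Z - r%:Z)%:~R * u) *
    (sigma ^+ 2 * trunc_cov N t0 a J s r)).
  apply: continuousR_sum => s; apply: continuousR_sum => r; under eq_fun do rewrite mulrC.
  by apply: continuousRZ; under eq_fun do rewrite -[_ * _]addr0; exact: continuous_cos_lin.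
have -> : trunc_mean sigma N t0 a (kcoef (kernel W m lam)) x y J =
    pint (fun u => kernel W m lam u * \sum_(x <= s < y) \sum_(x <= r < y) cos ((s%:Z - r%:Z)%:~R * u) *
      (sigma ^+ 2 * trunc_cov N t0 a J s r)).
  by rewrite (pint_mul_sum2 ki (fun s r => sigma ^+ 2 * trunc_cov N t0 a J s r)).
have off0 : 0 <= off k x y by rewrite sumr_ge0.
have eps0 : 0 <= eps by have := tailA (s := [::]) isT isT; rewrite big_nil.
apply: (pint_mul_norm ki (l := lam)) => //.
- exact: kernel_ge0.
- exact: pint_kernel_le1.
- exact: pint_kernel_dist.
- by rewrite mulr_ge0.
- by rewrite !addr_ge0 ?mulr_ge0 ?addr_ge0 ?mulr_ge0 ?divr_ge0 ?sqr_ge0 ?invr_ge0 ?(ltW G0) ?(ltW t_gt0).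
move=> u uI; rewrite -saE.
rewrite -[X in `|X|](subrKA (\sum_(l < K.+1) cnt l x y * f l u)).
apply: le_trans (ler_normD _ _) _; apply: lerD; last first.
  rewrite -sumrB; apply: le_trans (ler_norm_sum _ _ _) _.
  apply: (@le_trans _ _ (\sum_(l < K.+1) cnt l x y * (Bf * `|u - lam|))).
    by apply: ler_sum => l _; rewrite -mulrBr normrM ger0_norm// ler_wpM2l// flip.
  rewrite -mulr_suml -mulrA ler_wpM2r ?mulr_ge0// -natr_sum ler_nat.
  by rewrite (seg_count_total t00 t0N t0S)// (leq_trans (leq_subr _ _)).
have L0 : 0 <= 8 * Bf by rewrite mulr_ge0.
have app (l : 'I_K.+1) v : v \in `[- pi, pi] ->
    `|zsum (fun j => sigma * a l j * cos (j%:~R * v)) J ^+ 2 +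
      zsum (fun j => sigma * a l j * sin (j%:~R * v)) J ^+ 2 - f l u| <=
    (N%:R + 1)^-1 + 8 * Bf * (t * (1 - cos (u - v)) + t^-1).
  move=> vI; rewrite -[X in `|X|](subrKA (f l v)); apply: le_trans (ler_normD _ _) _.
  apply: lerD; first exact: hJ.
  by apply: lipschitz_circle => //; [exact: spectral_density_pi|exact: flip].
apply: le_trans (cov_bias (c := fun l j => sigma * a l j) (f := fun l => f l)
  t00 t0N t0S saA hG t_gt0 L0 (ltW e1) app tailA k x yN) _.
by rewrite !lerD2r ler_pdivrMr// mul1r lerDl.
Qed.

(** The bounds of [schur_sqr_sum] and [kcoef_sqr_sum] together, for a kernel of height m MW. *)
Definition dev_var := G ^+ 4 * (N%:R * (2 * (2 * pi * (m * MW)))).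

Lemma spec_deviation (k : 'I_K.+1) x y z : (x < y <= N)%N -> 0 < z ->
  (P [set w | (bias_bound Bf G eps t m H K N (off k x y) + z <
     `|(y - x)%:R * spec_est W m (X^~ w) x y lam -
       pint (kernel W m lam) * \sum_(l < K.+1) cnt l x y * f l lam|)%R] <=
   (expR (4 ^+ q) * (quad_const q mu * dev_var) ^+ q / z ^+ (2 * q))%:E)%E.
Proof.
move=> xyN z0; have [J0 hJ0] := mean_bias k xyN; have /andP[xy yN] := xyN.
have ki := integrable_kernel W0 WM Wint lam m1.
have m0 : 0 < m by exact: lt_le_trans m1.
under eq_set => w do rewrite (spec_estE (X^~ w) xy (lt0r_neq0 m0) ki).
apply: (deviation q0 mxi indep momxi meanxi varxi mu1 mu2 mu4 sgmu t00 t0N t0S mX hX G0 aA hG yN z0 _ _ hJ0).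
  by rewrite /dev_var !mulr_gt0 ?exprn_gt0 ?pi_gt0// ltr0n (leq_trans _ yN)// (leq_ltn_trans _ xy).
rewrite /dev_var ler_wpM2l ?exprn_ge0 ?(ltW G0)//.
apply: kcoef_sqr_sum => //; last exact: pint_kernel_le1.
by move=> u; rewrite kernel_ge0//= kernel_le.
Qed.

Lemma measurable_spec_est x y : (x < y)%N ->
  measurable_fun [set: T] (fun w => (y - x)%:R * spec_est W m (X^~ w) x y lam).
Proof.
move=> xy; have ki := integrable_kernel W0 WM Wint lam m1.
have m0 : 0 < m by exact: lt_le_trans m1.
under eq_fun => w do rewrite (spec_estE (X^~ w) xy (lt0r_neq0 m0) ki).
exact: measurable_stat.
Qed.

End SpecDeviation.

(** * Selection of the number of change points *)

Section PathSelection.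
Context {R : realType}.
Variables (B : baseline) (Lam : seq R) (W : R -> R) (m : R) (N : nat) (x : nat -> R).
Variables (ml C : R) (Kmax K : nat) (t0 : nat -> nat) (f : 'I_K.+1 -> R -> R) (kap : R -> R).
Variables (c0 c1 eta E dl Nm : R).
Hypothesis Lam0 : (0 < size Lam)%N.
Hypothesis KK : (1 <= K <= Kmax)%N.
Hypothesis adm : admissible N ml K t0.
Hypothesis c00 : 0 < c0.
Hypothesis c01 : c0 <= c1.
Hypothesis fc : forall k u, u \in Lam -> c0 <= f k u <= c1.
Hypothesis kapc : forall u, u \in Lam -> 2^-1 <= kap u <= 1.
Hypothesis hest : forall a b u (k : 'I_K.+1), (a < b <= N)%N -> u \in Lam ->
  `|(b - a)%:R * spec_est W m x a b u - kap u * \sum_(l < K.+1) (seg_count t0 l a b)%:R * f l u| <=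
  E + dl * \sum_(l < K.+1 | l != k) (seg_count t0 l a b)%:R.
Hypothesis E0 : 0 <= E.
Hypothesis Edl : E <= dl * ml.
Hypothesis dl0 : 0 <= dl.
Hypothesis dlc : dl <= c0 / 8.
Hypothesis ml0 : 0 < ml.
Hypothesis hgap : forall k l, k != l ->
  2 * eta * gap_const c0 c1 <= KLdiv Lam (f k) (f l).
Hypothesis eta0 : 0 < eta.
Hypothesis hdl : 4 * pi * ln_bound c0 c1 * dl <= eta / 2.
Hypothesis NmN : forall k : 'I_K.+1, Nm <= (t0 k.+1 - t0 k)%:R.
Local Notation slack := ((Kmax.+1 + K.+1)%:R * (4 * pi * ln_bound c0 c1 * E)).
Hypothesis slackC : slack < C.
Hypothesis slackNm : slack + K%:R * C < eta / 2 * Nm.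

(** Deterministic. The slack adds the errors of two bounds, one for a competing partition, with at
    most Kmax + 1 segments, and one for the true partition, with K + 1. *)
Lemma path_selection L : BIC_minimizer B Lam W m N x ml C Kmax L -> L = K.
Proof.
have [t00 t0N t0adm] := adm.
have t0S k : (k <= K)%N -> (t0 k <= t0 k.+1)%N by move=> /t0adm[/ltnW].
have LL0 : 0 <= ln_bound c0 c1 by exact: ln_bound_ge0.
have pi0 := @pi_gt0 R.
have X0 : 0 <= 4 * pi * ln_bound c0 c1 * E by rewrite !mulr_ge0// ltW.
have N0 : (0 < N)%N by have [h _] := t0adm K (leqnn K); rewrite -t0N; exact: leq_ltn_trans h.
have mlN0 : ml <= (N - 0)%:R.
  have [_ h] := t0adm K (leqnn K); apply: le_trans h _.
  by rewrite ler_nat -t0N subn0 leq_subr.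
(* The whole sample is the segment ]0, N], so its estimate is bounded by [est_itv] like any other.
   The constant baseline is covered because 2 pi <= 16 pi c1 / c0. *)
have hb u : u \in Lam -> 0 < st_baseline B Lam W m N x u /\
    `|ln (st_baseline B Lam W m N x u)| <= ln_bound c0 c1.
  move=> uL; case: B; rewrite /=.
    apply: ln_st_bound uL => // v vL.
    by apply: (est_itv t00 t0N t0S c00 c01 fc kapc hest Edl dl0 dlc) => //; rewrite N0 leqnn.
  have p2 : 0 < 2 * pi :> R by rewrite mulr_gt0.
  split; first by rewrite divr_gt0.
  rewrite div1r lnV ?posrE// normrN ger0_norm; last first.
    by rewrite ln_ge0//; have := @pi_ge2 R; lra.
  rewrite /ln_bound ler_ln ?posrE//; last by rewrite divr_gt0// !mulr_gt0// (lt_le_trans c00).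
  rewrite ler_pdivlMr// -mulrA [leRHS](_ : _ = 2 * (pi * (8 * c1))); last by ring.
  by rewrite -mulrA ler_wpM2l// ler_wpM2l ?(ltW pi0)//; move: c00 c01; lra.
have hb1 u (uL : u \in Lam) := (hb u uL).1; have hb2 u (uL : u \in Lam) := (hb u uL).2.
pose D := eta / 2 * Nm.
apply: (BIC_minimizer_unique (A := slack) (D := D) KK adm) => //; last by rewrite mulr_ge0.
move=> L' tau LK admt.
have h1 := total_objective_le Lam0 t00 t0N t0S c00 c01 fc kapc hest Edl dl0 dlc hb1 hb2 hgap eta0 hdl NmN admt.
have h2 := total_objective_ge Lam0 t00 t0N t0S c00 c01 fc kapc hest Edl dl0 dlc ml0 hb1 hb2
  (fun k => (t0adm k (ltn_ord k)).2).
have h3 : L'.+1%:R * (4 * pi * ln_bound c0 c1 * E) <= Kmax.+1%:R * (4 * pi * ln_bound c0 c1 * E).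
  by rewrite ler_wpM2r// ler_nat.
change (total_objective Lam (st_baseline B Lam W m N x) (spec_est W m x) L' tau <=
  total_objective Lam (st_baseline B Lam W m N x) (spec_est W m x) K t0 + slack - (L' < K)%N%:R * D).
rewrite natrD mulrDl /D.
have -> : (L' < K)%N%:R * (eta / 2 * Nm) = eta / 2 * ((L' < K)%N%:R * Nm) by ring.
by move: h1 h2 h3; lra.
Qed.

End PathSelection.

(** * Moments of the innovations *)

Section Moments.
Context {d : measure_display} {T : measurableType d} {R : realType}.
Variable P : probability T R.
Variables (xi : int -> {RV P >-> R}) (sigma : R) (q : nat).
Hypothesis q0 : (0 < q)%N.
Hypothesis hid : identically_distributed P (fun t => xi t : T -> R).
Hypothesis hmean : forall t, ('E_P[xi t] = 0)%E.
Hypothesis hvar : forall t, ('V_P[xi t] = (sigma ^+ 2)%:E)%E.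
Hypothesis hmom : forall t, ('E_P[fun w => (xi t w ^+ (8 * q))%R] < +oo)%E.

Lemma measurable_RV t : measurable_fun [set: T] (xi t : T -> R).
Proof. exact: measurable_funPT. Qed.

Lemma integrable_norm_pow8 t : P.-integrable [set: T] (fun w => (`|xi t w| ^+ (8 * q))%:E).
Proof.
have E : (fun w => (`|xi t w| ^+ (8 * q))%:E) = (fun w => (xi t w ^+ (8 * q))%:E) :> (T -> \bar R).
  apply/funext => w; rewrite -normrX ger0_norm// (_ : 8 * q = 2 * (4 * q))%N; last by lia.
  by rewrite exprM exprn_ge0// sqr_ge0.
have mX : measurable_fun [set: T] (fun w => (`|xi t w| ^+ (8 * q))%:E).
  apply/measurable_EFinP; apply: measurable_funX; apply: measurableT_comp => //.
apply/integrableP; split => //.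
under eq_integral => w _ do rewrite gee0_abs ?lee_fin ?exprn_ge0//.
by have := hmom t; rewrite unlock E.
Qed.

Lemma integrable_norm_pow t n : (n <= 8 * q)%N ->
  P.-integrable [set: T] (fun w => (`|xi t w| ^+ n)%:E).
Proof.
move=> nq; have := integrable_pow (Y := fun t w => `|xi t w|) _ _ t nq.
apply; first by move=> i; apply: measurableT_comp => //.
by move=> i; under eq_fun do rewrite normr_id; exact: integrable_norm_pow8.
Qed.

Lemma Rintegral_RV t : \int[P]_w xi t w = 0.
Proof. by have := hmean t; rewrite unlock /Rintegral => ->. Qed.

Lemma Rintegral_RV_sqr t : \int[P]_w (xi t w ^+ 2) = sigma ^+ 2.
Proof.
have := hvar t; rewrite /variance unlock hmean /= unlock /Rintegral => h.
rewrite -[RHS]/(fine (sigma ^+ 2)%:E) -h; congr fine; apply: eq_integral => w _.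
by rewrite -[RHS]/(((xi t w - 0) * (xi t w - 0))%:E) subr0 expr2.
Qed.

(** Read on the pushforward measures, which agree on measurable sets. It makes one constant bound
    the moments of all innovations. *)
Lemma Rintegral_pow_id s t n : \int[P]_w (xi s w ^+ (2 * n)) = \int[P]_w (xi t w ^+ (2 * n)).
Proof.
pose g (z : R) : \bar R := (z ^+ (2 * n))%:E.
have mg : measurable_fun [set: R] g by apply/measurable_EFinP; exact: measurable_funX.
have g0 : {in [set: R], forall z, (0 <= g z)%E} by move=> z _; rewrite lee_fin exprM exprn_ge0// sqr_ge0.
have pf u : (\int[P]_w (xi u w ^+ (2 * n))%:E = \int[pushforward P (xi u)]_z g z)%E.
  by rewrite ge0_integral_pushforward//.
rewrite /Rintegral !pf; congr fine; apply: eq_measure_integral => A mA _.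
exact: hid.
Qed.

Lemma moment_bound : exists mu : R, [/\ 1 <= mu,
  forall t, \int[P]_w (xi t w ^+ (2 * q)) <= mu,
  forall t, \int[P]_w (xi t w ^+ (4 * q)) <= mu & (sigma ^+ 2) ^+ (2 * q) <= mu].
Proof.
pose m1 := `|\int[P]_w (xi 0 w ^+ (2 * q))|; pose m2 := `|\int[P]_w (xi 0 w ^+ (4 * q))|.
have s0 : 0 <= (sigma ^+ 2) ^+ (2 * q) by rewrite exprn_ge0// sqr_ge0.
exists (1 + m1 + m2 + (sigma ^+ 2) ^+ (2 * q)).
have m10 : 0 <= m1 by exact: normr_ge0.
have m20 : 0 <= m2 by exact: normr_ge0.
split; [by lra| | |by lra] => t.
  by rewrite (Rintegral_pow_id t 0); have := ler_norm (\int[P]_w (xi 0 w ^+ (2 * q))); rewrite -/m1; lra.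
rewrite (_ : 4 * q = 2 * (2 * q))%N; last by lia.
rewrite (Rintegral_pow_id t 0) (_ : 2 * (2 * q) = 4 * q)%N; last by lia.
by have := ler_norm (\int[P]_w (xi 0 w ^+ (4 * q))); rewrite -/m2; lra.
Qed.

End Moments.

Lemma window_total {R : realType} (W : R -> R) :
  (@lebesgue_measure R).-integrable [set: R] (fun u => (W u)%:E) -> invFourier_re W 0 = 1 ->
  (\int[@lebesgue_measure R]_v (W v)%:E = 1)%E.
Proof.
move=> Wi; rewrite /invFourier_re /Rintegral; under eq_integral => u _ do rewrite mulr0 cos0 mulr1.
by move=> h; rewrite -[LHS]fineK ?h//; exact: integrable_fin_num.
Qed.

Section SpectralBounds.
Context {R : realType}.
Variables (K : nat) (f : 'I_K.+1 -> R -> R).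
Hypothesis flip : forall k, exists B : R, forall u1 u2,
  u1 \in `[- pi, pi] -> u2 \in `[- pi, pi] -> `|f k u1 - f k u2| <= B * `|u1 - u2|.

Lemma common_lipschitz : exists2 B : R, 0 <= B & forall k u1 u2,
  u1 \in `[- pi, pi] -> u2 \in `[- pi, pi] -> `|f k u1 - f k u2| <= B * `|u1 - u2|.
Proof.
have [B hB] := choice flip; exists (\sum_k `|B k|); first by rewrite sumr_ge0.
move=> k u1 u2 i1 i2; apply: le_trans (hB k u1 u2 i1 i2) _; rewrite ler_wpM2r//.
by apply: le_trans (ler_norm _) _; rewrite (bigD1 k)//= lerDl sumr_ge0.
Qed.

Hypothesis fpos : forall k u, u \in `[- pi, pi] -> 0 < f k u.

Lemma common_bounds : exists c0 c1 : R, [/\ 0 < c0, c0 <= c1 &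
  forall k u, u \in `[- pi, pi] -> c0 <= f k u <= c1].
Proof.
have [B B0 hB] := common_lipschitz; have pi0 := @pi_gt0 R.
have zI : (0 : R) \in `[- pi, pi] by rewrite in_itv /= oppr_le0 ltW.
have low k : exists c, 0 < c /\ forall u, u \in `[- pi, pi] -> c <= f k u.
  have pp : - pi <= pi :> R by lra.
  have cf : {within `[- pi, pi], continuous (f k)}.
    apply/subspace_continuousP => v vI; apply/cvgrPdist_le => e e0.
    have B1 : 0 < B + 1 by rewrite ltr_wpDl.
    rewrite near_withinE; have hr : \forall t \near v, `|v - t| <= e / (B + 1).
      by apply/nbhs_ballP; exists (e / (B + 1)); [rewrite /= divr_gt0|move=> t /= /ltW].
    apply: filterS hr => t vt tI; apply: le_trans (hB k _ _ vI tI) _.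
    apply: (@le_trans _ _ ((B + 1) * (e / (B + 1)))); last by rewrite mulrC divfK// gt_eqF.
    by apply: ler_pM => //; rewrite lerDl.
  have [c cI hc] := EVT_min pp cf.
  by exists (f k c); split; [exact: fpos|].
have [g hg] := choice low.
have gm k : (\big[Num.min/1]_k g k) <= g k by exact: bigmin_le_cond.
have up k u : u \in `[- pi, pi] -> f k u <= \sum_l f l 0 + B * pi.
  move=> uI; have := hB k u 0 uI zI; rewrite subr0 => h.
  have up0 : `|u| <= pi by move: uI; rewrite in_itv /= ler_norml.
  have f0 : f k 0 <= \sum_l f l 0.
    by rewrite (bigD1 k)//= lerDl sumr_ge0// => l _; rewrite ltW ?fpos.
  have := ler_wpM2l B0 up0; move: h; rewrite ler_norml => /andP[_]; move: f0; lra.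
exists (\big[Num.min/1]_k g k), (\sum_k f k 0 + B * pi); split.
- by apply: lt_bigmin => // k _; case: (hg k).
- by apply: le_trans (up ord0 0 zI); apply: le_trans (gm ord0) _; case: (hg ord0) => _; apply.
by move=> k u uI; rewrite up// andbT; apply: le_trans (gm k) _; case: (hg k) => _; apply.
Qed.

End SpectralBounds.

Lemma bigminn_le (I : eqType) (s : seq I) (F : I -> nat) N i : i \in s ->
  (\big[minn/N]_(j <- s) F j <= F i)%N.
Proof.
elim: s => // j s IH; rewrite in_cons big_cons => /predU1P[<-|/IH h]; first exact: geq_minl.
by apply: leq_trans h; exact: geq_minr.
Qed.

Lemma Nmin_le {R : realType} K (kappa : nat -> R) N (k : 'I_K.+1) :
  (Nmin K kappa N <= true_cp kappa N k.+1 - true_cp kappa N k)%N.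
Proof.
apply: (bigminn_le (fun k : 'I_K.+1 => (true_cp kappa N k.+1 - true_cp kappa N k)%N)).
exact: mem_index_enum.
Qed.

(** * A uniform gap between the normalized spectra *)

Section Separation.
Context {R : realType}.
Variables (K : nat) (f : 'I_K.+1 -> R -> R) (Lam : nat -> seq R).
Hypothesis fpos : forall k u, u \in `[- pi, pi] -> 0 < f k u.
Hypothesis hlin : lin_indep_on `[- pi, pi] f.
Hypothesis hLam : forall N u, u \in Lam N -> u \in `[- pi, pi].
Hypothesis Lam0 : forall N, (1 <= N)%N -> (0 < size (Lam N))%N.
Hypothesis sep : forall k l, grid_separates Lam (f k) (f l).

(** Without a gap the divergence is below any positive number infinitely often, so its lower limit
    is 0; separation by the grids then makes the normalized spectra equal on [-pi, pi], against
    linear independence. *)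
Lemma KLdiv_gap_pair k l : k != l -> exists eta : R, 0 < eta /\
  \forall N \near \oo, eta <= KLdiv (Lam N) (f k) (f l).
Proof.
move=> kl; apply: contrapT => no.
have [KL0 [toeq _]] := sep k l.
have inf0 : (limn_einf (fun n => (KLdiv (Lam n) (f k) (f l))%:E) = 0)%E.
  rewrite limn_einf_lim (_ : einfs _ = cst 0%E) ?lim_cst//.
  apply/funext => n; rewrite /einfs; apply/eqP; rewrite eq_le; apply/andP; split; last first.
    by apply: le_ereal_inf_tmp => _ [j nj <-]; rewrite lee_fin.
  apply/lee_addgt0Pr => e e0; rewrite add0e.
  have [j nj hj] : exists2 j, (n <= j)%N & KLdiv (Lam j) (f k) (f l) < e.
    apply: contrapT => h; apply: no; exists e; split => //; exists n => // j /= nj.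
    by rewrite leNgt; apply/negP => hj; apply: h; exists j.
  apply: (@le_trans _ _ (KLdiv (Lam j) (f k) (f l))%:E); last by rewrite lee_fin ltW.
  by apply: ereal_inf_lbound; exists j.
have [n _ hn] := toeq inf0.
(* The successor ensures that the grid is not empty. *)
have {}hn := hn n.+1 (leqnSn n); set s := Lam n.+1 in hn.
have s0 : (0 < size s)%N by exact: Lam0.
have G0 i : 0 < grid_int s (f i) by apply: grid_int_gt0 => // u us; apply: fpos; exact: hLam us.
(* Equality of the normalizations is a linear relation with these coefficients. *)
pose c i := if i == k then (grid_int s (f k))^-1 else if i == l then - (grid_int s (f l))^-1 else 0.
have := hlin (c := c) _ k; rewrite /c eqxx => H.
have : (grid_int s (f k))^-1 = 0.
  apply: H => u uI; rewrite (bigD1 k)//= (bigD1 l) /=; last by rewrite eq_sym.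
  rewrite eqxx eq_sym (negbTE kl) eqxx big1 ?addr0.
    by have := hn u uI; rewrite /st [X in X = _]mulrC [X in _ = X]mulrC => ->; rewrite mulNr subrr.
  by move=> i /andP[ik il]; rewrite (negbTE ik) (negbTE il) mul0r.
by apply/eqP; rewrite invr_eq0 gt_eqF.
Qed.

Lemma KLdiv_gap : exists eta : R, 0 < eta /\
  \forall N \near \oo, forall k l, k != l -> eta <= KLdiv (Lam N) (f k) (f l).
Proof.
have pair (kl : 'I_K.+1 * 'I_K.+1) : exists eta : R, 0 < eta /\
    \forall N \near \oo, kl.1 != kl.2 -> eta <= KLdiv (Lam N) (f kl.1) (f kl.2).
  have [E|ne] := eqVneq kl.1 kl.2; first by exists 1; split => //; apply: nearW.
  by have [eta [e0 he]] := KLdiv_gap_pair ne; exists eta; split => //; apply: filterS he.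
have [g hg] := choice pair.
have gm : forall p, (\big[Num.min/1]_p g p) <= g p by move=> p; exact: bigmin_le_cond.
exists (\big[Num.min/1]_p g p); split.
  by apply: lt_bigmin => // p _; case: (hg p).
have : \forall N \near \oo, forall p : 'I_K.+1 * 'I_K.+1, p.1 != p.2 -> g p <= KLdiv (Lam N) (f p.1) (f p.2).
  by apply: filter_forall => p; case: (hg p).
by apply: filterS => N h k l kl; apply: le_trans (gm (k, l)) _; exact: h (k, l) kl.
Qed.

End Separation.

Lemma powR_nat_pinfty {R : realType} (a : R) (M : R) : 0 < a ->
  \forall N \near \oo, M <= (N%:R : R) `^ a.
Proof.
move=> a0; pose L := `|M| + 1.
have L0 : 0 < L by rewrite ltr_wpDl.
near=> N; apply: (@le_trans _ _ L); first by rewrite ler_wpDr// ler_norm.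
have -> : L = (L `^ a^-1) `^ a by rewrite -powRrM mulVf ?gt_eqF// powRr1// ltW.
apply: ge0_ler_powR; rewrite ?nnegrE ?powR_ge0 ?(ltW a0)//.
near: N; exact: nbhs_infty_ger.
Unshelve. all: by end_near. Qed.

(** * Orders of magnitude in N *)

Section Rates.
Context {R : realType}.
Variables (q N : nat) (alpha : R).
Hypothesis q0 : (0 < q)%N.
Hypothesis N1 : (1 <= N)%N.
Hypothesis alpha4 : 1 / 4 <= alpha.
Local Notation rho := ((q%:R + 3 + 2 * q%:R * alpha) / (2 * q%:R)).
Local Notation "n ^^ a" := ((n%:R : R) `^ a) (at level 30).

Let N1R : (1 : R) <= N%:R. Proof. by rewrite ler1n. Qed.
Let NR0 : (0 : R) < N%:R. Proof. by rewrite ltr0n. Qed.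
Let qR0 : (0 : R) < q%:R. Proof. by rewrite ltr0n. Qed.

Let rhoE : rho = 1 / 2 + 3 / (2 * q%:R) + alpha.
Proof. by field; rewrite gt_eqF. Qed.

Let r3 : 0 <= 3 / (2 * q%:R) :> R.
Proof. by rewrite divr_ge0// mulr_ge0. Qed.

Let pD x y : N ^^ (x + y) = N ^^ x * N ^^ y.
Proof. by apply: powRD; apply/implyP => _; exact: lt0r_neq0. Qed.

Let pB x y : N ^^ (x - y) = N ^^ x / N ^^ y.
Proof. by apply: powRB; apply/implyP => _; exact: lt0r_neq0. Qed.

(** The choice t = sqrt N balances t and N / t in the Fejer bias. The smoothing bias is of order
    N^(1 - alpha), below N^rho because alpha >= 1/4. The deviation allowed in the Markov inequality
    is the summand N^rho on the left. *)
Lemma bias_bound_rate (Bf G eps c1 m off : R) (H K : nat) : 0 <= Bf -> 0 < c1 -> c1 * N ^^ alpha <= m ->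
  bias_bound Bf G eps (N ^^ (1 / 2)) m H K N off + N ^^ rho <=
  (2 + 8 * Bf * (K.+1%:R + 1) + 2 * G ^+ 2 * (K.+2%:R * (H.*2.+1).*2.+1%:R) + Bf * (pi / c1)) * N ^^ rho +
  4 * eps * G * off.
Proof.
move=> Bf0 c10 cm; rewrite /bias_bound.
have p1 : 1 <= N ^^ rho.
  rewrite -[leLHS](powRr0 N%:R); apply: ler_powR => //; rewrite rhoE; have := alpha4; have := r3; lra.
have ph : N ^^ (1 / 2) <= N ^^ rho.
  by apply: ler_powR => //; rewrite rhoE; have := alpha4; have := r3; lra.
have pa0 : 0 < N ^^ alpha by exact: powR_gt0.
have h0 : 0 < N ^^ (1 / 2) by exact: powR_gt0.
have Nh : N%:R / N ^^ (1 / 2) = N ^^ (1 / 2).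
  rewrite -[X in X / _](powRr1 (ler0n R N)) -pB.
  by congr (_ `^ _); lra.
have Nm : N%:R * Bf * (pi / m) <= Bf * (pi / c1) * N ^^ rho.
  have m0 : 0 < m by apply: lt_le_trans cm; rewrite mulr_gt0.
  apply: (@le_trans _ _ (Bf * (pi / c1) * (N%:R / N ^^ alpha))).
    rewrite [leLHS](_ : _ = Bf * pi * (N%:R * m^-1)); last by ring.
    rewrite [leRHS](_ : _ = Bf * pi * (N%:R * (c1 * N ^^ alpha)^-1)); last first.
      by rewrite invfM; ring.
    rewrite ler_wpM2l ?mulr_ge0 ?pi_ge0// ler_wpM2l// lef_pV2 ?posrE// mulr_gt0//.
  rewrite ler_wpM2l ?mulr_ge0 ?divr_ge0 ?invr_ge0 ?pi_ge0 ?(ltW c10)//.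
  rewrite -[X in X / _](powRr1 (ler0n R N)) -pB.
  by apply: ler_powR => //; rewrite rhoE; have := alpha4; have := r3; lra.
rewrite Nh.
have k0 : 0 <= 8 * Bf * (K.+1%:R + 1) by rewrite !mulr_ge0// addr_ge0.
have h1 : 8 * Bf * (K.+1%:R * N ^^ (1 / 2) + N ^^ (1 / 2)) <= 8 * Bf * (K.+1%:R + 1) * N ^^ rho.
  by rewrite -mulrA mulrDl mul1r -mulrA; have := ler_wpM2l k0 ph; lra.
have g0 : 0 <= 2 * G ^+ 2 * (K.+2%:R * (H.*2.+1).*2.+1%:R).
  by apply: mulr_ge0; apply: mulr_ge0 => //; exact: sqr_ge0.
have h2 := ler_wpM2l g0 p1.
rewrite mulr1 in h2.
have -> : 2 * (2 * eps * G * off + G ^+ 2 * (K.+2%:R * (H.*2.+1).*2.+1%:R)) =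
    4 * eps * G * off + 2 * G ^+ 2 * (K.+2%:R * (H.*2.+1).*2.+1%:R) by ring.
move: h1 h2 Nm p1; move: (8 * Bf * (K.+1%:R + 1)) (2 * G ^+ 2 * (K.+2%:R * _)) => a b.
move: (8 * Bf * _) (N%:R * Bf * _) (Bf * (pi / c1)) (4 * eps * G * off) (N ^^ rho) => x1 x5 c x7 r.
by lra.
Qed.

(** Here s is the number of events in the union bound, at most 4 (K + 1) N^3. The exponents add up
    to 3 + q (1 + alpha) - (q + 3 + 2 q alpha) = - q alpha. *)
Lemma deviation_rate (G MW c2 m mu : R) (s : nat) (K : nat) : 0 < MW -> 0 <= m -> 1 <= mu ->
  m <= c2 * N ^^ alpha -> (s <= N.+1 * N.+1 * (N * K.+1))%N ->
  s%:R * (expR (4 ^+ q) * (quad_const q mu * dev_var N G MW m) ^+ q / (N ^^ rho) ^+ (2 * q)) <=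
  4 * K.+1%:R * expR (4 ^+ q) * (quad_const q mu * (G ^+ 4 * (4 * pi * (c2 * MW)))) ^+ q * (N ^^ (q%:R * alpha))^-1.
Proof.
move=> MW0 m0 mu1 mc hs.
have qc0 : 0 <= quad_const q mu.
  have mu0 : 0 <= mu by apply: le_trans mu1.
  by rewrite /quad_const !(mulr_ge0, addr_ge0, exprn_ge0, expR_ge0).
have G4 : 0 <= G ^+ 4 by rewrite (_ : 4 = 2 * 2)%N// exprM sqr_ge0.
set V := quad_const q mu * (G ^+ 4 * (4 * pi * (c2 * MW))).
have pa0 : 0 < N ^^ alpha by exact: powR_gt0.
have r0 : 0 < N ^^ rho by exact: powR_gt0.
have c20 : 0 <= c2 by rewrite -(pmulr_lge0 _ pa0); exact: le_trans mc.
have V0 : 0 <= V.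
  by apply: mulr_ge0 => //; apply: mulr_ge0 => //; rewrite !mulr_ge0 ?pi_ge0// ltW.
have dv0 : 0 <= quad_const q mu * dev_var N G MW m.
  by apply: mulr_ge0 => //; apply: mulr_ge0 => //; rewrite !mulr_ge0 ?pi_ge0// ltW.
have h1 : quad_const q mu * dev_var N G MW m <= V * N ^^ (1 + alpha).
  rewrite /dev_var /V pD powRr1//.
  have -> : quad_const q mu * (G ^+ 4 * (4 * pi * (c2 * MW))) * (N%:R * N ^^ alpha) =
      quad_const q mu * (G ^+ 4 * (4 * pi * MW * N%:R * (c2 * N ^^ alpha))) by ring.
  apply: ler_wpM2l => //; apply: ler_wpM2l => //.
  rewrite (_ : N%:R * (2 * (2 * pi * (m * MW))) = 4 * pi * MW * N%:R * m); last by ring.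
  by rewrite ler_wpM2l// !mulr_ge0 ?pi_ge0// ltW.
have h2 : (quad_const q mu * dev_var N G MW m) ^+ q <= V ^+ q * N ^^ ((1 + alpha) * q%:R).
  rewrite powRrM powR_mulrn ?powR_ge0// -exprMn lerXn2r// nnegrE.
  by rewrite mulr_ge0// powR_ge0.
have h3 : (N ^^ rho) ^+ (2 * q) = N ^^ (q%:R + 3 + 2 * q%:R * alpha).
  rewrite -powR_mulrn ?powR_ge0// -powRrM; congr (_ `^ _).
  by rewrite natrM; field; rewrite gt_eqF.
have h4 : s%:R <= 4 * K.+1%:R * N ^^ 3.
  rewrite powR_mulrn//; apply: (@le_trans _ _ (N.+1 * N.+1 * (N * K.+1))%N%:R); first by rewrite ler_nat.
  rewrite -!natrX -!natrM ler_nat; apply: (@leq_trans (2 * N * (2 * N) * (N * K.+1))).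
    have NN : (N.+1 <= 2 * N)%N by rewrite mul2n -addnn -addn1 leq_add2l.
    by apply: leq_mul => //; exact: leq_mul.
  by rewrite leq_eqVlt; apply/orP; left; apply/eqP; ring.
have h5 : N ^^ 3 * (N ^^ ((1 + alpha) * q%:R) / N ^^ (q%:R + 3 + 2 * q%:R * alpha)) = (N ^^ (q%:R * alpha))^-1.
  rewrite -pB -pD -powRN; congr (_ `^ _).
  by ring.
rewrite h3 -h5; set D := N ^^ (q%:R + 3 + 2 * q%:R * alpha).
have D0 : 0 < D by exact: powR_gt0.
have e0 := expR_ge0 (4 ^+ q : R).
rewrite [leRHS](_ : _ = (4 * K.+1%:R * N ^^ 3) * (expR (4 ^+ q) * (V ^+ q * N ^^ ((1 + alpha) * q%:R)) / D)); last by ring.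
apply: ler_pM => //.
  by apply: divr_ge0; [apply: mulr_ge0 => //; exact: exprn_ge0|exact: ltW].
by rewrite ler_wpM2r ?invr_ge0 ?(ltW D0)// ler_wpM2l.
Qed.

End Rates.

Theorem theorem2
  (R : realType) (d : measure_display) (T : measurableType d)
  (P : probability T R)
  (* change points *)
  (K : nat) (hK : (1 <= K)%N) (kappa : nat -> R)
  (hkappa0 : kappa 0%N = 0) (hkappa1 : kappa K.+1 = 1)
  (hkappa : forall k, (k <= K)%N -> kappa k < kappa k.+1)
  (* innovations and observations; segment k : 'I_K.+1 is the (k+1)-st one *)
  (xi : int -> {RV P >-> R}) (sigma : R)
  (hindep : mutually_independent P (fun t => xi t : T -> R))
  (hid : identically_distributed P (fun t => xi t : T -> R))
  (hmean : forall t, ('E_P[xi t] = 0)%E)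
  (hvar : forall t, ('V_P[xi t] = (sigma ^+ 2)%:E)%E)
  (a : 'I_K.+1 -> int -> R)
  (X : nat -> nat -> {RV P >-> R})
  (hX : forall (N : nat) (k : 'I_K.+1) (t : nat),
    (true_cp kappa N k < t <= true_cp kappa N k.+1)%N ->
    {ae P, forall w : T,
      zsum (fun j : int => a k j * xi (t%:Z - j) w) @ \oo --> X N t w})
  (* (A1) *)
  (q : nat) (hq : (3 <= q)%N)
  (hmom : forall t, ('E_P[fun w => (xi t w ^+ (8 * q))%R] < +oo)%E)
  (ha : forall k, summable [set: int] (fun j => (a k j)%:E))
  (* (A2) *)
  (W : R -> R)
  (hW0 : forall u, 0 <= W u)
  (hWeven : forall u, W (- u) = W u)
  (hWbnd : exists M : R, forall u, W u <= M)
  (hWint : lebesgue_measure.-integrable [set: R] (fun u => (W u)%:E))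
  (hW1 : (\int[lebesgue_measure]_(v in `[(- pi)%R, pi%R]) (W v)%:E = 1)%E)
  (hWq : (\int[lebesgue_measure]_(v in `[(- pi)%R, pi%R])
            ((W v `^ (1 - 1 / (2 * q)%:R))%R)%:E < +oo)%E)
  (* (A3) *)
  (m : nat -> R) (cmin : R) (hcmin : 0 < cmin)
  (hNmin : ((Nmin K kappa N)%:R / N%:R : R) @[N --> \oo] --> cmin)
  (hNminm : \forall N \near \oo, m N < (Nmin K kappa N)%:R)
  (* (A4) *)
  (hfpos : forall k u, u \in `[- pi, pi] -> 0 < spectral_density sigma (a k) u)
  (hflip : forall k, exists B : R, forall u1 u2,
    u1 \in `[- pi, pi] -> u2 \in `[- pi, pi] ->
    `|spectral_density sigma (a k) u1 - spectral_density sigma (a k) u2|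
      <= B * `|u1 - u2|)
  (* (A5) *)
  (alpha : R) (halpha : 1 / 4 <= alpha)
  (halphaq : alpha + 3 / (2 * q)%:R < 1 / 2)
  (hm : exists c1 c2 : R, [/\ 0 < c1, 0 < c2 &
    \forall N \near \oo,
      c1 * (N%:R `^ alpha) <= m N <= c2 * (N%:R `^ alpha)])
  (* (A6) *)
  (hw0 : invFourier_re W 0 = 1 /\ invFourier_im W 0 = 0)
  (hw : has_cont_derivs (2 * q) (invFourier_re W) /\
        has_cont_derivs (2 * q) (invFourier_im W))
  (* (A7) *)
  (hlin : lin_indep_on `[- pi, pi] (fun k => spectral_density sigma (a k)))
  (* (A8) *)
  (cml : R) (hcml : 0 < cml)
  (hml : \forall N \near \oo, cml * N%:R < (Nmin K kappa N)%:R)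
  (* frequency grids *)
  (Lam : nat -> seq R)
  (hLamuniq : forall N, uniq (Lam N))
  (hLamsize : forall N, (1 <= N)%N -> (1 <= size (Lam N) <= N)%N)
  (hLam : forall N u, u \in Lam N -> u \in `[- pi, pi])
  (hLamKL : forall k l,
    grid_separates Lam (spectral_density sigma (a k))
                       (spectral_density sigma (a l)))
  (* baseline *)
  (B : baseline)
  (hB : B = white_noise -> forall k, ~ exists c : R, forall u,
    u \in `[- pi, pi] -> spectral_density sigma (a k) u = c)
  (* penalty and estimator *)
  (Kmax : nat) (hKmax : (K < Kmax)%N)
  (C : nat -> R)
  (hC0 : (C N / N%:R) @[N --> \oo] --> (0 : R))
  (hCoo : (C N / (N%:R `^ ((q%:R + 3 + 2 * q%:R * alpha) / (2 * q%:R))))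
            @[N --> \oo] --> +oo)
  (Khat : nat -> {RV P >-> nat})
  (hKhat : \forall N \near \oo, forall w : T,
    BIC_minimizer B (Lam N) W (m N) N (fun t => X N t w)
      (cml * N%:R) (C N) Kmax (Khat N w)) :
  (P [set w | Khat N w = K]) @[N --> \oo] --> 1%E.
Proof.
have q0 : (0 < q)%N by exact: leq_trans hq.
have pi0 := @pi_gt0 R.
have [Bf Bf0 hB2] := common_lipschitz hflip.
have [c0 [c1 [c00 c01 fc]]] := common_bounds hflip hfpos.
have WR := window_total hWint hw0.1.
have [MW [MW0 WM]] : exists MW, 0 < MW /\ forall u, W u <= MW.
  have [M hM] := hWbnd; exists (`|M| + 1); split; first by rewrite ltr_wpDl.
  by move=> u; apply: le_trans (hM u) _; apply: le_trans (ler_norm M) _; rewrite lerDl.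
have [mu [mu1 mu2 mu4 sgmu]] := moment_bound sigma q0 hid.
have mom i : P.-integrable [set: T] (fun w => (`|xi i w| ^+ (4 * q))%:E).
  by apply: (integrable_norm_pow q0 hmom); rewrite leq_mul2r orbT.
have [A [G [G0 aA saA hG tailA]]] := dominating_sequence sigma ha.
have Lam0 N : (1 <= N)%N -> (0 < size (Lam N))%N by move=> /hLamsize /andP[].
have [eta0 [eta00 gap]] := KLdiv_gap hfpos hlin hLam Lam0 hLamKL.
have gc0 : 0 < gap_const c0 c1.
  have c10 : 0 < c1 by exact: lt_le_trans c01.
  rewrite /gap_const; have : 0 < 2 * c1 / c0 by rewrite divr_gt0// mulr_gt0.
  move: (2 * c1 / c0) => r r0; have r1 : 0 < 1 + (r ^+ 2) ^+ 2 by rewrite ltr_wpDr// sqr_ge0.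
  apply: divr_gt0; last by rewrite !mulr_gt0.
  by apply: mulr_gt0; [apply: mulr_gt0 => //; rewrite !mulr_gt0|rewrite exprn_gt0].
have LL0 : 0 <= ln_bound c0 c1 by exact: ln_bound_ge0.
have [eta [eta_gt0 etaE]] : exists eta, 0 < eta /\ 2 * eta * gap_const c0 c1 = eta0.
  exists (eta0 / (2 * gap_const c0 c1)); split; first by rewrite divr_gt0// mulr_gt0.
  by field; rewrite gt_eqF.
set LL := ln_bound c0 c1 in LL0 *.
have [dl [dl0 dlc hdl]] : exists dl, [/\ 0 < dl, dl <= c0 / 8 & 4 * pi * LL * dl <= eta / 2].
  have L1 : 0 < 8 * pi * (LL + 1) by rewrite !mulr_gt0// ltr_wpDl.
  exists (Num.min (c0 / 8) (eta / (8 * pi * (LL + 1)))).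
  split; [by rewrite lt_min !divr_gt0|by rewrite ge_min lexx|].
  have h : Num.min (c0 / 8) (eta / (8 * pi * (LL + 1))) <= eta / (8 * pi * (LL + 1)).
    by rewrite ge_min lexx orbT.
  apply: (@le_trans _ _ (4 * pi * (LL + 1) * (eta / (8 * pi * (LL + 1))))).
    apply: ler_pM => //; first by rewrite !mulr_ge0// ltW.
      by rewrite le_min !divr_ge0// ltW.
    by rewrite ler_wpM2l ?mulr_ge0 ?(ltW pi0)// lerDl.
  rewrite le_eqVlt; apply/orP; left; apply/eqP.
  have : LL + 1 != 0 by rewrite gt_eqF// ltr_wpDl.
  by move: (LL + 1) (pi : R) (lt0r_neq0 pi0) => l p p0 l0; field; rewrite l0 p0.
(* The tail level for which the coefficient 4 eps G of the foreign times in [bias_bound_rate] is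
   exactly dl. *)
have [H hH] := tailA (dl / (4 * G)) (divr_gt0 dl0 (mulr_gt0 (ltr0n R 4) G0)).
set eps := dl / (4 * G) in hH.
have epsG : 4 * eps * G = dl by rewrite /eps; field; rewrite gt_eqF.
have [b1 [b2 [b10 b20 hmN]]] := hm.
pose CE := 2 + 8 * Bf * (K.+1%:R + 1) + 2 * G ^+ 2 * (K.+2%:R * (H.*2.+1).*2.+1%:R) + Bf * (pi / b1).
have CE0 : 0 <= CE.
  rewrite /CE; apply: addr_ge0; last by apply: mulr_ge0 => //; apply: divr_ge0; exact: ltW.
  apply: addr_ge0; last by apply: mulr_ge0; [apply: mulr_ge0 => //; exact: sqr_ge0|exact: mulr_ge0].
  by apply: addr_ge0 => //; apply: mulr_ge0; [exact: mulr_ge0|exact: addr_ge0].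
set rho := (q%:R + 3 + 2 * q%:R * alpha) / (2 * q%:R).
have alpha0 : 0 < alpha by apply: lt_le_trans halpha.
pose t0 N := true_cp kappa N.
have t00 N : t0 N 0 = 0%N by rewrite /t0 /true_cp hkappa0 mul0r truncn0.
have t0N N : t0 N K.+1 = N by rewrite /t0 /true_cp hkappa1 mul1r natrK.
have t0S N k : (k <= K)%N -> (t0 N k <= t0 N k.+1)%N.
  by move=> kK; apply: le_truncn; rewrite ler_wpM2r// ltW// hkappa.
pose f k := spectral_density sigma (a k).
pose cnt N x y (l : 'I_K.+1) : R := (seg_count (t0 N) l x y)%:R.
pose off N x y (k : 'I_K.+1) : R := \sum_(l < K.+1 | l != k) cnt N x y l.
pose kap N u := pint (kernel W (m N) u).
pose dev N x y u w := `|(y - x)%:R * spec_est W (m N) (fun t => X N t w) x y u -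
  kap N u * \sum_(l < K.+1) cnt N x y l * f l u|.
(* The exceptional event of the segment ]x, y], the frequency u and the true segment k whose times
   are not counted as foreign. It is empty unless x < y <= N, so that all pairs up to N can be
   enumerated. *)
pose F N (i : (nat * nat) * (R * 'I_K.+1)) : set T :=
  if (i.1.1 < i.1.2 <= N)%N then
    [set w | (bias_bound Bf G eps (N%:R `^ (1 / 2)) (m N) H K N (off N i.1.1 i.1.2 i.2.2) +
      N%:R `^ rho < dev N i.1.1 i.1.2 i.2.1 w)%R]
  else set0.
pose idx N := [seq (p, l) | p <- [seq (x, y) | x <- iota 0 N.+1, y <- iota 0 N.+1],
  l <- [seq (u, k) | u <- Lam N, k <- enum 'I_K.+1]].
pose bad N := \bigcup_(i in [set` idx N]) F N i.
pose S N := [set w | Khat N w = K].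
have mS N : measurable (S N).
  have := @measurable_funPT _ _ _ _ (Khat N) measurableT [set K] I.
  by rewrite setTI.
pose V := 4 * K.+1%:R * expR (4 ^+ q) * (quad_const q mu * (G ^+ 4 * (4 * pi * (b2 * MW)))) ^+ q.
have Fm N : 1 <= m N -> forall i, measurable (F N i).
  move=> m1 [[x y] [u k]]; rewrite /F /=; case: ifPn => // /andP[xy _].
  rewrite -[X in measurable X]setTI; apply: (@measurable_fun_ltr _ _ _ _ (cst _)) => //.
  apply: measurableT_comp => //; apply: measurable_funB => //.
  by apply: (measurable_spec_est (X := fun t => X N t)) => //.
have badP N : (1 <= N)%N -> 1 <= m N -> b1 * N%:R `^ alpha <= m N <= b2 * N%:R `^ alpha ->
    (P (bad N) <= (V * (N%:R `^ (q%:R * alpha))^-1)%:E)%E.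
  move=> N1 m1 /andP[mb1 mb2].
  have NR0 : (0 : R) < N%:R by rewrite ltr0n.
  apply: le_trans (probability_bigcup_seq (c := expR (4 ^+ q) * (quad_const q mu * dev_var N G MW (m N)) ^+ q /
    (N%:R `^ rho) ^+ (2 * q)) (Fm N m1) _) _.
    move=> [[x y] [u k]] /allpairsP[[p l] /= [_ /allpairsP[[u' k'] /= [uL _ ->]] [_ -> _]]].
    rewrite /F /=; case: ifPn => [xyN|_]; last first.
      rewrite measure0 lee_fin; have mu0 : 0 <= mu by exact: le_trans mu1.
      have qc : 0 <= quad_const q mu.
        by rewrite /quad_const !(mulr_ge0, addr_ge0, exprn_ge0, expR_ge0).
      apply: divr_ge0; last by rewrite exprn_ge0// powR_ge0.
      apply: mulr_ge0; first exact: expR_ge0.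
      apply: exprn_ge0; apply: mulr_ge0 => //; apply: mulr_ge0; first by rewrite exprn_ge0// ltW.
      by rewrite !mulr_ge0// ltW// (lt_le_trans ltr01).
    have mXN t : measurable_fun [set: T] (X N t : T -> R) by exact: measurable_funPT.
    have tp : 0 < N%:R `^ (1 / 2) :> R by exact: powR_gt0.
    have rp : 0 < N%:R `^ rho :> R by exact: powR_gt0.
    exact: (spec_deviation (xi := fun t => xi t : T -> R) (X := fun t => X N t : T -> R) q0
      (fun t => measurable_RV xi t) hindep mom (Rintegral_RV hmean) (Rintegral_RV_sqr hmean hvar)
      mu1 mu2 mu4 sgmu (t00 N) (t0N N) (@t0S N) ha mXN (@hX N) G0 aA saA hG hH Bf0 hB2 hW0 MW0 WM hWint hW1 WR m1
      (hLam N _ uL) tp k xyN rp).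
  rewrite lee_fin /V; apply: deviation_rate => //; first exact: le_trans m1.
  rewrite !size_allpairs !size_iota size_enum_ord leq_mul// leq_mul//.
  by have /andP[] := hLamsize N N1.
(* A ceiling for C_N / N. The first bound makes the error at most dl per time of a segment of
   minimal length; the second makes (K + 1) C_N at most the loss of a missed true segment. *)
have [ec [ec0 ec1 ec2]] : exists ec, [/\ 0 < ec, ec <= dl * cml & K.+1%:R * ec <= eta / 2 * (cmin / 2)].
  exists (Num.min (dl * cml) (eta / 2 * (cmin / 2) / K.+1%:R)); split.
  - by rewrite lt_min mulr_gt0//= divr_gt0// mulr_gt0// divr_gt0.
  - by rewrite ge_min lexx.
  by rewrite mulrC -ler_pdivlMr// ge_min lexx orbT.
pose slack := (Kmax.+1 + K.+1)%:R * (4 * pi * LL).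
have slack0 : 0 <= slack by rewrite !mulr_ge0// ltW.
(* A floor for C_N / N^rho. It makes C_N exceed both the slack and the error CE N^rho itself; the
   latter is thereby compared with N through C_N. *)
pose M := slack * CE + CE + 1.
have good N w : (1 <= N)%N -> 1 <= m N -> b1 * N%:R `^ alpha <= m N <= b2 * N%:R `^ alpha ->
    cmin / 2 <= (Nmin K kappa N)%:R / N%:R -> cml * N%:R < (Nmin K kappa N)%:R ->
    (forall k l, k != l -> eta0 <= KLdiv (Lam N) (f k) (f l)) ->
    C N / N%:R <= ec -> M <= C N / N%:R `^ rho ->
    BIC_minimizer B (Lam N) W (m N) N (fun t => X N t w) (cml * N%:R) (C N) Kmax (Khat N w) ->
    ~ bad N w -> S N w.
  move=> N1 m1 /andP[mb1 mb2] Nc Ncml gapN CN CM bic nbad.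
  have NR0 : (0 : R) < N%:R by rewrite ltr0n.
  have r0 : 0 < N%:R `^ rho :> R by exact: powR_gt0.
  have CM' : M * N%:R `^ rho <= C N by rewrite -ler_pdivlMr.
  have CN' : C N <= ec * N%:R by rewrite -ler_pdivrMr.
  have NmN (k : 'I_K.+1) : (Nmin K kappa N)%:R <= (t0 N k.+1 - t0 N k)%:R :> R.
    by rewrite ler_nat; exact: Nmin_le.
  have E0 : 0 <= CE * N%:R `^ rho by apply: mulr_ge0 => //; exact: powR_ge0.
  have sE0 : 0 <= slack * (CE * N%:R `^ rho) by exact: mulr_ge0.
  have ME : M * N%:R `^ rho = slack * (CE * N%:R `^ rho) + CE * N%:R `^ rho + N%:R `^ rho.
    by rewrite /M; ring.
  have slackC : slack * (CE * N%:R `^ rho) < C N.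
    by apply: lt_le_trans CM'; rewrite ME -addrA ltrDl ltr_wpDl.
  apply: (path_selection (f := f) (kap := kap N) (t0 := t0 N) (c0 := c0) (c1 := c1) (eta := eta)
    (E := CE * N%:R `^ rho) (dl := dl) (Nm := (Nmin K kappa N)%:R)) bic.
  - exact: Lam0.
  - by rewrite hK ltnW.
  - split => // k kK; have h : cml * N%:R < (t0 N k.+1 - t0 N k)%:R.
      by apply: lt_le_trans Ncml _; exact: (NmN (Ordinal (kK : (k < K.+1)%N))).
    split; last exact: ltW.
    by rewrite -subn_gt0 -(ltr0n R); apply: le_lt_trans h; rewrite mulr_ge0// ltW.
  - by [].
  - by [].
  - by move=> k u uL; apply: fc; exact: hLam uL.
  - move=> u uL; rewrite (pint_kernel_ge hW0 hWeven hWint hW1 WR m1 (hLam N u uL)) /=.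
    exact: pint_kernel_le1.
  - move=> x y u k xyN uL; rewrite leNgt; apply/negP => h; apply: nbad.
    exists ((x, y), (u, k)).
      have [xy yN] := andP xyN.
      apply: allpairs_f; apply: allpairs_f; rewrite ?mem_iota ?mem_enum//=.
      by rewrite add0n ltnS ltnW// (leq_trans xy).
    rewrite /F /= xyN /=; apply: le_lt_trans h.
    have := bias_bound_rate q0 N1 halpha G eps (off N x y k) H K Bf0 b10 mb1.
    by rewrite epsG.
  - exact: E0.
  - apply: (@le_trans _ _ (C N)); first by apply: le_trans CM'; rewrite ME -addrA addrCA lerDl addr_ge0// ltW.
    by apply: le_trans CN' _; rewrite mulrA ler_wpM2r// ltW.
  - exact: ltW.
  - by [].
  - by rewrite mulr_gt0.
  - by move=> k l kl; rewrite etaE; exact: gapN.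
  - by [].
  - by [].
  - exact: NmN.
  - by rewrite mulrA.
  rewrite mulrA -/LL -/slack; apply: (@lt_le_trans _ _ (K.+1%:R * C N)).
    have -> : K.+1%:R * C N = C N + K%:R * C N by rewrite -natr1; ring.
    by rewrite ltrD2r.
  apply: (@le_trans _ _ (eta / 2 * (cmin / 2) * N%:R)).
    apply: (@le_trans _ _ (K.+1%:R * (ec * N%:R))); first by rewrite ler_wpM2l.
    by rewrite mulrA ler_wpM2r// ltW.
  rewrite -mulrA ler_wpM2l//; first by rewrite divr_ge0// ltW.
  by rewrite -ler_pdivlMr.
apply/fine_cvgP; split.
  by apply: nearW => N; apply: fin_num_measure; exact: mS.
apply/cvgrPdist_le => e e0; near=> N.
have N1 : (1 <= N)%N by near: N; exact: nbhs_infty_ge.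
have NR0 : (0 : R) < N%:R by rewrite ltr0n.
have mN : b1 * N%:R `^ alpha <= m N <= b2 * N%:R `^ alpha by near: N.
have m1 : 1 <= m N.
  have /andP[h _] := mN; apply: le_trans h; rewrite -ler_pdivrMl// mulr1.
  by near: N; exact: powR_nat_pinfty.
have badN := badP N N1 m1 mN.
have small : V * (N%:R `^ (q%:R * alpha))^-1 <= e.
  rewrite ler_pdivrMr ?powR_gt0// mulrC -ler_pdivrMr//.
  by near: N; apply: powR_nat_pinfty; rewrite mulr_gt0// ltr0n.
have bicN w : BIC_minimizer B (Lam N) W (m N) N (fun t => X N t w) (cml * N%:R) (C N) Kmax (Khat N w).
  by move: w; near: N.
(* Covering the space by the success and the bad event gives the lower bound 1 - P(bad N) for the
   probability of success. *)
have sub : [set: T] `<=` S N `|` bad N.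
  move=> w _; have [bw|nbw] := pselect (bad N w); [by right|left].
  apply: (good N w) => //.
  - near: N; by apply: (cvgr_ge cmin) => //; rewrite ltr_pdivrMr// mulr_natr mulr2n ltrDl.
  - by near: N.
  - by near: N.
  - near: N; apply: (cvgr_le 0) => //.
  - near: N; move/cvgryPge : hCoo; apply.
have bm : measurable (bad N).
  by apply: fin_bigcup_measurable; [exact: finite_seq|move=> i _; exact: Fm].
have fS : P (S N) \is a fin_num by apply: fin_num_measure; exact: mS.
have SE : P (S N) = (fine (P (S N)))%:E by rewrite fineK.
have S1 : fine (P (S N)) <= 1 by rewrite -lee_fin -SE; exact: probability_le1.
have : (1 <= P (S N) + P (bad N))%E.
  rewrite -(probability_setT P); apply: (@le_trans _ _ (P (S N `|` bad N))).
    by apply: le_measure; rewrite ?inE//; exact: measurableU.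
  exact: measureU2.
move=> h; have {h} : (1%:E <= (fine (P (S N)))%:E + (V * (N%:R `^ (q%:R * alpha))^-1)%:E)%E.
  by apply: le_trans h _; rewrite -SE leeD2l.
rewrite -EFinD lee_fin => h.
rewrite /= ger0_norm ?subr_ge0// lerBlDl; apply: le_trans h _.
by rewrite -/(S N) lerD2l.
Unshelve. all: by end_near. Qed.
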